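(* Let $u_0\in\mathcal{M}$. There exist constants $C_u>0$, $C_g>0$ and $0<C_\alpha\le 1$, depending only on $\Omega$, $d$, $\beta$, $V$ and $\|u_0\|_{H_0^1(\Omega)}$, such that whenever $0<\alpha_{\min}\le\alpha_n\le\alpha_{\max}\le C_\alpha$ for all $n\ge 0$, the iterates $\{u_n\}_{n=0}^\infty\subset\mathcal{M}$ of the $H^1$-scheme $u_{n+1}=R\big(u_n-\alpha_n\nabla^{\mathcal{R}}_{H^1}E(u_n)\big)$, $n\ge 0$, started at $u_0$ satisfy, for every $n\ge 0$: (i) $\|u_n\|_{H_0^1(\Omega)}\le C_u$; (ii) $\|\nabla^{\mathcal{R}}_{H^1}E(u_n)\|_{H_0^1(\Omega)}\le\|\nabla_{H^1}E(u_n)\|_{H_0^1(\Omega)}\le C_g$; (iii) $E(u_n)-E(u_{n+1})\ge\frac{\alpha_{\min}}{2}\|\nabla^{\mathcal{R}}_{H^1}E(u_n)\|_{H_0^1(\Omega)}^2$.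
   Context: Standing assumptions: $d\in\{1,2,3\}$, $\Omega\subset\mathbb{R}^d$ is a bounded Lipschitz domain, $V\in L^\infty(\Omega)$ with $0\le V\le V_{\max}<\infty$, $\beta\ge 0$; functions are real-valued. $H_0^1(\Omega)$ carries the inner product $(z,w)_{H_0^1(\Omega)}=(\nabla z,\nabla w)_{L^2(\Omega)}$ and the induced norm. Energy: $E(u)=\int_\Omega\frac12|\nabla u|^2+\frac12V|u|^2+\frac{\beta}{4}|u|^4$ for $u\in H_0^1(\Omega)$. Manifold: $\mathcal{M}=\{u\in H_0^1(\Omega):\|u\|_{L^2(\Omega)}=1\}$. Retraction: $R(u)=u/\|u\|_{L^2(\Omega)}$ for $u\in H_0^1(\Omega)\setminus\{0\}$. Green's operator: for $w\in L^2(\Omega)$, $\mathcal{G}_{H^1}w\in H_0^1(\Omega)$ is the unique element with $(z,\mathcal{G}_{H^1}w)_{H_0^1(\Omega)}=(z,w)_{L^2(\Omega)}$ for all $z\in H_0^1(\Omega)$. (For $u\in H_0^1(\Omega)$ and $d\le3$, $Vu+\beta|u|^2u\in L^2(\Omega)$.) $H^1$-gradient: $\nabla_{H^1}E(u)=u+\mathcal{G}_{H^1}(Vu+\beta|u|^2u)$. Riemannian $H^1$-gradient at $u\in\mathcal{M}$: $$\nabla^{\mathcal{R}}_{H^1}E(u)=u+\mathcal{G}_{H^1}(Vu+\beta|u|^2u)-\frac{1+(\mathcal{G}_{H^1}(Vu+\beta|u|^2u),u)_{L^2(\Omega)}}{\|\mathcal{G}_{H^1}u\|_{H_0^1(\Omega)}^2}\,\mathcal{G}_{H^1}u.$$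 *)

(* Defs.v *)
From HB Require Import structures.
From mathcomp Require Import all_boot all_order all_algebra.
From mathcomp Require Import all_classical all_reals all_analysis.

Set Implicit Arguments.
Unset Strict Implicit.
Unset Printing Implicit Defensive.

Import Order.TTheory GRing.Theory Num.Theory.
Import numFieldNormedType.Exports.

Local Open Scope classical_set_scope.
Local Open Scope ring_scope.

Definition rV_coord (R : realType) (n : nat) (i : 'I_n) (x : 'rV[R]_n) : R :=
  x ord0 i.

(* 'rV[R]_n carries the sigma-algebra generated by the coordinate functions,
   which is the Borel sigma-algebra of R^n. *)
Section measurable_rV.
Context (R : realType) (n : nat).

Let rV_set0 : g_sigma_preimage (@rV_coord R n) set0.
Proof. exact: sigma_algebra0. Qed.

Let rV_setC A :
  g_sigma_preimage (@rV_coord R n) A -> g_sigma_preimage (@rV_coord R n) (~` A).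
Proof. exact: sigma_algebraC. Qed.

Let rV_bigcup (F : (set 'rV[R]_n)^nat) :
  (forall i, g_sigma_preimage (@rV_coord R n) (F i)) ->
  g_sigma_preimage (@rV_coord R n) (\bigcup_i (F i)).
Proof. exact: sigma_algebra_bigcup. Qed.

HB.instance Definition _ := @isMeasurable.Build default_measure_display
  'rV[R]_n (g_sigma_preimage (@rV_coord R n)) rV_set0 rV_setC rV_bigcup.

End measurable_rV.

Section rV_cons.
Context (R : realType) (n : nat).

Definition rV_cons (p : R * 'rV[R]_n) : 'rV[R]_n.+1 :=
  \row_i oapp (fun j => p.2 ord0 j) p.1 (unlift ord0 i).

Definition rV_uncons (x : 'rV[R]_n.+1) : R * 'rV[R]_n :=
  (x ord0 ord0, \row_j x ord0 (lift ord0 j)).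

Lemma rV_consK : cancel rV_cons rV_uncons.
Proof.
move=> [a v]; rewrite /rV_uncons /rV_cons !mxE unlift_none/=; congr pair.
by apply/rowP => j; rewrite !mxE liftK.
Qed.

End rV_cons.

Section measurable_rV_lemmas.
Context (R : realType).

Lemma measurable_rV_coord n (i : 'I_n) :
  measurable_fun [set: 'rV[R]_n] (@rV_coord R n i).
Proof.
move=> _ Y mY; rewrite setTI; apply: sub_sigma_algebra => /=.
rewrite -bigcup_seq/=; exists i => /=; first by rewrite mem_index_enum.
by exists Y => //; rewrite setTI.
Qed.

Lemma measurable_fun_rV d (T : measurableType d) n (f : T -> 'rV[R]_n) :
  (forall i, measurable_fun [set: T] (fun t => rV_coord i (f t))) ->
  measurable_fun [set: T] f.
Proof.
move=> mf _ A mA; rewrite setTI.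
pose G := [set B : set 'rV[R]_n | measurable (f @^-1` B)].
suff : measurable `<=` G by apply.
apply: smallest_sub.
  split=> [|B|F] /=; rewrite /G/=.
  - by rewrite preimage_set0.
  - by move=> mB; rewrite setTD preimage_setC; exact: measurableC.
  - by move=> mF; rewrite preimage_bigcup; exact: bigcupT_measurable.
rewrite -bigcup_seq/= => B [i _ [C mC <-]]; rewrite /G/= setTI.
by rewrite -comp_preimage -[X in measurable X]setTI; exact: mf.
Qed.

Lemma measurable_rV_cons n :
  measurable_fun [set: measurableTypeR R * 'rV[R]_n] (@rV_cons R n).
Proof.
apply: measurable_fun_rV => i.
rewrite /rV_coord /rV_cons.
under eq_fun do rewrite mxE.
case: (unlift ord0 i) => [j|] /=; last exact: measurable_fst.
by apply: (measurableT_comp (measurable_rV_coord j)).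
Qed.

Lemma measurable_rV_uncons n :
  measurable_fun [set: 'rV[R]_n.+1]
    (@rV_uncons R n : 'rV[R]_n.+1 -> measurableTypeR R * 'rV[R]_n).
Proof.
apply/measurable_fun_pairP; split; first exact: (measurable_rV_coord ord0).
apply: measurable_fun_rV => i; rewrite /rV_coord /=.
under eq_fun do rewrite mxE.
exact: (measurable_rV_coord (lift ord0 i)).
Qed.

End measurable_rV_lemmas.

Section lebesgue_step.
Local Open Scope ereal_scope.
Context (R : realType) (n : nat).
Variable m : {sigma_finite_measure set 'rV[R]_n -> \bar R}.

Definition lebesgue_step : set 'rV[R]_n.+1 -> \bar R :=
  pushforward (@lebesgue_measure R \x m)
    (@rV_cons R n : measurableTypeR R * 'rV[R]_n -> 'rV[R]_n.+1).

Let step0 : lebesgue_step set0 = 0.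
Proof. by rewrite /lebesgue_step /pushforward preimage_set0 measure0. Qed.

Let step_ge0 A : 0 <= lebesgue_step A.
Proof. by rewrite /lebesgue_step /pushforward; exact: measure_ge0. Qed.

Let step_sigma_additive : semi_sigma_additive lebesgue_step.
Proof.
move=> F mF tF mUF.
have mp A : measurable A -> measurable (@rV_cons R n @^-1` A).
  by move=> mA; rewrite -[X in measurable X]setTI; exact: measurable_rV_cons.
rewrite /lebesgue_step /pushforward preimage_bigcup.
apply: measure_semi_sigma_additive => [k| |]; [exact: mp| |].
- apply/trivIsetP => /= i j _ _ ij; rewrite -preimage_setI.
  by move/trivIsetP : tF => /(_ _ _ _ _ ij) ->//; rewrite preimage_set0.
- by rewrite -preimage_bigcup; exact: mp.
Qed.

HB.instance Definition _ := isMeasure.Build _ _ _ lebesgue_step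
  step0 step_ge0 step_sigma_additive.

Let step_sigma_finite : sigma_finite setT lebesgue_step.
Proof.
have /sigma_finiteP[F [TF ndF Foo]] := sigma_finiteT (@lebesgue_measure R).
have /sigma_finiteP[G [TG ndG Goo]] := sigma_finiteT m.
exists (fun k => @rV_uncons R n @^-1` (F k `*` G k)).
  rewrite -preimage_bigcup (_ : \bigcup_k (F k `*` G k) = setT) ?preimage_setT//.
  apply/seteqP; split => // -[x y] _.
  have [k _ Fx] : (\bigcup_k F k) x by rewrite -TF.
  have [l _ Gy] : (\bigcup_k G k) y by rewrite -TG.
  exists (maxn k l) => //; split => /=.
  - by move: x Fx; exact/subsetPset/ndF/leq_maxl.
  - by move: y Gy; exact/subsetPset/ndG/leq_maxr.
move=> k; have [mF Fk] := Foo k; have [mG Gk] := Goo k; split.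
  rewrite -[X in measurable X]setTI; apply: measurable_rV_uncons => //.
  exact: measurableX.
rewrite /lebesgue_step /pushforward -comp_preimage.
rewrite (_ : _ \o _ = id) ?preimage_id; last first.
  by apply/funext => p /=; rewrite rV_consK.
by rewrite product_measure1E// lte_mul_pinfty// ge0_fin_numE.
Qed.

HB.instance Definition _ := Measure_isSigmaFinite.Build _ _ _ lebesgue_step
  step_sigma_finite.

End lebesgue_step.

(* Lebesgue measure on R^n: the n-fold product of the Lebesgue measure of R,
   transported along R * R^n ~ R^(n+1). *)
Fixpoint lebesgue_rV (R : realType) (n : nat) :
    {sigma_finite_measure set 'rV[R]_n -> \bar R} :=
  match n with
  | 0 => \d_(0 : 'rV[R]_0)
  | n'.+1 => lebesgue_step (lebesgue_rV R n')
  end.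

Section lipschitz_domain.
Context (R : realType) (d : nat).
Implicit Types (Omega : set 'rV[R]_d) (x y nu : 'rV[R]_d).

Definition dotv x y : R := \sum_i x ord0 i * y ord0 i.

(* Near every boundary point, Omega is the open epigraph of a Lipschitz
   function gamma of the orthogonal projection y - (y . nu) nu of y on the
   hyperplane normal to some unit vector nu; nu plays the role of the last
   basis vector of a rotated Cartesian frame. *)
Definition lipschitz_boundary Omega : Prop :=
  forall x, (closure Omega `\` interior Omega) x ->
  exists (nu : 'rV[R]_d) (gamma : 'rV[R]_d -> R),
    [/\ dotv nu nu = 1,
        [lipschitz gamma y | y in [set y | dotv y nu = 0]] &
        \forall y \near x,
          Omega y <-> gamma (y - dotv y nu *: nu) < dotv y nu].

Definition bounded_lipschitz_domain Omega : Prop :=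
  [/\ open Omega, connected Omega, Omega !=set0, bounded_set Omega &
      lipschitz_boundary Omega].

End lipschitz_domain.

(* Elements of the function spaces over Omega are represented by functions on
   'rV[R]_d, whose values outside Omega are irrelevant; equality in these spaces
   is equality almost everywhere on Omega. *)
Section sobolev.
Context (R : realType) (d : nat).
Variable Omega : set 'rV[R]_d.
Implicit Types (f g u v w z phi : 'rV[R]_d -> R) (i : 'I_d) (s : seq 'I_d).

Local Notation mu := (lebesgue_rV R d).

Definition pderiv i f : 'rV[R]_d -> R := 'D_(delta_mx ord0 i) f.

Definition iter_pderiv s f : 'rV[R]_d -> R := foldr pderiv f s.

(* C^infinity: all iterated partial derivatives exist and are continuous. *)
Definition smooth f : Prop :=
  forall s, continuous (iter_pderiv s f) /\
    forall i x, derivable (iter_pderiv s f) x (delta_mx ord0 i).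

Definition test_function phi : Prop :=
  smooth phi /\
  exists K : set 'rV[R]_d,
    [/\ compact K, K `<=` Omega & forall x, ~ K x -> phi x = 0].

Definition L2 f : Prop :=
  measurable_fun Omega f /\
  mu.-integrable Omega (fun x => (f x ^+ 2)%:E).

Definition L2_inner f g : R := \int[mu]_(x in Omega) (f x * g x).

Definition L2_norm f : R := Num.sqrt (L2_inner f f).

Definition is_weak_pderiv i u g : Prop :=
  L2 g /\ forall phi, test_function phi ->
    \int[mu]_(x in Omega) (u x * pderiv i phi x) =
    - \int[mu]_(x in Omega) (g x * phi x).

(* The weak partial derivative, unique up to a null set when it exists. *)
Definition weak_pderiv i u : 'rV[R]_d -> R :=
  xget (cst 0) [set g | is_weak_pderiv i u g].

Definition H1 u : Prop :=
  L2 u /\ forall i, exists g, is_weak_pderiv i u g.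

Definition H1_norm u : R :=
  Num.sqrt (L2_norm u ^+ 2 + \sum_i L2_norm (weak_pderiv i u) ^+ 2).

(* The closure of the test functions in H^1(Omega). *)
Definition H01 u : Prop :=
  H1 u /\ forall e : R, 0 < e ->
    exists2 phi, test_function phi & H1_norm (u \- phi) < e.

Definition H01_inner z w : R :=
  \sum_i L2_inner (weak_pderiv i z) (weak_pderiv i w).

Definition H01_norm u : R := Num.sqrt (H01_inner u u).

Definition is_green w v : Prop :=
  H01 v /\ forall z, H01 z -> H01_inner z v = L2_inner z w.

(* Green's operator; its value is unique up to a null set. *)
Definition green w : 'rV[R]_d -> R := xget (cst 0) [set v | is_green w v].

End sobolev.

Section gross_pitaevskii.
Context (R : realType) (d : nat).
Variables (Omega : set 'rV[R]_d) (V : 'rV[R]_d -> R) (beta : R).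
Implicit Types (u : 'rV[R]_d -> R) (alpha : nat -> R).

Local Notation mu := (lebesgue_rV R d).

(* V represents an element of L^oo(Omega) with 0 <= V <= Vmax. *)
Definition bounded_potential (Vmax : R) : Prop :=
  measurable_fun Omega V /\
  {ae mu, forall x, Omega x -> 0 <= V x <= Vmax}.

Definition energy u : R :=
  \int[mu]_(x in Omega)
    (2^-1 * (\sum_i weak_pderiv Omega i u x ^+ 2)
     + 2^-1 * V x * `|u x| ^+ 2 + beta / 4 * `|u x| ^+ 4).

Definition manifold u : Prop := H01 Omega u /\ L2_norm Omega u = 1.

Definition retraction u : 'rV[R]_d -> R := fun x => u x / L2_norm Omega u.

Definition green_potential u : 'rV[R]_d -> R :=
  green Omega (fun x => V x * u x + beta * `|u x| ^+ 2 * u x).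

Definition gradE u : 'rV[R]_d -> R := fun x => u x + green_potential u x.

Definition riem_gradE u : 'rV[R]_d -> R := fun x =>
  u x + green_potential u x
  - (1 + L2_inner Omega (green_potential u) u)
    / H01_norm Omega (green Omega u) ^+ 2 * green Omega u x.

Fixpoint scheme alpha u0 (n : nat) : 'rV[R]_d -> R :=
  match n with
  | 0 => u0
  | n'.+1 => let u := scheme alpha u0 n' in
             retraction (fun x => u x - alpha n' * riem_gradE u x)
  end.

End gross_pitaevskii.

(* Main.v *)
Require Import Defs.
From HB Require Import structures.
From mathcomp Require Import all_boot all_order all_algebra.
From mathcomp Require Import ring lra.
From mathcomp Require Import all_classical all_reals all_analysis.
From mathcomp Require Import measurable_realfun.

Set Implicit Arguments.
Unset Strict Implicit.
Unset Printing Implicit Defensive.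

Import Order.TTheory GRing.Theory Num.Theory.
Import numFieldNormedType.Exports.

Local Open Scope classical_set_scope.
Local Open Scope ring_scope.

(** The scheme moves from [u] in the direction of [g = riem_gradE u], which is
    the [H01]-orthogonal projection of the gradient of the energy off
    [green u]. As the [H01] inner product with [green u] is the [L2] inner
    product with [u], the direction [g] is tangent to the unit sphere
    ([riem_gradE_tangent]). Hence [v = u - a g] has [L2] norm at least [1], and
    the retraction multiplies [v] by a number in [0, 1]; this can only lower
    the energy, whose terms are all nonnegative and homogeneous
    ([energy_scale_le]). Along the line [u - a g] the energy is a polynomial of
    degree [4] in [a] with slope [- <grad, g> = - |g|^2] at [0], so that
    [E v = E u - a |g|^2 + O(a^2 |g|^2)]. The Poincare inequality and the
    embedding of [H01] into [L4] bound the constant of the remainder by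
    [|u|^2] and [|g|^2] ([energy_descent]); a step that is small with respect
    to this constant lowers the energy by [a / 2 |g|^2] at least
    ([energy_step]). Finally [|u|^2 <= 2 E u], and [|g| <= |grad|] is controlled
    by [|u|]: the constants are uniform on a sublevel set of the energy, and
    the scheme never leaves the sublevel set in which it starts
    ([scheme_dissipation]).

    Three facts about [H01] support this argument.

    - Weak derivatives are unique up to null sets, which makes the Dirichlet
      form bilinear. A function orthogonal to all test functions vanishes
      ([ae_zero_of_test]): its integrals over small boxes are zero because
      products of the bumps [exp (- c / y)] approach the indicator of a box as
      [c] tends to [0], and boxes generate the Borel sets.

    - The inequalities of Poincare and Ladyzhenskaya hold for compactly
      supported [C1] functions by integration along lines and induction on the
      dimension ([C1c_poincare], [C1c_ladyzhenskaya]). They extend to [H01] by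
      density, with Fatou's lemma for the quartic norm ([H01_quartic]).

    - [H01] is complete for the Dirichlet form ([H01_complete]): the Lebesgue
      space is complete by the theorem of Riesz and Fischer, weak
      differentiation is closed, and the Poincare inequality controls the
      functions by their gradients. The Riesz representation theorem then
      yields Green's operator ([green_spec]), for right-hand sides [w] such
      that [z |-> (z, w)] is bounded on [H01]. For [w = V u + beta u^3] the
      embedding into [L4] gives this bound, by
      [|(z, u^3)| <= |u|_4^3 |z|_4] ([lower_form_le]).

    Everything is stated for functions and not for their classes modulo null
    sets; the forms are therefore only positive semidefinite. *)

(** * Square-integrable functions *)

Definition lin (T : Type) (R : realType) (a : R) (f g : T -> R) : T -> R :=
  fun x => a * f x + g x.

(** The degenerate case [a = 0], where the quadratic is affine, does occur: it
    comes from functions of norm zero. *)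
Lemma discriminant_le (R : realType) (a b c : R) :
  (forall t, 0 <= a * t ^+ 2 + 2 * b * t + c) -> b ^+ 2 <= a * c.
Proof.
move=> key; have [a0|a0] := eqVneq a 0.
  have [->|b0] := eqVneq b 0; first by rewrite a0 mul0r expr0n.
  have := key (- (c + 1) / (2 * b)).
  rewrite a0 mul0r add0r (_ : 2 * b * _ = - (c + 1)); last by field.
  lra.
have [ap|an] := ltP 0 a.
  have := key (- b / a).
  rewrite (_ : _ + c = (a * c - b ^+ 2) / a); last by field.
  by rewrite pmulr_lge0 ?invr_gt0// subr_ge0.
have c0 : 0 <= c by have := key 0; lra.
have {}an : a < 0 by rewrite lt_neqAle a0.
have ai : a^-1 < 0 by rewrite invr_lt0.
have b1 : b <= `|b| by rewrite ler_norm.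
have b2 : 0 <= `|b| by [].
(* far enough from [0] for the negative leading term to win *)
have := key ((2 * `|b| + c + 1) * (1 - a^-1)).
apply: contraTT => _; rewrite -ltNge.
have aa : a * a^-1 = 1 by rewrite divff.
set s := 1 - a^-1; have s1 : 1 <= s by rewrite /s; lra.
have as1 : a * s <= -1 by rewrite /s mulrBr aa; lra.
set k := 2 * `|b| + c + 1; have k1 : 1 <= k by rewrite /k; lra.
have -> : a * (k * s) ^+ 2 + 2 * b * (k * s) + c
  = (k * s) * (k * (a * s) + 2 * b) + c by ring.
have k0 : 0 <= k by lra.
have h : k * (a * s) <= - k by rewrite -mulrN1 ler_wpM2l.
have ks : 1 <= k * s by rewrite (le_trans k1)// ler_peMr.
have : k * s * (k * (a * s) + 2 * b) <= k * s * (- c - 1).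
  by apply: ler_wpM2l; [|rewrite /k in h *]; lra.
have : c * 1 <= c * (k * s) by rewrite ler_wpM2l.
lra.
Qed.

Section square_integrable.
Context d (T : measurableType d) (R : realType).
Variables (mu : {measure set T -> \bar R}) (D : set T).
Hypothesis mD : measurable D.
Implicit Types (f g h : T -> R) (a b : R).

Definition sqint f : Prop :=
  measurable_fun D f /\ mu.-integrable D (fun x => (f x ^+ 2)%:E).

Definition ip f g : R := \int[mu]_(x in D) (f x * g x).

Lemma integrable_le f g : measurable_fun D f ->
  mu.-integrable D (EFin \o g) -> (forall x, D x -> `|f x| <= g x) ->
  mu.-integrable D (EFin \o f).
Proof.
move=> mf ig fg; apply: le_integrable ig => //; first exact/measurable_EFinP.
move=> x Dx /=; by rewrite lee_fin (le_trans (fg x Dx))// ler_norm.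
Qed.

Lemma integrableRD f g : mu.-integrable D (EFin \o f) ->
  mu.-integrable D (EFin \o g) -> mu.-integrable D (EFin \o (f \+ g)).
Proof.
move=> fi gi; rewrite (_ : _ \o _ = (EFin \o f) \+ (EFin \o g))%E; last first.
  by apply/funext => x /=; rewrite EFinD.
exact: integrableD.
Qed.

Lemma integrableRZ a f : mu.-integrable D (EFin \o f) ->
  mu.-integrable D (EFin \o (fun x => a * f x)).
Proof.
move=> fi; rewrite (_ : _ \o _ = (fun x => a%:E * (EFin \o f) x))%E; last first.
  by apply/funext => x /=; rewrite EFinM.
exact: integrableZl.
Qed.

Lemma sqint_mul f g : sqint f -> sqint g ->
  mu.-integrable D (EFin \o (fun x => f x * g x)).
Proof.
move=> [mf fi] [mg gi].
apply: (@integrable_le _ (fun x => f x ^+ 2 + g x ^+ 2)).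
- exact: measurable_funM.
- exact: (integrableRD fi gi).
- move=> x _; rewrite ler_norml; apply/andP; split; nra.
Qed.

Lemma sqint_lin a f g : sqint f -> sqint g -> sqint (lin a f g).
Proof.
move=> Hf Hg; have [mf fi] := Hf; have [mg gi] := Hg; split.
  by apply: measurable_funD => //; exact: measurable_funM.
have := sqint_mul Hf Hg => fgi.
have := integrableRD (integrableRZ (a ^+ 2) fi)
   (integrableRD (integrableRZ (2 * a) fgi) gi).
congr (mu.-integrable D _); apply/funext => x /=; rewrite /lin; congr (_%:E); ring.
Qed.

Lemma ip_linl a f g h : sqint f -> sqint g -> sqint h ->
  ip (lin a f g) h = a * ip f h + ip g h.
Proof.
move=> Hf Hg Hh; rewrite /ip -RintegralZl//; last exact: sqint_mul.
rewrite -RintegralD//; [|exact/integrableRZ/sqint_mul|exact: sqint_mul].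
by apply: eq_Rintegral => x _; rewrite /lin; ring.
Qed.

Lemma ipC f g : ip f g = ip g f.
Proof. by apply: eq_Rintegral => x _; rewrite mulrC. Qed.

Lemma ip_ge0 f : 0 <= ip f f.
Proof. by apply: Rintegral_ge0 => x _; rewrite -expr2 sqr_ge0. Qed.

Lemma ae_eq_Rintegral f g : measurable_fun D f -> measurable_fun D g ->
  ae_eq mu D f g -> \int[mu]_(x in D) f x = \int[mu]_(x in D) g x.
Proof.
move=> mf mg fg; congr fine; apply: ae_eq_integral => //; last exact: ae_eq_comp.
- exact/measurable_EFinP.
- exact/measurable_EFinP.
Qed.

Lemma ip_ae f f' g g' : sqint f -> sqint f' -> sqint g -> sqint g' ->
  ae_eq mu D f f' -> ae_eq mu D g g' -> ip f g = ip f' g'.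
Proof.
move=> [mf _] [mf' _] [mg _] [mg' _] ff' gg'.
apply: ae_eq_Rintegral; [exact: measurable_funM..|].
by move: ff' gg'; apply: filterS2 => x h1 h2 Dx; rewrite h1// h2.
Qed.

Lemma ae_sqint f g : sqint f -> measurable_fun D g -> ae_eq mu D f g -> sqint g.
Proof.
move=> [mf /integrableP[mf2 fi]] mg fg; split => //; apply/integrableP; split.
  exact/measurable_EFinP/measurable_funX.
rewrite (_ : (\int[mu]_(x in D) _ = \int[mu]_(x in D) `|(f x ^+ 2)%:E|)%E)//.
apply: ge0_ae_eq_integral => //.
- by apply: measurableT_comp => //; exact/measurable_EFinP/measurable_funX.
- exact: measurableT_comp.
- by move: fg; apply: filterS => x h Dx; rewrite h.
Qed.

Lemma ip_CS f g : sqint f -> sqint g -> ip f g ^+ 2 <= ip f f * ip g g.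
Proof.
move=> Hf Hg; rewrite [leRHS]mulrC; apply: discriminant_le => t.
have := ip_ge0 (lin t g f); rewrite ip_linl//; last exact: sqint_lin.
rewrite ipC ip_linl// (ipC f (lin _ _ _)) ip_linl// (ipC g f); lra.
Qed.

Lemma EFin_ip f : sqint f ->
  (ip f f)%:E = (\int[mu]_(x in D) (f x ^+ 2)%:E)%E.
Proof.
move=> [mf fi]; rewrite /ip /Rintegral fineK; last first.
  by apply: integrable_fin_num => //; apply: eq_integrable fi.
by apply: eq_integral => x _; rewrite expr2.
Qed.

Lemma sqint_le f (C : R) : measurable_fun D f ->
  (\int[mu]_(x in D) (f x ^+ 2)%:E <= C%:E)%E -> sqint f /\ ip f f <= C.
Proof.
move=> mf fC; suff Hf : sqint f by split => //; rewrite -lee_fin EFin_ip.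
split => //; apply/integrableP; split.
  exact/measurable_EFinP/measurable_funX.
apply: le_lt_trans (ltry C); apply: le_trans fC; rewrite le_eqVlt; apply/orP; left.
by apply/eqP; apply: eq_integral => x _ /=; rewrite ger0_norm// sqr_ge0.
Qed.

Lemma ip_eq0 f : sqint f -> ip f f = 0 -> ae_eq mu D f (cst 0).
Proof.
move=> [mf fi] f0.
have H : ae_eq mu D (fun x => (f x ^+ 2)%:E) (cst 0%E).
  apply/ae_eq_integral_abs => //; first exact/measurable_EFinP/measurable_funX.
  rewrite (eq_integral (fun x => (f x ^+ 2)%:E)) => [|x _].
    by rewrite -EFin_ip// f0.
  by rewrite /= ger0_norm// sqr_ge0.
move: H; apply: filterS => x h Dx; have /eqP := h Dx.
by rewrite eqe sqrf_eq0 => /eqP.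
Qed.

(** Fatou's lemma in the form that transfers a bound of integrals to an almost
    everywhere limit. *)
Lemma integral_fatou (g_ : nat -> T -> R) (g : T -> R) (C : \bar R) :
  (forall n, measurable_fun D (g_ n)) -> measurable_fun D g ->
  (forall n x, 0 <= g_ n x) -> (forall x, 0 <= g x) ->
  {ae mu, forall x, D x -> g_ n x @[n --> \oo] --> g x} ->
  (\forall n \near \oo, \int[mu]_(x in D) (g_ n x)%:E <= C)%E ->
  (\int[mu]_(x in D) (g x)%:E <= C)%E.
Proof.
move=> mg_ mg g_0 g0 cg gC.
have mE n : measurable_fun D (EFin \o g_ n) by exact/measurable_EFinP.
have E : (\int[mu]_(x in D) (g x)%:E =
    \int[mu]_(x in D) limn_einf (fun n => (g_ n x)%:E))%E.
  apply: ge0_ae_eq_integral => //.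
  - exact/measurable_EFinP.
  - rewrite /limn_einf; apply: measurableT_comp => //.
    by apply: measurable_fun_limn_esup => n; apply: measurableT_comp => //; exact: mE.
  - by move=> x _; rewrite lee_fin.
  - move=> x _; rewrite limn_einf_lim; apply: lime_ge; first exact: is_cvg_einfs.
    by near=> n; apply: le_ereal_inf_tmp => _ [m _ <-]; rewrite lee_fin.
  - move: cg; apply: filterS => x h Dx; apply/esym.
    apply: (cvg_limn_einf_sup _).1.
    by apply: cvg_EFin; [exact: nearW|exact: h].
rewrite E; apply: le_trans (fatou mu mD mE _) _.
  by move=> n x _ /=; rewrite lee_fin.
rewrite limn_einf_lim; apply: lime_le; first exact: is_cvg_einfs.
case: gC => N _ NC; near=> n.
apply: le_trans (NC (maxn N n) _); last by rewrite /= leq_maxl.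
by apply: ereal_inf_lbound; exists (maxn N n) => //=; rewrite leq_maxr.
Unshelve. all: by end_near. Qed.

End square_integrable.

Section square_integrable_complete.
Context d (T : measurableType d) (R : realType).
Variables (mu : {measure set T -> \bar R}) (D : set T).
Hypothesis mD : measurable D.
Implicit Types (f g h : T -> R) (a b : R).

Local Notation sqint := (sqint mu D).
Local Notation ip := (ip mu D).

(** With the weights [16^k] this rate is summable, while [16^k h^2 <= M]
    bounds [h] by a multiple of [4^-k], which is summable as well. *)
Definition fast_rate k : R := 1 / (2 ^ k.+1)%:R / 16 ^+ k.

Lemma fast_rate_gt0 k : 0 < fast_rate k.
Proof. by rewrite !divr_gt0// ?exprn_gt0// ltr0n expn_gt0. Qed.

(** If [ip h_k h_k] decays like [32^-k], the series of the [16^k h_k ^ 2] is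
    integrable, hence finite almost everywhere, and so are its terms bounded. *)
Lemma fast_ae_bounded (h_ : nat -> T -> R) : (forall k, sqint (h_ k)) ->
  (forall k, ip (h_ k) (h_ k) <= fast_rate k) ->
  {ae mu, forall x, D x -> exists M, forall k, 16 ^+ k * h_ k x ^+ 2 <= M}.
Proof.
move=> sh hr; pose F k x : \bar R := (16 ^+ k * h_ k x ^+ 2)%:E.
have F0 k x : (0 <= F k x)%E.
  by rewrite lee_fin mulr_ge0 ?sqr_ge0// exprn_ge0.
have mF k : measurable_fun D (F k).
  have [mh _] := sh k; apply/measurable_EFinP/measurable_funM => //.
  exact: measurable_funX.
have S : mu.-integrable D (fun x => \sum_(k <oo) F k x)%E.
  apply/integrableP; split; first exact: ge0_emeasurable_sum.
  rewrite (eq_integral (fun x => \sum_(k <oo) F k x)%E); last first.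
    by move=> x _; rewrite gee0_abs// nneseries_ge0.
  rewrite integral_nneseries//.
  apply: (@le_lt_trans _ _ 1%:E); last exact: ltry.
  apply: le_trans (epsilon_trick0 xpredT (ler01 : 0 <= (1 : R))).
  apply: lee_nneseries => k _.
    by move=> _; exact: integral_ge0.
  rewrite /F; under eq_integral do rewrite EFinM.
  have mh2 : measurable_fun D (fun x => (h_ k x ^+ 2)%:E).
    by have [mh _] := sh k; exact/measurable_EFinP/measurable_funX.
  rewrite ge0_integralZl//; last by move=> x _; rewrite lee_fin sqr_ge0.
  rewrite -EFin_ip// -EFinM lee_fin mulrC -ler_pdivlMr ?exprn_gt0//.
have := integrable_ae mD S; apply: filterS => x fin Dx.
exists (fine (\sum_(k <oo) F k x)%E) => k.
rewrite -lee_fin fineK; last exact: fin.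
rewrite -[leLHS]/(F k x).
apply: le_trans (nneseries_lim_ge k.+1 _) => //.
by rewrite big_mkord big_ord_recr/= leeDr// sume_ge0.
Qed.

Lemma fast_bound (u : nat -> R) M : (forall k, 16 ^+ k * u k ^+ 2 <= M) ->
  forall k, `|u k| <= geometric (Num.sqrt M) 4^-1 k.
Proof.
move=> uM k; rewrite /geometric/= exprVn ler_pdivlMr ?exprn_gt0//.
rewrite -(ger0_norm (exprn_ge0 k (ler0n R 4))) -normrM -sqrtr_sqr.
rewrite ler_wsqrtr// exprMn mulrC -exprM mulnC exprM.
by rewrite (_ : 4 ^+ 2 = 16) ?uM//; ring.
Qed.

Lemma geometric4_cvg0 C : geometric C (4^-1 : R) @ \oo --> (0 : R).
Proof. by apply: cvg_geometric; rewrite ger0_norm//; lra. Qed.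

Lemma fast_ae_cvg0 (h_ : nat -> T -> R) : (forall k, sqint (h_ k)) ->
  (forall k, ip (h_ k) (h_ k) <= fast_rate k) ->
  {ae mu, forall x, D x -> h_ k x @[k --> \oo] --> (0 : R)}.
Proof.
move=> sh hr; have := fast_ae_bounded sh hr; apply: filterS => x H Dx.
have [M /fast_bound hM] := H Dx.
apply/norm_cvg0P; apply: squeeze_cvgr (cvg_cst 0) (geometric4_cvg0 (Num.sqrt M)).
by apply: nearW => k; rewrite normr_ge0 hM.
Qed.

Lemma fast_ae_cvg (f_ : nat -> T -> R) : (forall k, sqint (f_ k)) ->
  (forall k, ip (lin (-1) (f_ k) (f_ k.+1)) (lin (-1) (f_ k) (f_ k.+1))
     <= fast_rate k) ->
  {ae mu, forall x, D x -> cvgn (fun k => f_ k x)}.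
Proof.
move=> sf fr.
have := @fast_ae_bounded (fun k => lin (-1) (f_ k) (f_ k.+1)) _ fr.
move=> H; have {}H := H (fun k => sqint_lin mD (-1) (sf k) (sf k.+1)).
move: H; apply: filterS => x H Dx; have [M /fast_bound hM] := H Dx.
have -> : (fun k => f_ k x) =
    (fun k => f_ 0 x + series (fun k => lin (-1) (f_ k) (f_ k.+1) x) k).
  apply/funext => k; rewrite /series/=; elim: k => [|k ih].
    by rewrite big_geq// addr0.
  by rewrite big_nat_recr//= addrA -ih /lin; ring.
apply: is_cvgD; first exact: is_cvg_cst.
apply: normed_cvg; apply: series_le_cvg (hM) _ => //.
- by move=> n; rewrite (le_trans _ (hM n)).
- by apply: is_cvg_geometric_series; rewrite ger0_norm//; lra.
Qed.

Lemma fast_subsequence (N : nat -> nat) : exists s : nat -> nat,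
  [/\ forall k, (N k <= s k)%N, forall k, (k <= s k)%N &
      forall k, (N k <= s k.+1)%N].
Proof.
exists (fun k => \max_(i < k.+1) (N i + i))%N.
have H i k : (i <= k)%N -> (N i + i <= \max_(i < k.+1) (N i + i))%N.
  move=> ik; rewrite -ltnS in ik.
  exact: (@leq_bigmax_cond _ xpredT (fun i : 'I_k.+1 => N i + i)%N (Ordinal ik)).
split=> k.
- exact: leq_trans (leq_addr _ _) (H k k _).
- exact: leq_trans (leq_addl _ _) (H k k _).
- exact: leq_trans (leq_addr _ _) (H k k.+1 _).
Qed.

(** Riesz-Fischer: a subsequence converges almost everywhere, and Fatou's lemma
    shows that its pointwise limit is a limit in mean square. *)
Lemma sqint_complete (f_ : nat -> T -> R) : (forall k, sqint (f_ k)) ->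
  (forall e : R, 0 < e -> exists N, forall m n, (N <= m)%N -> (N <= n)%N ->
     ip (lin (-1) (f_ m) (f_ n)) (lin (-1) (f_ m) (f_ n)) <= e) ->
  exists2 f, sqint f & forall e : R, 0 < e -> exists N, forall n, (N <= n)%N ->
     ip (lin (-1) (f_ n) f) (lin (-1) (f_ n) f) <= e.
Proof.
move=> sf cf.
have /choice[N NP] : forall k, exists N, forall m n, (N <= m)%N -> (N <= n)%N ->
    ip (lin (-1) (f_ m) (f_ n)) (lin (-1) (f_ m) (f_ n)) <= fast_rate k.
  by move=> k; apply: cf; exact: fast_rate_gt0.
have [s [sN sk sN1]] := fast_subsequence N.
have fc : {ae mu, forall x, D x -> cvgn (fun k => f_ (s k) x)}.
  by apply: (@fast_ae_cvg (f_ \o s)) => k /=; [exact: sf|apply: NP].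
(* an upper limit, to be measurable on the whole of [D] *)
pose f x := fine (limn_esup (fun k => (f_ (s k) x)%:E)).
have mf : measurable_fun D f.
  apply: measurableT_comp => //; apply: measurable_fun_limn_esup => k.
  by apply/measurable_EFinP; have [] := sf (s k).
have cf' : {ae mu, forall x, D x -> f_ (s k) x @[k --> \oo] --> f x}.
  move: fc; apply: filterS => x H Dx; have {}H := H Dx.
  have E : (f_ (s k) x)%:E @[k --> \oo] --> (limn (fun k => f_ (s k) x))%:E.
    by apply: cvg_EFin => //; exact: nearW.
  by rewrite /f (cvg_limn_einf_sup E).2.
have bound e N' n : (forall m, (N' <= m)%N ->
    ip (lin (-1) (f_ m) (f_ n)) (lin (-1) (f_ m) (f_ n)) <= e) ->
    sqint (lin (-1) (f_ n) f) /\ ip (lin (-1) (f_ n) f) (lin (-1) (f_ n) f) <= e.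
  move=> He; have [mfn _] := sf n; apply: sqint_le => //.
    by apply: measurable_funD => //; exact: measurable_funM.
  apply: (@integral_fatou _ _ _ mu D mD (fun k x => lin (-1) (f_ (s k)) (f_ n) x ^+ 2)).
  - move=> k; have [mfk _] := sf (s k); apply: measurable_funX.
    by apply: measurable_funD => //; exact: measurable_funM.
  - by apply/measurable_funX/measurable_funD => //; exact: measurable_funM.
  - by move=> *; exact: sqr_ge0.
  - by move=> *; exact: sqr_ge0.
  - move: cf'; apply: filterS => x H Dx; have {}H := H Dx.
    rewrite (_ : lin (-1) (f_ n) f x ^+ 2 = (-1 * f x + f_ n x) ^+ 2); last first.
      by rewrite /lin; ring.
    rewrite expr2; under eq_fun do rewrite expr2.
    have : (lin (-1) (f_ (s k)) (f_ n) x) @[k --> \oo] --> (-1 * f x + f_ n x).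
      by apply: cvgD; [exact: cvgMr|exact: cvg_cst].
    by move=> H1; exact: cvgM.
  - exists N' => // k /= Nk; rewrite -EFin_ip//; last exact: sqint_lin.
    by rewrite lee_fin He// (leq_trans Nk).
have fs : sqint f.
  have [N' HN'] := cf 1 ltr01.
  have [H _] := bound 1 N' N' (fun m Hm => HN' m N' Hm (leqnn _)).
  rewrite (_ : f = lin 1 (f_ N') (lin (-1) (f_ N') f)); first exact: sqint_lin.
  by apply/funext => x; rewrite /lin; ring.
exists f => // e e0; have [N' HN'] := cf e e0; exists N' => n Nn.
by have [] := bound e N' n (fun m Hm => HN' m n Hm Nn).
Qed.

End square_integrable_complete.

(** * The Riesz representation theorem *)

Section riesz.
Context (T : Type) (R : realType).
Variables (H : set (T -> R)) (B : (T -> R) -> (T -> R) -> R) (l : (T -> R) -> R).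
Hypothesis H0 : H (cst 0).
Hypothesis Hlin : forall a f g, H f -> H g -> H (lin a f g).
Hypothesis Blin : forall a f g h, H f -> H g -> H h ->
  B (lin a f g) h = a * B f h + B g h.
Hypothesis BC : forall f g, B f g = B g f.
Hypothesis B0 : forall f, 0 <= B f f.

Let Blinr a f g h : H f -> H g -> H h -> B h (lin a f g) = a * B h f + B h g.
Proof. by move=> Hf Hg Hh; rewrite BC Blin// !(BC _ h). Qed.

Let Bquad a f g : H f -> H g ->
  B (lin a f g) (lin a f g) = a ^+ 2 * B f f + 2 * a * B f g + B g g.
Proof.
move=> Hf Hg; rewrite Blin//; last exact: Hlin.
by rewrite !Blinr// (BC g f); ring.
Qed.

Lemma semi_inner_CS f g : H f -> H g -> B f g ^+ 2 <= B f f * B g g.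
Proof.
move=> Hf Hg; apply: discriminant_le => t.
have := B0 (lin t f g); rewrite Bquad//; lra.
Qed.

Hypothesis Hcomplete : forall u : nat -> T -> R, (forall n, H (u n)) ->
  (forall e : R, 0 < e -> exists N, forall m n, (N <= m)%N -> (N <= n)%N ->
    B (lin (-1) (u m) (u n)) (lin (-1) (u m) (u n)) <= e) ->
  exists2 v, H v & forall e : R, 0 < e -> exists N, forall n, (N <= n)%N ->
    B (lin (-1) (u n) v) (lin (-1) (u n) v) <= e.
Hypothesis llin : forall a f g, H f -> H g -> l (lin a f g) = a * l f + l g.
Variable C : R.
Hypothesis C0 : 0 <= C.
Hypothesis lB : forall f, H f -> l f ^+ 2 <= C * B f f.

Let J f := B f f - 2 * l f.

(** A minimizing sequence of [J] is Cauchy by the parallelogram identity; near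
    minimality of [J] along the lines [f + t z] makes the residual
    [B z f - l z] small. *)
Lemma riesz_representation : exists2 v, H v & forall z, H z -> B z v = l z.
Proof.
have Jlow f : H f -> - C <= J f.
  move=> Hf; have h := lB Hf; have b0 := B0 f; rewrite /J.
  suff : 2 * l f <= B f f + C by lra.
  apply: le_trans (ler_norm _) _.
  rewrite -(@ler_pXn2r _ 2)// ?nnegrE ?addr_ge0// real_normK ?num_real//.
  have := sqr_ge0 (B f f - C); nra.
pose m := inf [set J f | f in H].
have hm : has_inf [set J f | f in H].
  split; first by exists (J (cst 0)), (cst 0).
  by exists (- C) => _ [f Hf <-]; exact: Jlow.
have mJ f : H f -> m <= J f by move=> Hf; apply: ge_inf; [exact: hm.2|exists f].
have /choice[u uP] : forall n : nat, exists f, H f /\ J f < m + n.+1%:R^-1.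
  move=> n; have [|_ [f Hf <-] fm] := inf_adherent (_ : 0 < (n.+1%:R^-1 : R)) hm.
    by rewrite invr_gt0.
  by exists f.
have Hu n := (uP n).1.
have inv_le (N n : nat) : (N <= n)%N -> n.+1%:R^-1 <= N.+1%:R^-1 :> R.
  by move=> Nn; rewrite lef_pV2 ?posrE// ler_nat.
have small (e : R) : 0 < e -> exists N, forall n, (N <= n)%N -> n.+1%:R^-1 <= e.
  move=> e0; have [N _ NP] := near_infty_natSinv_lt (PosNum e0).
  by exists N => n Nn; apply/ltW/NP.
have uC p q : B (lin (-1) (u p) (u q)) (lin (-1) (u p) (u q)) <=
    2 * (p.+1%:R^-1 + q.+1%:R^-1).
  (* the midpoint of [u p] and [u q] *)
  have Hw : H (lin 2^-1 (lin (-1) (u p) (u q)) (u p)) by do 2 apply: Hlin => //.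
  have := mJ _ Hw; have := (uP p).2; have := (uP q).2; rewrite /J.
  have HL := Hlin (-1) (Hu p) (Hu q).
  rewrite (Bquad _ HL (Hu p)) (Bquad _ (Hu p) (Hu q)) (Blin _ (Hu p) (Hu q) (Hu p)).
  rewrite (llin _ HL (Hu p)) (llin _ (Hu p) (Hu q)) (BC (u q) (u p)).
  move: (p.+1%:R^-1) (q.+1%:R^-1) => rp rq; lra.
have [|v Hv vP] := Hcomplete Hu.
  move=> e e0; have [N NP] := small (e / 4) (divr_gt0 e0 (ltr0n _ 4)).
  exists N => p q Np Nq; apply: le_trans (uC p q) _.
  move: (NP _ Np) (NP _ Nq); move: (p.+1%:R^-1) (q.+1%:R^-1) => rp rq; lra.
exists v => // z Hz; apply/eqP; rewrite -subr_eq0 -sqrf_eq0.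
have res n : (B z (u n) - l z) ^+ 2 <= B z z * n.+1%:R^-1.
  apply: discriminant_le => t.
  have := mJ _ (Hlin t Hz (Hu n)); have := (uP n).2; rewrite /J.
  rewrite (Bquad _ Hz (Hu n)) (llin _ Hz (Hu n)).
  move: (n.+1%:R^-1) => rn; lra.
apply/eqP/le_anti; rewrite sqr_ge0 andbT.
apply/ler_addgt0Pr => e e0; rewrite add0r.
pose K := B z z + 1.
have K0 : 0 < K by rewrite /K; have := B0 z; lra.
have e' : 0 < e / (4 * K) by rewrite divr_gt0// mulr_gt0.
have [N NP] := small _ e'; have [N' NP'] := vP _ e'.
pose n := maxn N N'.
have h1 := NP n (leq_maxl _ _); have h2 := NP' n (leq_maxr _ _).
have h3 := res n.
have h4 := semi_inner_CS Hz (Hlin (-1) (Hu n) Hv).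
rewrite (Blinr _ (Hu n) Hv Hz) in h4.
have hh x : x <= e / (4 * K) -> B z z * x <= e / 4.
  move=> xe; have -> : e / 4 = K * (e / (4 * K)) by field; lra.
  have [x0|x0] := leP 0 x.
    apply: (@le_trans _ _ (K * x)); last by rewrite ler_wpM2l// ltW.
    by rewrite ler_wpM2r// /K; lra.
  have ? := B0 z; have := mulr_gt0 K0 e'; nra.
have {}h3 := le_trans h3 (hh _ h1).
have {}h4 := le_trans h4 (hh _ h2).
have := sqr_ge0 (B z v - 2 * B z (u n) + l z).
nra.
Qed.

End riesz.

(** * Measurability and iterated integrals on row vectors *)

Section rV_measure.
Context (R : realType).

Lemma rV_ballP n (x y : 'rV[R]_n) (e : R) : 0 < e ->
  ball x e y <-> forall i, `|x ord0 i - y ord0 i| < e.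
Proof.
move=> e0; split => [[_ H] i|H]; first exact: (H ord0 i).
by split => // i j; rewrite (ord1 i); exact: H.
Qed.

Definition obox n (a b : 'rV[R]_n) : set 'rV[R]_n :=
  [set x | forall i, a ord0 i < x ord0 i < b ord0 i].

Definition cbox n (a b : 'rV[R]_n) : set 'rV[R]_n :=
  [set x | forall i, a ord0 i <= x ord0 i <= b ord0 i].

Lemma obox_cbox n (a b : 'rV[R]_n) : obox a b `<=` cbox a b.
Proof. by move=> x xab i; have /andP[/ltW -> /ltW ->] := xab i. Qed.

Lemma oboxI n (a b a' b' : 'rV[R]_n) :
  obox a b `&` obox a' b' = obox (\row_i Num.max (a ord0 i) (a' ord0 i))
    (\row_i Num.min (b ord0 i) (b' ord0 i)).
Proof.
apply/seteqP; split => [x [H H'] i|x H].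
  have /andP[h1 h2] := H i; have /andP[h1' h2'] := H' i.
  by rewrite !mxE gt_max h1 h1' lt_min h2 h2'.
by split => i; have := H i; rewrite !mxE gt_max lt_min =>
  /andP[/andP[h1 h2] /andP[h3 h4]]; apply/andP.
Qed.

Lemma cboxI n (a b a' b' : 'rV[R]_n) :
  cbox (\row_i Num.max (a ord0 i) (a' ord0 i))
    (\row_i Num.min (b ord0 i) (b' ord0 i)) `<=` cbox a b.
Proof.
by move=> x H i; have := H i; rewrite !mxE ge_max le_min =>
  /andP[/andP[h1 _] /andP[h2 _]]; apply/andP.
Qed.

Lemma measurable_coord_preimage n (P : 'I_n -> set R) :
  (forall i, measurable (P i)) ->
  measurable [set x : 'rV[R]_n | forall i, P i (x ord0 i)].
Proof.
move=> mP; rewrite (_ : mkset _ = \big[setI/setT]_(i < n)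
    ((@rV_coord R n i) @^-1` P i)); last first.
  apply/seteqP; split => y; rewrite -bigcap_seq/=.
    by move=> H i _; exact: H.
  by move=> H i; apply: H; rewrite /= mem_index_enum.
apply: bigsetI_measurable => i _; rewrite -[X in measurable X]setTI.
exact: measurable_rV_coord.
Qed.

Lemma measurable_obox n (a b : 'rV[R]_n) : measurable (obox a b).
Proof.
rewrite (_ : obox a b =
  [set x | forall i, `]a ord0 i, b ord0 i[%classic (x ord0 i)]).
  by apply: (@measurable_coord_preimage _ (fun i => `]a ord0 i, b ord0 i[%classic)).
by apply/seteqP; split => x H i; have := H i; rewrite /= in_itv.
Qed.

(** Boxes with rational centre and radius [1 / k] form a countable base. The
    closed boxes are kept inside [A] so that they can carry test functions. *)
Lemma open_bigcup_boxes n (A : set 'rV[R]_n) : open A ->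
  exists (a b : nat -> 'rV[R]_n) (P : set nat),
    A = \bigcup_(k in P) obox (a k) (b k) /\
    forall k, P k -> cbox (a k) (b k) `<=` A.
Proof.
move=> oA.
pose lo (p : 'rV[rat]_n * nat) : 'rV[R]_n :=
  \row_i (ratr (p.1 ord0 i) - p.2.+1%:R^-1).
pose hi (p : 'rV[rat]_n * nat) : 'rV[R]_n :=
  \row_i (ratr (p.1 ord0 i) + p.2.+1%:R^-1).
pose P := [set p | cbox (lo p) (hi p) `<=` A].
pose p0 : 'rV[rat]_n * nat := (0, 0%N).
exists (fun k => lo (odflt p0 (unpickle k))), (fun k => hi (odflt p0 (unpickle k))).
exists [set k | P (odflt p0 (unpickle k))]; split; last by [].
apply/seteqP; split => [x Ax|x [k /= Pk xk]]; last exact/Pk/obox_cbox.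
have /nbhs_ballP[e /= e0 eA] := open_nbhs_nbhs (conj oA Ax).
have [N _ NP] := near_infty_natSinv_lt (PosNum (divr_gt0 e0 (ltr0n R 2))).
have {NP}Ne : N.+1%:R^-1 < e / 2 := NP N (leqnn N).
have N0 : 0 < (N.+1%:R^-1 : R) by rewrite invr_gt0.
have /choice[q qP] : forall i, exists q : rat, `|ratr q - x ord0 i| < N.+1%:R^-1.
  move=> i; have /rat_in_itvoo[q] : x ord0 i - N.+1%:R^-1 < x ord0 i + N.+1%:R^-1.
    by move: N0; move: (N.+1%:R^-1) => r r0; lra.
  by rewrite in_itv/= => /andP[h1 h2]; exists q; rewrite ltr_distl h1 h2.
exists (pickle (\row_i q i, N)) => /=; rewrite pickleK /=.
  move=> y yq; apply: eA; apply/rV_ballP => // i.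
  have := yq i; rewrite !mxE /= => yi; have := qP i.
  move: yi Ne; rewrite ?mxE !ltr_distl; move: (N.+1%:R^-1) => r; lra.
move=> i; rewrite !mxE /=; have := qP i; rewrite ?mxE ltr_distl.
move: (N.+1%:R^-1) => r; lra.
Qed.

Lemma measurable_open_rV n (A : set 'rV[R]_n) : open A -> measurable A.
Proof.
move=> /open_bigcup_boxes[a [b [P [-> _]]]].
by apply: bigcup_measurable => k _; exact: measurable_obox.
Qed.

Lemma measurable_continuous_rV n (f : 'rV[R]_n -> R) :
  continuous f -> measurable_fun [set: 'rV[R]_n] f.
Proof.
move=> cf; apply: (measurability _ (RGenOpens.measurableE R)).
move=> _ [_ [a [b ->] <-]]; rewrite setTI; apply: measurable_open_rV.
by apply: open_comp => [x _|]; [exact: cf|exact: interval_open].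
Qed.

Lemma lebesgue_rV_cons n (A : set 'rV[R]_n.+1) : lebesgue_rV R n.+1 A =
  pushforward (@lebesgue_measure R \x lebesgue_rV R n)%E
    (@rV_cons R n : measurableTypeR R * 'rV[R]_n -> 'rV[R]_n.+1) A.
Proof. by []. Qed.

Definition cube n (M : R) : set 'rV[R]_n := [set x | forall i, `|x ord0 i| <= M].
Arguments cube n M : clear implicits.

Lemma rV_cons0 n (t : R) (v : 'rV[R]_n) : rV_cons (t, v) ord0 ord0 = t.
Proof. by rewrite mxE unlift_none. Qed.

Lemma rV_consS n (t : R) (v : 'rV[R]_n) j :
  rV_cons (t, v) ord0 (lift ord0 j) = v ord0 j.
Proof. by rewrite mxE liftK. Qed.

Lemma measurable_cube n M : measurable (cube n M).
Proof.
rewrite (_ : cube n M = [set x | forall i, `[(- M), M]%classic (x ord0 i)]).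
  by apply: (@measurable_coord_preimage _ (fun=> `[(- M), M]%classic)).
by apply/seteqP; split => x H i; have := H i; rewrite /= in_itv/= ler_norml.
Qed.

Lemma cube_lty n M : (lebesgue_rV R n (cube n M) < +oo)%E.
Proof.
elim: n => [|n ih].
  rewrite /= diracE; exact: ltry.
rewrite lebesgue_rV_cons /pushforward.
rewrite (_ : _ @^-1` _ = `[(- M), M]%classic `*` cube n M); last first.
  apply/seteqP; split => -[t v]; rewrite /cube /=.
    move=> H; split => [|j]; last by have := H (lift ord0 j); rewrite rV_consS.
    by have := H ord0; rewrite rV_cons0 ler_norml in_itv.
  move=> [tM H] i; have [j ->|->] := unliftP ord0 i; first by rewrite rV_consS.
  by move: tM; rewrite rV_cons0 ler_norml in_itv.
rewrite product_measure1E//; last exact: measurable_cube.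
rewrite lte_mul_pinfty//.
rewrite ge0_fin_numE// [ltLHS]lebesgue_measure_itv/=; case: ifP => _ //.
by rewrite -EFinB ltry.
Qed.

Lemma rV_tonelli n (f : 'rV[R]_n.+1 -> \bar R) :
  measurable_fun setT f -> (forall x, 0 <= f x)%E ->
  (\int[lebesgue_rV R n.+1]_x f x =
   \int[lebesgue_measure]_t \int[lebesgue_rV R n]_v f (rV_cons (t, v)))%E.
Proof.
move=> mf f0.
rewrite (eq_measure_integral (pushforward (@lebesgue_measure R \x lebesgue_rV R n)%E
    (@rV_cons R n : measurableTypeR R * 'rV[R]_n -> 'rV[R]_n.+1)))//; first exact: measurable_rV_cons.
move=> mc; rewrite ge0_integral_pushforward//.
rewrite preimage_setT fubini_tonelli1//; last by move=> x; exact: f0.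
by apply: measurableT_comp => //; exact: measurable_rV_cons.
Qed.

Lemma rV_tonelli_swap n (f : 'rV[R]_n.+1 -> \bar R) :
  measurable_fun setT f -> (forall x, 0 <= f x)%E ->
  (\int[lebesgue_rV R n.+1]_x f x =
   \int[lebesgue_rV R n]_v \int[lebesgue_measure]_t f (rV_cons (t, v)))%E.
Proof.
move=> mf f0; rewrite rV_tonelli//.
apply: (@fubini_tonelli _ _ _ _ _ _ _ (fun p : measurableTypeR R * 'rV[R]_n => f (rV_cons p))) => //.
by apply: measurableT_comp => //; exact: measurable_rV_cons.
Qed.

Lemma rV_integrable n (f : 'rV[R]_n.+1 -> \bar R) :
  measurable_fun setT f -> (lebesgue_rV R n.+1).-integrable setT f ->
  (lebesgue_measure \x lebesgue_rV R n)%E.-integrable setT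
    (fun p : measurableTypeR R * 'rV[R]_n => f (rV_cons p)).
Proof.
move=> mf /integrableP[_ fi]; apply/integrableP; split.
  by apply: measurableT_comp => //; exact: measurable_rV_cons.
rewrite fubini_tonelli1//; last first.
  apply: measurableT_comp => //.
  by apply: measurableT_comp => //; exact: measurable_rV_cons.
rewrite rV_tonelli// in fi.
exact: measurableT_comp.
Qed.

Lemma rV_fubini n (f : 'rV[R]_n.+1 -> \bar R) :
  measurable_fun setT f -> (lebesgue_rV R n.+1).-integrable setT f ->
  (\int[lebesgue_rV R n.+1]_x f x =
   \int[lebesgue_measure]_t \int[lebesgue_rV R n]_v f (rV_cons (t, v)))%E /\
  (\int[lebesgue_rV R n.+1]_x f x =
   \int[lebesgue_rV R n]_v \int[lebesgue_measure]_t f (rV_cons (t, v)))%E.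
Proof.
move=> mf fi; have fi' := rV_integrable mf fi.
have -> : (\int[lebesgue_rV R n.+1]_x f x =
   \int[lebesgue_measure \x lebesgue_rV R n]_p
      (fun p : measurableTypeR R * 'rV[R]_n => f (rV_cons p)) p)%E.
  rewrite (eq_measure_integral (pushforward (@lebesgue_measure R \x lebesgue_rV R n)%E
    (@rV_cons R n : measurableTypeR R * 'rV[R]_n -> 'rV[R]_n.+1)))//; first exact: measurable_rV_cons.
  by move=> mc; rewrite integral_pushforward.
by split; [rewrite -integral12_prod_meas1|rewrite -integral21_prod_meas1].
Qed.

End rV_measure.
Arguments cube {R} n M.

(** * Compactly supported continuously differentiable functions *)

(** The compact support makes the fundamental theorem of calculus hold without
    boundary terms, on the whole line for the first claim and on the half line
    below [t] for the second. *)
Lemma ftc_compact (R : realType) (F f : R -> R) (M : R) :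
  (forall t, derivable F t 1) -> (forall t, 'D_1 F t = f t) -> continuous f ->
  (forall t, M < `|t| -> F t = 0) -> (forall t, M < `|t| -> f t = 0) ->
  (\int[lebesgue_measure]_t (f t)%:E = 0)%E /\
  forall t, (`|F t|%:E <= \int[lebesgue_measure]_s `|f s|%:E)%E.
Proof.
move=> dF F'f cf F0 f0.
have cF : continuous F.
  by move=> t; apply: differentiable_continuous; apply/derivable1_diffP.
have ftc a b : a < b ->
    (\int[lebesgue_measure]_(x in `[a, b]) (f x)%:E = (F b)%:E - (F a)%:E)%E.
  move=> ab; apply: continuous_FTC2 => //.
  - exact: continuous_subspaceT.
  - split; first by move=> x _; exact: dF.
      exact/cvg_at_right_filter/cF.
    exact/cvg_at_left_filter/cF.
  - by move=> x _; rewrite derive1E F'f.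
have mf : measurable_fun setT (EFin \o f).
  apply/measurable_EFinP. exact: continuous_measurable_fun.
split.
  pose L := `|M| + 1.
  have LM : M < L by rewrite /L (le_lt_trans (ler_norm M))// ltrDl.
  have L0 : 0 < L by rewrite /L ltr_wpDl.
  transitivity (\int[lebesgue_measure]_(t in `[(- L)%R, L]) (f t)%:E)%E.
    rewrite [RHS]integral_mkcond; apply: eq_integral => t _.
    rewrite patchE; case: ifPn => //; rewrite notin_setE/= in_itv/= => /negP tL.
    rewrite f0// (lt_trans LM)// ltNge; apply/negP; rewrite ler_norml.
    exact/negP.
  rewrite ftc ?gtrN// !F0 ?normrN ?(gtr0_norm L0)//.
  by rewrite subee.
move=> t; pose a := - (`|M| + `|t| + 1).
have Ma : M < `|a|.
  rewrite /a normrN ger0_norm ?addr_ge0//.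
  by have := ler_norm M; have := normr_ge0 t; lra.
have aLt : a < t by rewrite /a; have := ler_norm (- t); rewrite normrN;
  have := normr_ge0 M; lra.
have -> : (`|F t|%:E = `| \int[lebesgue_measure]_(x in `[a, t]) (f x)%:E |)%E.
  by rewrite ftc// (F0 a)// sube0.
apply: le_trans (le_abse_integral _ _ _) _ => //.
  exact: measurable_funTS.
apply: ge0_subset_integral => //.
exact: measurableT_comp.
Qed.

Section C1c.
Context (R : realType).

(** Supports are controlled by cubes centred at the origin, a notion which is
    inherited by slices. *)
Definition C1c n (M : R) (f : 'rV[R]_n -> R) : Prop :=
  [/\ continuous f, forall i x, derivable f x (delta_mx ord0 i),
      forall i, continuous (pderiv i f) &
      forall x, ~ cube n M x -> f x = 0].

Lemma rV_cons_continuousl n (v : 'rV[R]_n) :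
  continuous (fun t : R => rV_cons (t, v)).
Proof.
move=> t A /nbhs_ballP[e /= e0 eA]; apply/nbhs_ballP; exists e => // s ts.
apply: eA; apply/rV_ballP => // i; have [j ->|->] := unliftP ord0 i.
  by rewrite !rV_consS subrr normr0.
by rewrite !rV_cons0.
Qed.

Lemma rV_cons_continuousr n (t : R) :
  continuous (fun v : 'rV[R]_n => rV_cons (t, v)).
Proof.
move=> v A /nbhs_ballP[e /= e0 eA]; apply/nbhs_ballP; exists e => // w /rV_ballP vw.
apply: eA; apply/rV_ballP => // i; have [j ->|->] := unliftP ord0 i.
  by rewrite !rV_consS; exact: vw.
by rewrite !rV_cons0 subrr normr0.
Qed.

Lemma open_cubeC n M : open (~` cube n M : set 'rV[R]_n).
Proof.
rewrite openE => x /existsNP[i /negP]; rewrite -ltNge => Mx.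
apply/nbhs_ballP; exists (`|x ord0 i| - M); first by rewrite /= subr_gt0.
have Mx' : 0 < `|x ord0 i| - M by rewrite subr_gt0.
move=> y /(rV_ballP _ _ Mx')/(_ i) xy yM; have := yM i.
have := ler_normD (x ord0 i - y ord0 i) (y ord0 i); rewrite subrK; lra.
Qed.

Lemma pderiv_cube0 n M (f : 'rV[R]_n -> R) i x : C1c M f ->
  ~ cube n M x -> pderiv i f x = 0.
Proof.
move=> [_ _ _ f0] xM; rewrite /pderiv (@near_eq_derive _ _ _ f (cst 0)).
  exact: derive_cst.
have : (\near x, (~` cube n M) x) by apply: open_nbhs_nbhs; split => //; exact: open_cubeC.
by apply: filterS => y; exact: f0.
Qed.

Lemma compact_cube n M : compact (cube n M : set 'rV[R]_n).
Proof.
have := @rV_compact R n (fun=> `[(- M), M]%classic) (fun=> @segment_compact _ _ _).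
congr compact; apply/seteqP; split => x /= H i; have := H i;
  by rewrite /= in_itv/= ler_norml.
Qed.

Lemma continuous_cube_bounded n M (g : 'rV[R]_n -> R) : continuous g ->
  (forall x, ~ cube n M x -> g x = 0) -> exists C, forall x, `|g x| <= C.
Proof.
move=> cg g0.
have := @continuous_compact _ _ g (cube n M) (continuous_subspaceT cg) (@compact_cube n M).
move=> /compact_bounded[C [_ HC]]; exists (`|C| + 1) => x.
have [xM|/g0 ->] := pselect (cube n M x); last by rewrite normr0 addr_ge0.
apply: HC; last by exists x.
by rewrite (le_lt_trans (ler_norm C))// ltrDl.
Qed.

Lemma integrable_continuous_cube n M (g : 'rV[R]_n -> R) : continuous g ->
  (forall x, ~ cube n M x -> g x = 0) ->
  (lebesgue_rV R n).-integrable setT (EFin \o g).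
Proof.
move=> cg g0; have mg := measurable_continuous_rV cg.
have [C gC] := continuous_cube_bounded cg g0.
have -> : EFin \o g = (EFin \o g) \_ (cube n M).
  apply/funext => x; rewrite patchE; case: ifPn => //; rewrite notin_setE => /g0.
  by move=> /= ->.
apply/(@integrable_mkcond _ _ _ _ _ (EFin \o g) (@measurable_cube R n M)).
apply: measurable_bounded_integrable.
- exact: measurable_cube.
- exact: cube_lty.
- exact: measurable_funTS.
- exists C; split; first exact: num_real.
  by move=> y Cy x _ /=; rewrite (le_trans (gC x))// ltW.
Qed.

(** The difference quotients of [f] in the first coordinate and those of its
    restriction to a line are the same function of the increment. *)
Lemma C1c_lineE n (f : 'rV[R]_n.+1 -> R) (t : R) v :
  (fun h : R => h^-1 *: (((fun s => f (rV_cons (s, v))) \o shift t) (h *: 1) -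
      f (rV_cons (t, v)))) =
  (fun h : R => h^-1 *: ((f \o shift (rV_cons (t, v))) (h *: delta_mx ord0 ord0) -
      f (rV_cons (t, v)))).
Proof.
apply/funext => h /=; congr (_ *: (f _ - _)); apply/rowP => i.
have [j ->|->] := unliftP ord0 i; rewrite !mxE ?liftK ?unlift_none /=.
  by rewrite mulr0 add0r.
by [].
Qed.

Lemma C1c_sliceE n (f : 'rV[R]_n.+1 -> R) (t : R) v j :
  (fun h : R => h^-1 *: (((fun w => f (rV_cons (t, w))) \o shift v)
      (h *: delta_mx ord0 j) - f (rV_cons (t, v)))) =
  (fun h : R => h^-1 *: ((f \o shift (rV_cons (t, v)))
      (h *: delta_mx ord0 (lift ord0 j)) - f (rV_cons (t, v)))).
Proof.
apply/funext => h /=; congr (_ *: (f _ - _)); apply/rowP => i.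
have [k ->|->] := unliftP ord0 i; rewrite !mxE ?liftK ?unlift_none /=.
  by rewrite !mxE (inj_eq lift_inj).
by rewrite mulr0 add0r.
Qed.

Lemma C1c_line n M (f : 'rV[R]_n.+1 -> R) v : C1c M f ->
  let F t := f (rV_cons (t, v)) in
  let F' t := pderiv ord0 f (rV_cons (t, v)) in
  [/\ forall t, derivable F t 1, forall t, 'D_1 F t = F' t, continuous F' &
   (forall t, M < `|t| -> F t = 0) /\ (forall t, M < `|t| -> F' t = 0)].
Proof.
move=> Hf F F'; have [cf df cdf f0] := Hf.
have out t : M < `|t| -> ~ cube n.+1 M (rV_cons (t, v)).
  by move=> Mt /(_ ord0); rewrite rV_cons0 leNgt Mt.
split.
- by move=> t; rewrite /derivable C1c_lineE; exact: df.
- by move=> t; rewrite /derive C1c_lineE.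
- by move=> t; apply: continuous_comp; [exact: rV_cons_continuousl|exact: cdf].
- by split => t /out H; [exact: f0|exact: pderiv_cube0 H].
Qed.

Lemma pderiv_slice n (f : 'rV[R]_n.+1 -> R) t j v :
  pderiv j (fun w => f (rV_cons (t, w))) v = pderiv (lift ord0 j) f (rV_cons (t, v)).
Proof. by rewrite /pderiv /derive C1c_sliceE. Qed.

Lemma C1c_slice n M (f : 'rV[R]_n.+1 -> R) t : C1c M f ->
  C1c M (fun v => f (rV_cons (t, v))).
Proof.
move=> [cf df cdf f0]; split.
- by move=> v; apply: continuous_comp; [exact: rV_cons_continuousr|exact: cf].
- by move=> j v; rewrite /derivable C1c_sliceE; exact: df.
- move=> j; have -> : pderiv j (fun v => f (rV_cons (t, v))) =
     (fun v => pderiv (lift ord0 j) f (rV_cons (t, v))).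
    by apply/funext => v; rewrite pderiv_slice.
  by move=> v; apply: continuous_comp; [exact: rV_cons_continuousr|exact: cdf].
- move=> v vM; apply: f0 => H; apply: vM => i.
  by have := H (lift ord0 i); rewrite rV_consS.
Qed.

Lemma rV_continuousD n (f g : 'rV[R]_n -> R) :
  continuous f -> continuous g -> continuous (fun x => f x + g x).
Proof. by move=> cf cg x; apply: (@continuousD _ _ _ f g x (cf x) (cg x)). Qed.

Lemma rV_continuousM n (f g : 'rV[R]_n -> R) :
  continuous f -> continuous g -> continuous (fun x => f x * g x).
Proof. by move=> cf cg x; apply: (@continuousM _ _ f g x (cf x) (cg x)). Qed.

Lemma C1c_mul n M (f g : 'rV[R]_n -> R) : C1c M f -> C1c M g ->
  C1c M (fun x => f x * g x) /\
  forall i x, pderiv i (fun x => f x * g x) x = f x * pderiv i g x + pderiv i f x * g x.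
Proof.
move=> [cf df cdf f0] [cg dg cdg g0].
have E i x : pderiv i (fun x => f x * g x) x = f x * pderiv i g x + pderiv i f x * g x.
  have H := deriveM (df i x) (dg i x).
  rewrite [g x *: _]mulrC in H.
  exact: H.
split; [split|exact: E].
- exact: rV_continuousM.
- by move=> i x; exact: derivableM.
- move=> i; rewrite (_ : pderiv i _ =
    (fun x => f x * pderiv i g x + pderiv i f x * g x)); last exact/funext/E.
  exact: rV_continuousD (rV_continuousM cf (cdg i)) (rV_continuousM (cdf i) cg).
- by move=> x /f0 ->; rewrite mul0r.
Qed.

(** By Fubini, the integral over the lines parallel to the differentiation
    direction comes first. *)
Lemma integral_pderiv n M (f : 'rV[R]_n -> R) i : C1c M f ->
  (\int[lebesgue_rV R n]_x (pderiv i f x)%:E = 0)%E.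
Proof.
elim: n f i => [f [[]]//|n ih f i Hf].
have [_ _ cdf _] := Hf.
have ii := integrable_continuous_cube (cdf i) (fun x => @pderiv_cube0 _ M f i x Hf).
have mi : measurable_fun setT (EFin \o pderiv i f).
  by apply/measurable_EFinP; apply: measurable_continuous_rV; exact: cdf.
have [Fub1 Fub2] := rV_fubini mi ii.
case: (unliftP ord0 i) => [j ij|i0].
  rewrite Fub1 ij; under eq_integral => t _.
    under eq_integral do rewrite /= -pderiv_slice.
    rewrite ih; last exact: C1c_slice Hf.
    over.
  by rewrite integral0.
rewrite Fub2 i0; under eq_integral => v _.
  have [d1 d2 d3 [d4 d5]] := C1c_line v Hf.
  have [-> _] := ftc_compact d1 d2 d3 d4 d5.
  over.
by rewrite integral0.
Qed.

End C1c.

(** * The inequalities of Poincare and Ladyzhenskaya *)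

Section C1c_inequalities.
Context (R : realType).

Definition intT n (g : 'rV[R]_n -> R) : \bar R :=
  (\int[lebesgue_rV R n]_x (g x)%:E)%E.

Local Notation "'J_ n [ g ]" := (@intT n g%R)
  (at level 8, n at level 2, format "''J_' n [ g ]").

Lemma intT_ge0 n (g : 'rV[R]_n -> R) : (forall x, 0 <= g x) -> (0 <= 'J_n[g])%E.
Proof. by move=> g0; apply: integral_ge0 => x _; rewrite lee_fin. Qed.

Definition ipT n (f g : 'rV[R]_n -> R) : R :=
  ip (lebesgue_rV R n) setT f g.

Lemma EFin_ipT n (f : 'rV[R]_n -> R) : sqint (lebesgue_rV R n) setT f ->
  (ipT f f)%:E = 'J_n[fun x => f x ^+ 2].
Proof. exact: EFin_ip. Qed.

Lemma ipT_ge0 n (f : 'rV[R]_n -> R) : 0 <= ipT f f.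
Proof. exact: ip_ge0. Qed.

(** The modulus of the derivative of [f ^ 2] in the direction [i]. *)
Definition cross n (f : 'rV[R]_n -> R) i : 'rV[R]_n -> R :=
  fun x => `|2 * f x * pderiv i f x|.

Lemma C1c_measurable n M (f : 'rV[R]_n -> R) : C1c M f ->
  measurable_fun setT f /\ forall i, measurable_fun setT (pderiv i f).
Proof.
move=> [cf _ cdf _]; split => [|i]; apply: measurable_continuous_rV; first exact: cf.
exact: cdf.
Qed.

Lemma measurable_cross n M (f : 'rV[R]_n -> R) i : C1c M f ->
  measurable_fun setT (EFin \o cross f i).
Proof.
move=> /C1c_measurable[mf mdf]; apply/measurable_EFinP.
apply: measurableT_comp => //; apply: measurable_funM => //.
exact: measurable_funM.
Qed.

Lemma C1c_sqint n M (f : 'rV[R]_n -> R) : C1c M f ->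
  sqint (lebesgue_rV R n) setT f /\
  forall i, sqint (lebesgue_rV R n) setT (pderiv i f).
Proof.
move=> Hf; have [mf mdf] := C1c_measurable Hf; have [cf _ cdf f0] := Hf.
have key (g : 'rV[R]_n -> R) : continuous g -> (forall x, ~ cube n M x -> g x = 0) ->
    sqint (lebesgue_rV R n) setT g.
  move=> cg g0; split; first exact: measurable_continuous_rV.
  apply: (@integrable_continuous_cube _ _ M _ (rV_continuousM cg cg)) => x Hx.
  by rewrite g0// mul0r.
split=> [|i]; apply: key; [exact: cf|exact: f0|exact: cdf|].
by move=> x; exact: pderiv_cube0 Hf.
Qed.

(** The fundamental theorem of calculus bounds [f ^ 2] at a point by the
    integral of [cross f ord0] over the line through it; integrating over the
    lines that meet the slice gives a bound uniform in [t]. *)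
Lemma slice_sup n M (f : 'rV[R]_n.+1 -> R) t : C1c M f ->
  ('J_n[fun v => f (rV_cons (t, v)) ^+ 2] <= 'J_n.+1[cross f ord0])%E.
Proof.
move=> Hf; have [Hff dff] := C1c_mul Hf Hf.
have mc := measurable_cross ord0 Hf.
rewrite /intT [leRHS](rV_tonelli_swap mc); last by move=> x; rewrite /= lee_fin normr_ge0.
apply: ge0_le_integral => //.
- by move=> v _; rewrite lee_fin sqr_ge0.
- apply/measurable_EFinP/measurable_funX.
  by have [] := C1c_measurable (C1c_slice t Hf).
- apply: (@measurable_fun_fubini_tonelli_G _ _ _ _ _ (@lebesgue_measure R)
    (fun p : measurableTypeR R * 'rV[R]_n => (cross f ord0 (rV_cons p))%:E)).
    by apply: (measurableT_comp mc); exact: measurable_rV_cons.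
  by move=> p; rewrite lee_fin normr_ge0.
- move=> v _; have [d1 d2 d3 [d4 d5]] := C1c_line v Hff.
  have [_ /(_ t)] := ftc_compact d1 d2 d3 d4 d5.
  rewrite -expr2 ger0_norm ?sqr_ge0// => /le_trans; apply.
  rewrite le_eqVlt; apply/orP; left; apply/eqP; apply: eq_integral => s _.
  by rewrite dff /cross; congr (`|_|%:E); ring.
Qed.

(** The induction step on the dimension: an estimate of the quartic integral of
    each slice by its mean square times [Tf t] becomes, after [slice_sup], an
    estimate in one more dimension where only [Tf] remains to be integrated. *)
Lemma quartic_slice_le n M (f : 'rV[R]_n.+1 -> R) (Tf : R -> \bar R) : C1c M f ->
  measurable_fun [set: measurableTypeR R] Tf -> (forall t, 0 <= Tf t)%E ->
  (forall t, 'J_n[fun v => f (rV_cons (t, v)) ^+ 4] <=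
     'J_n[fun v => f (rV_cons (t, v)) ^+ 2] * Tf t)%E ->
  ('J_n.+1[fun x => f x ^+ 4] <=
     'J_n.+1[cross f ord0] * \int[lebesgue_measure]_t Tf t)%E.
Proof.
move=> Hf mT T0 fT; have [mf _] := C1c_measurable Hf.
have m4 : measurable_fun setT (fun x => (f x ^+ 4)%:E).
  exact/measurable_EFinP/measurable_funX.
rewrite [leLHS]/intT rV_tonelli//; last by move=> x; rewrite lee_fin -[4%N]/(2 * 2)%N exprM sqr_ge0.
have c0 : (0 <= 'J_n.+1[cross f ord0])%E.
  by apply: intT_ge0 => x; exact: normr_ge0.
rewrite -ge0_integralZl//.
apply: ge0_le_integral => //.
- by move=> t _; apply: integral_ge0 => v _;
    rewrite lee_fin -[4%N]/(2 * 2)%N exprM sqr_ge0.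
- apply: (@measurable_fun_fubini_tonelli_F _ _ _ _ _ (lebesgue_rV R n)
    (fun p : measurableTypeR R * 'rV[R]_n => (f (rV_cons p) ^+ 4)%:E)).
    by apply: (measurableT_comp m4); exact: measurable_rV_cons.
  by move=> p; rewrite lee_fin -[4%N]/(2 * 2)%N exprM sqr_ge0.
- by apply: emeasurable_funM => //; exact: measurable_cst.
- move=> t _; apply: le_trans (fT t) _; apply: lee_wpmul2r => //.
  exact: slice_sup Hf.
Qed.

Lemma slice_integral n (g : 'rV[R]_n.+1 -> R) :
  measurable_fun setT g -> (forall x, 0 <= g x) ->
  measurable_fun [set: measurableTypeR R]
     (fun t => 'J_n[fun v => g (rV_cons (t, v))]) /\
  (\int[lebesgue_measure]_t 'J_n[fun v => g (rV_cons (t, v))] = 'J_n.+1[g])%E.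
Proof.
move=> mg g0; split; last first.
  have mE : measurable_fun setT (EFin \o g) by exact/measurable_EFinP.
  by rewrite /intT [RHS](rV_tonelli mE)// => x; rewrite /= lee_fin.
apply: (@measurable_fun_fubini_tonelli_F _ _ _ _ _ (lebesgue_rV R n)
    (fun p : measurableTypeR R * 'rV[R]_n => (g (rV_cons p))%:E)).
  apply/measurable_EFinP.
  by apply: (measurableT_comp mg); exact: measurable_rV_cons.
by move=> p; rewrite lee_fin.
Qed.

(** By Cauchy-Schwarz; the absolute values inside the integral are harmless
    because those of [f] and of its derivative have the same norms. *)
Lemma cross_real n M (f : 'rV[R]_n -> R) i : C1c M f ->
  exists2 s : R, 'J_n[cross f i] = s%:E & 0 <= s /\
   s ^+ 2 <= 4 * ipT f f *
     ipT (pderiv i f) (pderiv i f).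
Proof.
move=> Hf; have [sf sdf] := C1c_sqint Hf; set mu := lebesgue_rV R n.
have abs (g : 'rV[R]_n -> R) : sqint mu setT g -> sqint mu setT (Num.norm \o g).
  move=> [mg ig]; split; first exact: measurableT_comp.
  by apply: eq_integrable ig => // x _; rewrite /= real_normK ?num_real.
have absE (g : 'rV[R]_n -> R) : ip mu setT (Num.norm \o g) (Num.norm \o g) = ip mu setT g g.
  by apply: eq_Rintegral => x _ /=; rewrite -!expr2 real_normK ?num_real.
exists (2 * ip mu setT (Num.norm \o f) (Num.norm \o pderiv i f)).
  rewrite /ip -RintegralZl//; last exact: sqint_mul (abs _ sf) (abs _ (sdf i)).
  rewrite /Rintegral /intT fineK.
    by apply: eq_integral => x _; rewrite /cross !normrM (@ger0_norm _ 2)//= mulrA.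
  apply: integrable_fin_num => //.
  apply: integrableRZ => //; exact: sqint_mul (abs _ sf) (abs _ (sdf i)).
split.
  by rewrite mulr_ge0//; apply: Rintegral_ge0 => x _; rewrite mulr_ge0 /=.
have := ip_CS measurableT (abs _ sf) (abs _ (sdf i)).
rewrite !absE exprMn /ipT -/mu; move: (ip _ _ f f) (ip _ _ (pderiv i f) _) => a b; lra.
Qed.

(** Each slice has mean square at most [s], the integral of [cross f ord0], and
    slices outside [[-M, M]] vanish: hence [a <= 2 M s], where
    [s^2 <= 4 a b] by [cross_real]. *)
Lemma C1c_poincare0 n M (f : 'rV[R]_n.+1 -> R) : 0 <= M -> C1c M f ->
  ipT f f <=
  16 * M ^+ 2 * ipT (pderiv ord0 f) (pderiv ord0 f).
Proof.
move=> M0 Hf; have [s sE [s0 s2]] := cross_real ord0 Hf.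
have [sf sdf] := C1c_sqint Hf; have [mf _] := C1c_measurable Hf.
set a := ipT f f in s2 *; set b := ipT _ _ in s2 *.
have a0 : 0 <= a := ipT_ge0 _.
suff ha : a <= 2 * M * s.
  have h1 : a ^+ 2 <= (2 * M * s) ^+ 2.
    by rewrite ler_pXn2r ?nnegrE// ?mulr_ge0.
  have h2 : a * a <= (16 * M ^+ 2 * b) * a.
    apply: (@le_trans _ _ (4 * M ^+ 2 * s ^+ 2)); first by move: h1; rewrite !exprMn; lra.
    have -> : 16 * M ^+ 2 * b * a = 4 * M ^+ 2 * (4 * a * b) by ring.
    by rewrite ler_wpM2l// mulr_ge0// sqr_ge0.
  have [a1|a1] := eqVneq a 0; first by rewrite a1 !mulr_ge0 ?sqr_ge0 ?ipT_ge0.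
  by rewrite -(ler_pM2r (_ : 0 < a)) // lt0r a1.
have [m1 m2] := slice_integral (measurable_funX 2 mf) (fun x => sqr_ge0 (f x)).
rewrite -lee_fin EFin_ipT// -m2.
have -> : (\int[lebesgue_measure]_t 'J_n[fun v => f (rV_cons (t, v)) ^+ 2] =
  \int[lebesgue_measure]_(t in `[(- M)%R, M])
    'J_n[fun v => f (rV_cons (t, v)) ^+ 2])%E.
  rewrite [RHS]integral_mkcond; apply: eq_integral => t _.
  rewrite patchE; case: ifPn => //; rewrite notin_setE/= in_itv/= => /negP tL.
  rewrite /intT integral0_eq// => v _; have [_ _ _ f0] := Hf.
  rewrite f0 ?expr0n// => /(_ ord0); rewrite rV_cons0 ler_norml; exact/negP.
apply: (@le_trans _ _ (\int[lebesgue_measure]_(t in `[(- M)%R, M]) cst s%:E t)%E).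
  apply: ge0_le_integral => //.
  - by move=> t _; apply: intT_ge0 => v; exact: sqr_ge0.
  - exact: measurable_funTS.
  - by move=> t _; rewrite /= -sE; exact: slice_sup Hf.
rewrite integral_cst// [X in (_ * X)%E]lebesgue_measure_itv/= lte_fin.
case: ifPn => MM; last by rewrite mule0 lee_fin !mulr_ge0.
by rewrite -EFinD -EFinM lee_fin; lra.
Qed.

(** The dimension zero, where the slices are points and
    [f^4 = f^2 * f^2], starts the induction. *)
Lemma ladyzhenskaya1 M (f : 'rV[R]_1 -> R) : C1c M f ->
  ('J_1[fun x => f x ^+ 4] <= 'J_1[fun x => f x ^+ 2] * 'J_1[cross f ord0])%E.
Proof.
move=> Hf; have [mf _] := C1c_measurable Hf.
have [m1 E1] := slice_integral (measurable_funX 2 mf) (fun x => sqr_ge0 (f x)).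
rewrite muleC -E1; apply: (quartic_slice_le Hf) => //.
  by move=> t; apply: intT_ge0 => v; exact: sqr_ge0.
move=> t; have [mft _] := C1c_measurable (C1c_slice t Hf).
have m2 k : measurable_fun setT (fun v => (f (rV_cons (t, v)) ^+ k)%:E).
  exact/measurable_EFinP/measurable_funX.
rewrite /intT !integral_dirac// !diracT !mul1e -EFinM lee_fin.
by rewrite -exprD.
Qed.

Lemma ladyzhenskaya2_cross M (f : 'rV[R]_2 -> R) : C1c M f ->
  ('J_2[fun x => f x ^+ 4] <= 'J_2[cross f ord0] * 'J_2[cross f (lift ord0 ord0)])%E.
Proof.
move=> Hf; have [mf mdf] := C1c_measurable Hf.
have mc : measurable_fun setT (cross f (lift ord0 ord0)).
  apply: measurableT_comp => //; apply: measurable_funM => //.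
  exact: measurable_funM.
have [m1 <-] := slice_integral mc (fun x => normr_ge0 _).
apply: (quartic_slice_le Hf) => //.
  by move=> t; apply: intT_ge0 => v; exact: normr_ge0.
move=> t; apply: le_trans (ladyzhenskaya1 (C1c_slice t Hf)) _.
apply: lee_wpmul2l; first by apply: intT_ge0 => v; exact: sqr_ge0.
rewrite le_eqVlt; apply/orP; left; apply/eqP; apply: eq_integral => v _.
by rewrite /cross pderiv_slice.
Qed.

Let mul_le_of_sqr (s t a b c : R) : s ^+ 2 <= 4 * a * b -> t ^+ 2 <= 4 * a * c ->
  s * t <= a * (2 * (b + c)).
Proof. by have := sqr_ge0 (s - t); lra. Qed.

Lemma ladyzhenskaya2 M (f : 'rV[R]_2 -> R) : C1c M f ->
  ('J_2[fun x => f x ^+ 4] <= 'J_2[fun x => f x ^+ 2] *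
     (2%:E * \sum_i 'J_2[fun x => pderiv i f x ^+ 2%N]))%E.
Proof.
move=> Hf; apply: le_trans (ladyzhenskaya2_cross Hf) _.
have [sf sdf] := C1c_sqint Hf.
under eq_bigr do rewrite -EFin_ipT//.
rewrite -(EFin_ipT sf) big_ord_recl big_ord1.
have [s -> [s0 s2]] := cross_real ord0 Hf.
have [s' -> [s'0 s'2]] := cross_real (lift ord0 ord0) Hf.
rewrite -EFinD -!EFinM lee_fin; exact: mul_le_of_sqr.
Qed.

(** The factor [cross f ord0] comes from the third dimension, the gradient from
    the two-dimensional inequality on the slices. *)
Lemma ladyzhenskaya3 M (f : 'rV[R]_3 -> R) : C1c M f ->
  ('J_3[fun x => f x ^+ 4] <= 'J_3[cross f ord0] *
     (2%:E * \sum_i 'J_3[fun x => pderiv (lift ord0 i) f x ^+ 2%N]))%E.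
Proof.
move=> Hf; have [mf mdf] := C1c_measurable Hf.
pose A i t := 'J_2[fun v => pderiv (lift ord0 i) f (rV_cons (t, v)) ^+ 2].
have A0 i t : (0 <= A i t)%E by apply: intT_ge0 => v; exact: sqr_ge0.
have sq i : measurable_fun [set: measurableTypeR R] (A i) /\
    (\int[lebesgue_measure]_t A i t =
     'J_3[fun x => pderiv (lift ord0 i) f x ^+ 2%N])%E.
  exact: (slice_integral (measurable_funX 2 (mdf (lift ord0 i)))
   (fun x => sqr_ge0 (pderiv (lift ord0 i) f x))).
have mS : measurable_fun [set: measurableTypeR R] (fun t => \sum_i A i t)%E.
  by apply: emeasurable_sum => i; exact: (sq i).1.
have S0 t : (0 <= \sum_i A i t)%E by apply: sume_ge0.
have <- : (\int[lebesgue_measure]_t (2%:E * \sum_i A i t) =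
    2%:E * \sum_i 'J_3[fun x => pderiv (lift ord0 i) f x ^+ 2%N])%E.
  rewrite ge0_integralZl//; congr (_ * _)%E.
  rewrite ge0_integral_sum//; last by move=> i; exact: (sq i).1.
  by apply: eq_bigr => i _; exact: (sq i).2.
apply: (quartic_slice_le Hf).
- by apply: emeasurable_funM; [exact: measurable_cst|exact: mS].
- by move=> t; apply: mule_ge0.
- move=> t; have H := ladyzhenskaya2 (C1c_slice t Hf).
  have E i : 'J_2[fun v => pderiv i (fun w => f (rV_cons (t, w))) v ^+ 2] = A i t.
    by congr intT; apply/funext => v; rewrite pderiv_slice.
  rewrite (eq_bigr _ (fun i _ => E i)) in H.
  exact: H.
Qed.

(** With [k = 16 M^2 + 1] both the mean square of [f] and the integrals of
    [cross f i] are at most [k] times the Dirichlet integral, and each of the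
    inequalities in dimensions one to three bounds the quartic integral by at
    most twice a product of two such quantities. *)
Definition ladyzhenskaya_const (M : R) := 2 * (16 * M ^+ 2 + 1) ^+ 2.

Lemma C1c_poincare n M (f : 'rV[R]_n -> R) : (1 <= n)%N -> 0 <= M -> C1c M f ->
  ipT f f <= 16 * M ^+ 2 *
    \sum_i ipT (pderiv i f) (pderiv i f).
Proof.
case: n f => // n f _ M0 Hf; apply: le_trans (C1c_poincare0 M0 Hf) _.
rewrite ler_wpM2l ?mulr_ge0 ?sqr_ge0//.
by rewrite big_ord_recl lerDl sumr_ge0// => i _; exact: ipT_ge0.
Qed.

Lemma C1c_ladyzhenskaya n M (f : 'rV[R]_n -> R) : (1 <= n <= 3)%N -> 0 <= M ->
  C1c M f ->
  ('J_n[fun x => f x ^+ 4] <= (ladyzhenskaya_const M *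
    (\sum_i ipT (pderiv i f) (pderiv i f)) ^+ 2)%:E)%E.
Proof.
move=> n13 M0 Hf; have n1 : (1 <= n)%N by case/andP: n13.
have := C1c_poincare n1 M0 Hf.
set a := ipT f f; set N := \sum_i _ => aN.
have a0 : 0 <= a := ipT_ge0 _.
have [sf sdf] := C1c_sqint Hf.
have bi i : 0 <= ipT (pderiv i f) (pderiv i f) <= N.
  rewrite ipT_ge0 /N (bigD1 i)//= lerDl sumr_ge0// => j _; exact: ipT_ge0.
have N0 : 0 <= N by apply: sumr_ge0 => i _; exact: ipT_ge0.
set k := 16 * M ^+ 2 + 1.
have k1 : 1 <= k by rewrite /k; have := sqr_ge0 M; lra.
have aN' : a <= k * N by rewrite /k; lra.
have kN0 : 0 <= k * N by rewrite mulr_ge0//; lra.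
have NkN : N <= k * N by rewrite ler_peMl.
have fin c : c <= 2 * (k * N) ^+ 2 -> (c%:E <= (ladyzhenskaya_const M * N ^+ 2)%:E)%E.
  by move=> H; rewrite lee_fin /ladyzhenskaya_const -/k -mulrA -exprMn.
have cr i : exists2 s : R, 'J_n[cross f i] = s%:E & 0 <= s <= k * N.
  have [s sE [s0 s2]] := cross_real i Hf; exists s => //; rewrite s0/=.
  have /andP[b0 bN] := bi i; rewrite -/a in s2.
  move: (ipT _ _) b0 bN s2 => b b0 bN s2.
  have h : s ^+ 2 <= (a + b) ^+ 2 by have := sqr_ge0 (a - b); lra.
  have {}h : s <= a + b by rewrite -(@ler_pXn2r _ 2)// ?nnegrE// addr_ge0.
  by apply: le_trans h _; rewrite /k; lra.
move: n13; case: n f Hf n1 @a @N aN a0 sf sdf bi N0 aN' kN0 NkN fin cr => [//|[|[|[|//]]]]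
  f Hf _ a N aN a0 sf sdf bi N0 aN' kN0 NkN fin cr _.
- apply: le_trans (ladyzhenskaya1 Hf) _.
  have [s -> /andP[s0 sk]] := cr ord0; rewrite -EFin_ipT// -EFinM; apply: fin.
  have : a * s <= (k * N) * (k * N) by exact: ler_pM.
  have := sqr_ge0 (k * N); rewrite -/a; lra.
- apply: le_trans (ladyzhenskaya2_cross Hf) _.
  have [s -> /andP[s0 sk]] := cr ord0.
  have [s' -> /andP[s'0 s'k]] := cr (lift ord0 ord0).
  rewrite -EFinM; apply: fin.
  have : s * s' <= (k * N) * (k * N) by exact: ler_pM.
  have := sqr_ge0 (k * N); lra.
- apply: le_trans (ladyzhenskaya3 Hf) _.
  have [s -> /andP[s0 sk]] := cr ord0.
  under eq_bigr do rewrite -EFin_ipT//.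
  rewrite sumEFin -!EFinM; apply: fin.
  rewrite mulrCA ler_wpM2l// expr2 ler_pM//; last first.
    apply: le_trans NkN; rewrite /N [leRHS]big_ord_recl lerDr; exact: ipT_ge0.
  by apply: sumr_ge0 => i _; exact: ipT_ge0.
Qed.

End C1c_inequalities.

(** * Smooth bumps *)

Section flat.
Context (R : realType) (c : R).
Hypothesis c0 : 0 < c.

(** The functions [y |-> y^-k exp (- c / y)], extended by [0] to [y <= 0]; up to
    linear combinations this family is stable under differentiation. *)
Definition flat (k : nat) (y : R) : R :=
  if 0 < y then y^-1 ^+ k * expR (- c * y^-1) else 0.

Lemma flat_ge0 k y : 0 <= flat k y.
Proof.
by rewrite /flat; case: ifP => // y0; rewrite mulr_ge0 ?expR_ge0// exprn_ge0// invr_ge0 ltW.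
Qed.

(** The exponential dominates the power [k + 1] of [y^-1], which leaves one
    factor [y]: this is continuity at [0], and differentiability there since
    [flat k y / y = flat k.+1 y]. *)
Lemma flat_le k y : flat k y <= k.+1`!%:R / c ^+ k.+1 * `|y|.
Proof.
rewrite /flat; case: ifPn => [y0|_]; last first.
  by rewrite mulr_ge0// divr_ge0// exprn_ge0// ltW.
have x0 : 0 <= c * y^-1 by rewrite mulr_ge0 ?invr_ge0 ?ltW.
have := expR_ge1Dxn k x0; rewrite mulNr expRN.
set E := expR _ => h.
have E0 : 0 < E := expR_gt0 _.
have F0 : 0 < (k.+1`!%:R : R) by rewrite ltr0n fact_gt0.
have {}h : (c * y^-1) ^+ k.+1 <= k.+1`!%:R * E.
  by rewrite -ler_pdivrMl// mulrC; apply: le_trans h; rewrite lerDr.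
rewrite (gtr0_norm y0); move: h; rewrite exprMn (exprSr y^-1).
have Q0 : 0 < c ^+ k.+1 by rewrite exprn_gt0.
move: (y^-1 ^+ k) (c ^+ k.+1) (k.+1`!%:R) Q0 => P Q F Q0 h.
have -> : P * E^-1 = Q * (P * y^-1) * (Q^-1 * y * E^-1) by field; rewrite !gt_eqF.
have -> : F / Q * y = F * E * (Q^-1 * y * E^-1) by field; rewrite !gt_eqF.
by rewrite ler_wpM2r// !mulr_ge0 ?invr_ge0// ltW.
Qed.

Lemma is_derive_flat k (y : R) :
  is_derive y 1 (flat k) (c * flat k.+2 y - k%:R * flat k.+1 y).
Proof.
have [y0|y0|->] := ltrgt0P y.
- pose H z := z ^+ k * expR (- c * z).
  have dH (z : R) : is_derive z 1 H (k%:R * z ^+ k.-1 * expR (- c * z) - c * z ^+ k * expR (- c * z)).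
    have d1 : is_derive z 1 ((@id R) ^+ k) (k%:R * z ^+ k.-1 * 1).
      exact: is_deriveX.
    have d2 : is_derive z 1 (expR \o (- c \*: (@id R))) (expR (- c * z) * (- c * 1)).
      exact: is_derive1_comp.
    have := is_deriveM d1 d2.
    have -> : (@id R) ^+ k * (expR \o (- c \*: id)) = H.
      by apply/funext => t; rewrite /H exprfctE.
    by move=> /is_derive_eq; apply; rewrite /= exprfctE /GRing.scale/=; ring.
  have dinv : is_derive y 1 (fun t : R => t^-1) (- y ^- 2 *: 1).
    by apply: (@is_deriveV _ id); rewrite ?gt_eqF.
  have d := is_derive1_comp (dH y^-1) dinv.
  apply: near_eq_is_derive (is_derive_eq d _).
    near=> t; rewrite /= /flat /H ifT//; near: t; exact: lt_nbhsr.
  rewrite /flat y0 /GRing.scale/= mulr1 -exprVn.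
  case: k {H dH d} => [|k]; first by rewrite !mul0r expr0; ring.
  by rewrite /= !exprS; ring.
- have d := is_derive_cst (0 : R) y 1.
  apply: near_eq_is_derive (is_derive_eq d _).
    near=> t; rewrite /= /flat ifF//; apply/negbTE; rewrite -leNgt ltW//.
    near: t; exact: lt_nbhsl.
  by rewrite /flat ltNge ltW//= !mulr0 subr0.
- rewrite /flat ltxx !mulr0 subr0.
  suff H : (fun h : R => h^-1 *: ((flat k \o shift 0) (h *: 1) - flat k 0)) @ 0^' --> (0 : R).
    by apply: DeriveDef; [apply/cvg_ex; exists 0|exact/cvg_lim].
  apply/norm_cvg0P.
  pose C : R := k.+2`!%:R / c ^+ k.+2.
  apply: (@squeeze_cvgr _ _ _ _ (cst 0) (fun h => C * `|h|)).
  + near=> h; rewrite normr_ge0/=.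
    have h0 : h != 0 by near: h; exact: nbhs_dnbhs_neq.
    rewrite /shift/= addr0 {2}/flat ltxx subr0 [h%:A]mulr1.
    have -> : h^-1 *: flat k h = flat k.+1 h.
      rewrite /flat; case: ifP => _; last by rewrite scaler0.
      by rewrite /GRing.scale/= exprS mulrA.
    by rewrite ger0_norm ?flat_ge0// flat_le.
  + exact: cvg_cst.
  + have : (fun h : R => C * `|h|) @ 0 --> C * `|0 : R|.
      by apply: cvgMr; apply: cvg_norm.
    rewrite normr0 mulr0; apply: cvg_trans; apply: cvg_app.
    exact: cvg_within.
Unshelve. all: by end_near. Qed.

Lemma continuous_flat k : continuous (flat k).
Proof.
move=> y; apply: differentiable_continuous; apply/derivable1_diffP.
by have [] := is_derive_flat k y.
Qed.

End flat.

Section box_bump.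
Context (R : realType) (n : nat).

Lemma is_derive_line (f : 'rV[R]_n -> R) (x v : 'rV[R]_n) (df : R) :
  is_derive (0 : R) 1 (fun h : R => f (h *: v + x)) df -> is_derive x v f df.
Proof.
move=> [d1 d2]; apply: DeriveDef; first by apply/derivable1P.
rewrite -d2 /derive; set g1 := (fun h : R => h^-1 *: _).
set g2 := (X in _ = lim (X @ _)).
suff -> : g1 = g2 by [].
by apply/funext => h; rewrite /g1 /g2 /= addr0 scale0r add0r [_%:A]mulr1.
Qed.

Section fixed_parameter.
Variable c : R.
Hypothesis c0 : 0 < c.

(** The algebra generated by the [flat] functions of the coordinates is stable
    under partial differentiation, so its members are smooth; this avoids
    computing any iterated derivative. *)
Inductive flat_alg : ('rV[R]_n -> R) -> Prop :=
| flat_alg_flat i k s a : flat_alg (fun x => flat c k (s * (x ord0 i - a)))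
| flat_alg_cst a : flat_alg (fun=> a)
| flat_algD f g : flat_alg f -> flat_alg g -> flat_alg (fun x => f x + g x)
| flat_algM f g : flat_alg f -> flat_alg g -> flat_alg (fun x => f x * g x).

Lemma flat_alg_derive f j : flat_alg f -> exists2 f', flat_alg f' &
  forall x, is_derive x (delta_mx ord0 j) f (f' x).
Proof.
elim=> {f} [i k s a|a|f g _ [f' Ff' df] _ [g' Fg' dg]|f g Ff [f' Ff' df] Fg [g' Fg' dg]].
- exists (fun x => (((i == j)%:R * s) * c) * flat c k.+2 (s * (x ord0 i - a)) +
      - (((i == j)%:R * s) * k%:R) * flat c k.+1 (s * (x ord0 i - a))).
    by apply: flat_algD; apply: flat_algM;
      [exact: flat_alg_cst|exact: flat_alg_flat|exact: flat_alg_cst|exact: flat_alg_flat].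
  move=> x; apply: is_derive_line.
  have -> : (fun h : R => flat c k (s * ((h *: delta_mx ord0 j + x) ord0 i - a))) =
     flat c k \o (((i == j)%:R * s) \*: (@id R) + cst (s * (x ord0 i - a))).
    apply/funext => h /=; rewrite !mxE eqxx/=; congr (flat _ _ _).
    by rewrite -[RHS]/((i == j)%:R * s * h + s * (x ord0 i - a)); ring.
  have d1 : is_derive (0 : R) 1 (((i == j)%:R * s) \*: (@id R) + cst (s * (x ord0 i - a)))
      (((i == j)%:R * s) *: 1 + 0).
    exact: is_deriveD.
  have := is_derive_flat c0 k
    ((((i == j)%:R * s) \*: (@id R) + cst (s * (x ord0 i - a))) 0).
  move=> d2; apply: (is_derive_eq (is_derive1_comp d2 d1)).
  have -> : (((i == j)%:R * s) \*: (@id R) + cst (s * (x ord0 i - a))) 0 =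
      s * (x ord0 i - a).
    by rewrite -[LHS]/((i == j)%:R * s * 0 + s * (x ord0 i - a)) mulr0 add0r.
  by rewrite -[_ *: 1]/(_ * 1); ring.
- by exists (fun=> 0); [exact: flat_alg_cst|move=> x; exact: is_derive_cst].
- exists (fun x => f' x + g' x); first exact: flat_algD.
  by move=> x; exact: is_deriveD.
- exists (fun x => f x * g' x + g x * f' x).
    by apply: flat_algD; exact: flat_algM.
  by move=> x; exact: is_deriveM.
Qed.

Lemma flat_alg_continuous f : flat_alg f -> continuous f.
Proof.
elim=> {f} [i k s a|a|f g _ cf _ cg|f g _ cf _ cg].
- move=> x; apply: (@continuous_comp _ _ _ (fun x : 'rV[R]_n => s * (x ord0 i - a)) (flat c k)).
    apply: continuousM; first exact: cst_continuous.
    apply: continuousB; last exact: cst_continuous.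
    exact: coord_continuous.
  exact: continuous_flat.
- exact: cst_continuous.
- exact: rV_continuousD.
- exact: rV_continuousM.
Qed.

Lemma flat_alg_smooth f : flat_alg f -> smooth f.
Proof.
move=> Hf.
have pd g i : flat_alg g -> flat_alg (pderiv i g).
  move=> /(flat_alg_derive i)[g' Fg' dg]; suff -> : pderiv i g = g' by [].
  by apply/funext => x; have [] := dg x.
move=> s; have {}Hf : flat_alg (iter_pderiv s f).
  by elim: s => //= i s ih; exact: pd.
split; first exact: flat_alg_continuous.
by move=> i x; have [g' _ dg] := flat_alg_derive i Hf; have [] := dg x.
Qed.

(** Positive exactly on the open box, where it tends to [1] with [c]
    tending to [0]. *)
Definition box_bump (a b x : 'rV[R]_n) : R :=
  \prod_i (flat c 0 (1 * (x ord0 i - a ord0 i)) *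
           flat c 0 (-1 * (x ord0 i - b ord0 i))).

Lemma box_bump_smooth a b : smooth (box_bump a b).
Proof.
apply: flat_alg_smooth; rewrite (_ : box_bump a b = fun x => \prod_(i <- index_enum 'I_n)
  (flat c 0 (1 * (x ord0 i - a ord0 i)) * flat c 0 (-1 * (x ord0 i - b ord0 i))))//.
elim: (index_enum _) => [|i s ih].
  rewrite (_ : (fun x => _) = fun=> 1); first exact: flat_alg_cst.
  by apply/funext => x; rewrite big_nil.
rewrite (_ : (fun x => _) = fun x : 'rV[R]_n =>
   (flat c 0 (1 * (x ord0 i - a ord0 i)) * flat c 0 (-1 * (x ord0 i - b ord0 i))) *
   \prod_(j <- s) (flat c 0 (1 * (x ord0 j - a ord0 j)) *
                   flat c 0 (-1 * (x ord0 j - b ord0 j)))); last first.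
  by apply/funext => x; rewrite big_cons.
by apply: flat_algM => //; apply: flat_algM; exact: flat_alg_flat.
Qed.

Lemma box_bump_out a b x : ~ obox a b x -> box_bump a b x = 0.
Proof.
move=> /existsNP[i /negP]; rewrite negb_and => H.
rewrite /box_bump (bigD1 i)//= [X in X * _](_ : _ = 0) ?mul0r//.
case/orP: H => H; rewrite {1 2}/flat.
- by rewrite mul1r subr_gt0 (negbTE H) mul0r.
- by rewrite mulN1r oppr_gt0 subr_lt0 (negbTE H) mulr0.
Qed.

Lemma box_bump_test (Omega : set 'rV[R]_n) a b : cbox a b `<=` Omega ->
  test_function Omega (box_bump a b).
Proof.
move=> abO; split; first exact: box_bump_smooth.
exists (cbox a b); split => //.
  have := @rV_compact R n (fun i => `[a ord0 i, b ord0 i]%classic)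
    (fun=> @segment_compact _ _ _).
  congr compact; apply/seteqP; split => x H i; have := H i; by rewrite /= in_itv.
by move=> x xab; apply: box_bump_out => /obox_cbox.
Qed.

Lemma box_bump_bound a b x : 0 <= box_bump a b x <= 1.
Proof.
have f01 y : 0 <= flat c 0 y <= 1.
  rewrite flat_ge0 /flat; case: ifP => y0 /=; last exact: ler01.
  by rewrite expr0 mul1r -expR0 ler_expR mulNr oppr_le0 mulr_ge0 ?invr_ge0 ?ltW.
have h i : 0 <= flat c 0 (1 * (x ord0 i - a ord0 i)) *
    flat c 0 (-1 * (x ord0 i - b ord0 i)) <= 1.
  move: (f01 (1 * (x ord0 i - a ord0 i))) (f01 (-1 * (x ord0 i - b ord0 i))).
  move=> /andP[u0 u1] /andP[v0 v1].
  by rewrite mulr_ge0// -[X in _ <= X](mulr1 1) ler_pM.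
rewrite /box_bump prodr_ile1 ?andbT//.
by apply: prodr_ge0 => i _; have /andP[] := h i.
Qed.

End fixed_parameter.

Lemma flat_cvg1 (y : R) : 0 < y ->
  (fun k : nat => flat (k.+1%:R^-1 : R) 0 y) @ \oo --> (1 : R).
Proof.
move=> y0; rewrite /flat y0; under eq_fun do rewrite expr0 mul1r.
have : (fun k : nat => expR (- k.+1%:R^-1 * y^-1)) @ \oo --> expR (0 : R).
  apply: continuous_cvg; first exact: continuous_expR.
  have : (fun k : nat => - (k.+1%:R^-1 : R) * y^-1) @ \oo --> - 0 * y^-1.
    by apply: cvgMl; apply: cvgN; exact: cvg_harmonic.
  by rewrite oppr0 mul0r.
by rewrite expR0.
Qed.

Lemma box_bump_cvg (a b x : 'rV[R]_n) :
  (fun k : nat => box_bump (k.+1%:R^-1 : R) a b x) @ \oo --> (\1_(obox a b) x : R).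
Proof.
rewrite indicE; have [xab|xab] := boolP (x \in obox a b); last first.
  under eq_fun => k.
    rewrite box_bump_out; first over.
    by move: xab; rewrite notin_setE.
  exact: cvg_cst.
move: xab; rewrite inE => xab.
rewrite (_ : (true%:R : R) = \prod_(i < n) (1 * 1)); last first.
  by rewrite big1// => i _; rewrite mulr1.
rewrite /box_bump; elim: (index_enum _) => [|i s ih].
  rewrite big_nil; apply: cvg_near_cst; apply: nearW => k.
  by rewrite big_nil.
rewrite big_cons (_ : (fun k => _) = fun k : nat =>
   (flat (k.+1%:R^-1 : R) 0 (1 * (x ord0 i - a ord0 i)) *
    flat (k.+1%:R^-1 : R) 0 (-1 * (x ord0 i - b ord0 i))) *
   \prod_(j <- s) (flat (k.+1%:R^-1 : R) 0 (1 * (x ord0 j - a ord0 j)) *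
                   flat (k.+1%:R^-1 : R) 0 (-1 * (x ord0 j - b ord0 j)))); last first.
  by apply/funext => k; rewrite big_cons.
have /andP[ax xb] := xab i.
apply: cvgM => //; apply: cvgM; apply: flat_cvg1.
- by rewrite mul1r subr_gt0.
- by rewrite mulN1r oppr_gt0 subr_lt0.
Qed.

End box_bump.

(** * The fundamental lemma of the calculus of variations *)

Section du_bois_reymond.
Context (R : realType) (n : nat).

Local Notation mu := (lebesgue_rV R n).

Definition oboxes : set (set 'rV[R]_n) := [set A | exists a b, A = obox a b].

Lemma setI_closed_oboxes : setI_closed oboxes.
Proof. by move=> _ _ [a [b ->]] [a' [b' ->]]; rewrite oboxI; eexists; eexists. Qed.

(** A slab [p < x_i < q] is the union of the boxes whose other sides are
    [(-k, k)]. *)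
Lemma measurable_oboxes : @measurable _ 'rV[R]_n `<=` <<s oboxes >>.
Proof.
apply: smallest_sub; first exact: smallest_sigma_algebra.
rewrite -bigcup_seq/= => _ [i _ [Y mY <-]]; rewrite setTI.
pose L := [set Y : set R | <<s oboxes >> ((@rV_coord R n i) @^-1` Y)].
suff : (@ocitv R).-sigma.-measurable `<=` L by apply.
rewrite RGenOpens.measurableE; apply: smallest_sub.
  split=> [|B|F] /=; rewrite /L/=.
  - by rewrite preimage_set0; exact: sigma_algebra0.
  - by move=> LB; rewrite setTD preimage_setC; exact: sigma_algebraC.
  - by move=> LF; rewrite preimage_bigcup; exact: sigma_algebra_bigcup.
move=> _ [p [q ->]]; rewrite /L /=.
have -> : @rV_coord R n i @^-1` `]p, q[%classic = \bigcup_k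
    obox (\row_j if j == i then p else - k%:R) (\row_j if j == i then q else k%:R).
  apply/seteqP; split => [x|x [k _ /(_ i)]] /=; last first.
    by rewrite !mxE eqxx /rV_coord in_itv.
  rewrite in_itv/= => xpq.
  pose N := \sum_j `|x ord0 j|.
  exists (Num.truncn N).+1 => //= j; rewrite !mxE; case: ifPn => [/eqP->//|_].
  rewrite -ltr_norml; apply: le_lt_trans (truncnS_gt N).
  by rewrite /N (bigD1 j)//= lerDl sumr_ge0.
apply: sigma_algebra_bigcup => k; apply: sub_sigma_algebra.
by eexists; eexists.
Qed.

Lemma obox_lty (a b : 'rV[R]_n) : (mu (obox a b) < +oo)%E.
Proof.
pose M := \sum_i (`|a ord0 i| + `|b ord0 i|).
apply: le_lt_trans (cube_lty n M); apply: le_measure.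
- by apply/mem_set; exact: measurable_obox.
- by apply/mem_set; exact: measurable_cube.
- move=> x xab i; have /andP[ax xb] := xab i.
  apply: (@le_trans _ _ (`|a ord0 i| + `|b ord0 i|)); last first.
    rewrite /M (bigD1 i)//= lerDl sumr_ge0// => j _; exact: addr_ge0.
  rewrite ler_norml; have := ler_norm (- a ord0 i); have := ler_norm (b ord0 i).
  rewrite normrN; have := normr_ge0 (a ord0 i); have := normr_ge0 (b ord0 i); lra.
Qed.

Section test.
Variables (Omega : set 'rV[R]_n) (g : 'rV[R]_n -> R).
Hypothesis oO : open Omega.
Hypothesis sg : sqint mu Omega g.
Hypothesis g_test : forall phi, test_function Omega phi ->
  \int[mu]_(x in Omega) (g x * phi x) = 0.

Lemma obox_integrable a b : cbox a b `<=` Omega ->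
  mu.-integrable (obox a b) (EFin \o g).
Proof.
move=> abO; have mb := measurable_obox a b.
have mO : measurable Omega by exact: measurable_open_rV.
have bO : obox a b `<=` Omega by apply: subset_trans abO; exact: obox_cbox.
have sgb : sqint mu (obox a b) g.
  have [mg ig] := sg; split; first exact: measurable_funS bO mg.
  exact: integrableS bO ig.
have s1 : sqint mu (obox a b) (cst 1).
  split; first exact: measurable_cst.
  have -> : (fun x => (cst 1 x ^+ 2)%:E) = EFin \o cst (1 : R) :> ('rV[R]_n -> \bar R).
    by apply/funext => x /=; rewrite expr1n.
  apply: (measurable_bounded_integrable mb (obox_lty a b)).
    exact: measurable_cst.
  exact: bounded_cst.
have := sqint_mul mb sgb s1.
by apply: eq_integrable => // x _ /=; rewrite mulr1.
Qed.

(** By dominated convergence, along bumps in [0, 1] that tend to the indicator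
    of the box. *)
Lemma obox_integral0 a b : cbox a b `<=` Omega ->
  (\int[mu]_(x in obox a b) (g x)%:E = 0)%E.
Proof.
move=> abO; have ig := obox_integrable abO.
have mb := measurable_obox a b.
have bO : obox a b `<=` Omega by apply: subset_trans abO; exact: obox_cbox.
pose phi k := box_bump (k.+1%:R^-1 : R) a b.
have k0 k : 0 < (k.+1%:R^-1 : R) by rewrite invr_gt0.
have mphi k : measurable_fun setT (phi k).
  by apply: measurable_continuous_rV; have [] := box_bump_smooth (k0 k) a b [::].
have mO : measurable Omega by exact: measurable_open_rV.
have mg : measurable_fun (obox a b) g.
  by have [mg _] := sg; exact: measurable_funS bO mg.
have zero k : (\int[mu]_(x in obox a b) (g x * phi k x)%:E = 0)%E.
  have := g_test (box_bump_test (k0 k) abO).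
  have -> : \int[mu]_(x in Omega) (g x * phi k x) =
      \int[mu]_(x in obox a b) (g x * phi k x).
    rewrite Rintegral_mkcond [RHS]Rintegral_mkcond; apply: eq_Rintegral => x _.
    rewrite !patchE; case: ifPn => xO; case: ifPn => xb //.
      by rewrite /phi box_bump_out ?mulr0//; move: xb; rewrite notin_setE.
    by move: xO; rewrite notin_setE => -[]; apply: bO; rewrite inE in xb.
  rewrite /Rintegral => z; rewrite -[LHS]fineK ?z//.
  apply: integrable_fin_num => //.
  apply: (@le_integrable _ _ _ _ _ mb _ (EFin \o g)) => //.
    by apply/measurable_EFinP/measurable_funM => //; exact: measurable_funTS.
  move=> x _ /=; rewrite lee_fin normrM.
  have /andP[p0 p1] := box_bump_bound (k0 k) a b x.
  by rewrite -[leRHS]mulr1 ler_wpM2l// ger0_norm.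
have : (\int[mu]_(x in obox a b) (g x * phi k x)%:E @[k --> \oo] -->
    \int[mu]_(x in obox a b) (g x)%:E)%E.
  apply: (@dominated_cvg _ _ _ mu _ mb (fun k x => (g x * phi k x)%:E)
     (EFin \o g) (abse \o (EFin \o g))).
  - by move=> k; apply/measurable_EFinP/measurable_funM => //; exact: measurable_funTS.
  - move=> x xb; apply: cvg_EFin; first exact: nearW.
    have h : (fun k => g x * phi k x) @ \oo --> g x * \1_(obox a b) x.
      by apply: cvgMr; exact: box_bump_cvg.
    by rewrite indicE mem_set// mulr1 in h.
  - by [].
  - exact: integrable_abse.
  - move=> k x _ /=; rewrite lee_fin normrM.
    have /andP[p0 p1] := box_bump_bound (k0 k) a b x.
    by rewrite -[leRHS]mulr1 ler_wpM2l// ger0_norm.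
under eq_fun do rewrite zero.
by move=> /cvg_unique; apply => //; exact: cvg_cst.
Qed.

(** The measurable sets on whose trace the integral of [g] vanishes form a
    Dynkin system; it contains the boxes, which are stable under intersection
    and generate the Borel sets. *)
Lemma obox_ae0 a b : cbox a b `<=` Omega -> ae_eq mu (obox a b) g (cst 0).
Proof.
move=> abO; have ig := obox_integrable abO; have mB := measurable_obox a b.
set B := obox a b in ig mB *.
have igS E : measurable E -> E `<=` B -> mu.-integrable E (EFin \o g).
  by move=> mE EB; exact: integrableS ig.
pose L := [set E : set 'rV[R]_n | measurable E /\
  (\int[mu]_(x in E `&` B) (g x)%:E = 0)%E].
have dL : dynkin L.
  split; rewrite /L/=.
  - by split => //; rewrite setTI; exact: obox_integral0.
  - move=> E [mE iE]; split; first exact: measurableC.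
    have := obox_integral0 abO; rewrite -/B.
    have BE : B = (E `&` B) `|` (~` E `&` B) by rewrite -setIUl setUv setTI.
    rewrite {1}BE integral_setU ?iE ?add0e//.
    + exact: measurableI.
    + by apply: measurableI => //; exact: measurableC.
    + by rewrite -BE; exact: (measurable_int mu ig).
    + by apply/disj_setPS => x [[Ex _] [nEx _]].
  - move=> F tF LF; split; first by apply: bigcupT_measurable => k; exact: (LF k).1.
    rewrite setI_bigcupl integral_bigcup.
    + by rewrite eseries0// => k _ _; exact: (LF k).2.
    + exact: trivIset_setIr.
    + by move=> k; apply: measurableI => //; exact: (LF k).1.
    + rewrite -setI_bigcupl; apply: igS; last exact: subIsetr.
      by apply: measurableI => //; apply: bigcupT_measurable => k; exact: (LF k).1.
have gL : oboxes `<=` L.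
  move=> _ [a' [b' ->]]; split; first exact: measurable_obox.
  rewrite setIC oboxI; apply: obox_integral0; apply: subset_trans abO; exact: cboxI.
have mL E : measurable E -> (\int[mu]_(x in E `&` B) (g x)%:E = 0)%E.
  move=> mE; suff [] : L E by [].
  have := measurable_oboxes mE.
  rewrite -(setI_closed_g_dynkin_g_sigma_algebra setI_closed_oboxes).
  exact: smallest_sub.
have : ae_eq mu B (EFin \o g) (cst 0%E).
  apply: integral_ae_eq => // E EB mE.
  by rewrite integral0 -(setIidl EB) mL.
by apply: filterS => x H Bx; have [] := H Bx.
Qed.

Lemma ae_zero_of_test : ae_eq mu Omega g (cst 0).
Proof.
have [a [b [P [OE PO]]]] := open_bigcup_boxes oO.
pose F k := if `[< P k >] then [set x | ~ (obox (a k) (b k) x -> g x = 0)] else set0.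
have nF k : mu.-negligible (F k).
  rewrite /F; case: asboolP => [Pk|_]; last exact: negligible_set0.
  exact: (obox_ae0 (PO k Pk)).
apply: negligibleS (negligible_bigcup nF) => x /= /not_implyP[Ox gx].
have [k Pk xk] : (\bigcup_(k in P) obox (a k) (b k)) x by rewrite -OE.
exists k => //.
by rewrite /F; case: asboolP => //= _; apply/not_implyP.
Qed.

End test.

End du_bois_reymond.

(** * Weak derivatives and Sobolev spaces on a bounded open set *)

Section sobolev.
Context (R : realType) (d : nat) (Omega : set 'rV[R]_d) (M : R).
Hypothesis oO : open Omega.
Hypothesis OM : Omega `<=` cube d M.

Local Notation mu := (lebesgue_rV R d).
Local Notation S := (sqint mu Omega).
Local Notation ipO := (ip mu Omega).
Local Notation G := (weak_pderiv Omega).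
Local Notation B := (H01_inner Omega).
Implicit Types (u v w z f g phi psi : 'rV[R]_d -> R) (i : 'I_d).

Let mO : measurable Omega.
Proof. exact: measurable_open_rV. Qed.

Lemma linB f g : lin (-1) g f = f \- g.
Proof. by apply/funext => x; rewrite /lin /=; ring. Qed.

(** ** Test functions *)

Lemma test_C1c phi : test_function Omega phi -> C1c M phi.
Proof.
move=> [sphi [K [cK KO phi0]]]; have [c0 d0] := sphi [::]; split => //.
- by move=> i; have [] := sphi [:: i].
- by move=> x xM; apply: phi0 => /KO/OM.
Qed.

Lemma test_out phi x : test_function Omega phi -> ~ Omega x ->
  phi x = 0 /\ forall i, pderiv i phi x = 0.
Proof.
move=> [sphi [K [cK KO phi0]]] Ox; have Kx : ~ K x by move=> /KO.
split; first exact: phi0.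
move=> i; rewrite /pderiv (@near_eq_derive _ _ _ phi (cst 0)).
  exact: derive_cst.
have : (\near x, (~` K) x).
  apply: open_nbhs_nbhs; split => //; apply: closed_openC.
  by apply: compact_closed => //; exact: norm_hausdorff.
by apply: filterS => y; exact: phi0.
Qed.

Lemma sqintS f : sqint mu setT f -> S f.
Proof.
move=> [mf fi]; split; first exact: measurable_funTS.
exact: integrableS fi.
Qed.

Lemma test_sqint phi : test_function Omega phi -> S phi /\ forall i, S (pderiv i phi).
Proof.
move=> /test_C1c/C1c_sqint[s1 s2]; split; first exact: sqintS.
by move=> i; exact: sqintS.
Qed.

Lemma integral_out f : (forall x, ~ Omega x -> f x = 0) ->
  \int[mu]_(x in Omega) f x = \int[mu]_x f x.
Proof.
move=> f0; rewrite Rintegral_mkcond; apply: eq_Rintegral => x _.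
by rewrite patchE; case: ifPn => //; rewrite notin_setE => /f0.
Qed.

(** Integration by parts: the derivative of [phi * psi] has integral zero. *)
Lemma test_weak_pderiv phi i : test_function Omega phi ->
  is_weak_pderiv Omega i phi (pderiv i phi).
Proof.
move=> tphi; have [sphi sdphi] := test_sqint tphi; split; first exact: sdphi.
move=> psi tpsi; have [spsi sdpsi] := test_sqint tpsi.
apply/eqP; rewrite -addr_eq0; apply/eqP.
rewrite -RintegralD//; [|exact: sqint_mul|exact: sqint_mul].
have [C E] := C1c_mul (test_C1c tphi) (test_C1c tpsi).
rewrite (@eq_Rintegral _ _ _ mu _ (pderiv i (fun x => phi x * psi x))); last first.
  by move=> x _; rewrite E.
rewrite integral_out; last first.
  move=> x Ox; rewrite E; have [-> ->] := test_out tphi Ox.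
  by rewrite !mul0r addr0.
by rewrite /Rintegral (integral_pderiv i C).
Qed.

Lemma smooth_lin a f g : smooth f -> smooth g -> smooth (lin a f g).
Proof.
move=> sf sg.
have E s : iter_pderiv s (lin a f g) = lin a (iter_pderiv s f) (iter_pderiv s g).
  elim: s => //= i s ->; apply/funext => x; rewrite /lin /pderiv.
  have df := (sf s).2 i x; have dg := (sg s).2 i x.
  have := deriveD (derivableZ (k := a) df) dg.
  by rewrite (deriveZ a df).
move=> s; rewrite E; have [cf df] := sf s; have [cg dg] := sg s; split.
  by apply: rV_continuousD => //; apply: rV_continuousM => //; exact: cst_continuous.
move=> i x; exact: (derivableD (derivableZ (k := a) (df i x)) (dg i x)).
Qed.

Lemma test_lin a phi psi : test_function Omega phi -> test_function Omega psi ->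
  test_function Omega (lin a phi psi).
Proof.
move=> [s1 [K1 [c1 K1O p1]]] [s2 [K2 [c2 K2O p2]]]; split; first exact: smooth_lin.
exists (K1 `|` K2); split; first exact: compactU.
- by move=> x [/K1O|/K2O].
- by move=> x /not_orP[/p1 h1 /p2 h2]; rewrite /lin h1 h2 mulr0 addr0.
Qed.

Lemma test_cst0 : test_function Omega (cst 0).
Proof.
split; last by exists set0; split => //; exact: compact0.
move=> s; have -> : iter_pderiv s (cst 0) = cst 0 :> ('rV[R]_d -> R).
  elim: s => //= i s ->; apply/funext => x; exact: derive_cst.
by split => [|i x]; [exact: cst_continuous|exact: derivable_cst].
Qed.

(** ** Weak derivatives *)

Lemma weak_pderiv_unique i u f g : is_weak_pderiv Omega i u f ->
  is_weak_pderiv Omega i u g -> ae_eq mu Omega f g.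
Proof.
move=> [sf Hf] [sg Hg].
have : ae_eq mu Omega (lin (-1) g f) (cst 0).
  apply: ae_zero_of_test => //; first exact: sqint_lin.
  move=> phi tphi; have [sphi _] := test_sqint tphi.
  have := ip_linl mO (-1) sg sf sphi; rewrite /ip => ->.
  by have := Hf _ tphi; rewrite (Hg _ tphi); lra.
by apply: filterS => x H Ox; have := H Ox; rewrite /lin /=; lra.
Qed.

Lemma is_weak_pderiv_lin i a u v f g : S u -> S v -> is_weak_pderiv Omega i u f ->
  is_weak_pderiv Omega i v g -> is_weak_pderiv Omega i (lin a u v) (lin a f g).
Proof.
move=> su sv [sf Hf] [sg Hg]; split; first exact: sqint_lin.
move=> phi tphi; have [sphi sdphi] := test_sqint tphi.
have := ip_linl mO a su sv (sdphi i); rewrite /ip => ->.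
have := ip_linl mO a sf sg sphi; rewrite /ip => ->.
by rewrite (Hf _ tphi) (Hg _ tphi); ring.
Qed.

Lemma weak_pderivP u i : H1 Omega u -> is_weak_pderiv Omega i u (G i u).
Proof. by move=> [_ /(_ i)[g Hg]]; apply: (xgetPex (cst 0)); exists g. Qed.

Lemma H1_sqint u : H1 Omega u -> S u. Proof. by case. Qed.

Lemma H1_sqint_weak u i : H1 Omega u -> S (G i u).
Proof. by move=> /(weak_pderivP i)[]. Qed.

Lemma weak_pderiv_ae u i g : is_weak_pderiv Omega i u g -> ae_eq mu Omega (G i u) g.
Proof.
by move=> Hg; apply: (weak_pderiv_unique _ Hg); apply: (xgetPex (cst 0)); exists g.
Qed.

Lemma H1_lin a u v : H1 Omega u -> H1 Omega v -> H1 Omega (lin a u v).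
Proof.
move=> Hu Hv; split; first exact: (sqint_lin mO a (H1_sqint Hu) (H1_sqint Hv)).
move=> i; exists (lin a (G i u) (G i v)).
exact: (is_weak_pderiv_lin a (H1_sqint Hu) (H1_sqint Hv)
  (weak_pderivP i Hu) (weak_pderivP i Hv)).
Qed.

Lemma weak_pderiv_lin a u v i : H1 Omega u -> H1 Omega v ->
  ae_eq mu Omega (G i (lin a u v)) (lin a (G i u) (G i v)).
Proof.
move=> Hu Hv; apply: weak_pderiv_ae.
exact: (is_weak_pderiv_lin a (H1_sqint Hu) (H1_sqint Hv)
  (weak_pderivP i Hu) (weak_pderivP i Hv)).
Qed.

Lemma test_H1 phi : test_function Omega phi -> H1 Omega phi.
Proof.
move=> tphi; have [s1 s2] := test_sqint tphi; split => // i.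
by exists (pderiv i phi); exact: test_weak_pderiv.
Qed.

(** ** The Dirichlet form *)

Lemma H01_innerC u v : B u v = B v u.
Proof. by apply: eq_bigr => i _; exact: ipC. Qed.

Lemma H01_inner_ge0 u : 0 <= B u u.
Proof. by apply: sumr_ge0 => i _; exact: ip_ge0. Qed.

Lemma H01_inner_lin a u v w : H1 Omega u -> H1 Omega v -> H1 Omega w ->
  B (lin a u v) w = a * B u w + B v w.
Proof.
move=> Hu Hv Hw; rewrite /H01_inner mulr_sumr -big_split/=; apply: eq_bigr => i _.
rewrite -[LHS]/(ipO _ _) -[X in _ = a * X + _]/(ipO _ _) -[X in _ = _ + X]/(ipO _ _).
have [su sv sw] := And3 (H1_sqint_weak i Hu) (H1_sqint_weak i Hv) (H1_sqint_weak i Hw).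
rewrite -ip_linl//; apply: ip_ae => //.
- exact/H1_sqint_weak/H1_lin.
- exact: sqint_lin.
- exact: weak_pderiv_lin.
- exact: ae_eq_refl.
Qed.

Definition H1_sqnorm u : R := (ipO u u) + B u u.

Lemma H1_sqnorm_ge0 u : 0 <= H1_sqnorm u.
Proof. by rewrite addr_ge0 ?ip_ge0 ?H01_inner_ge0. Qed.

Lemma H1_normE u : H1_norm Omega u = Num.sqrt (H1_sqnorm u).
Proof.
rewrite /H1_norm /H1_sqnorm /L2_norm sqr_sqrtr ?ip_ge0//; congr (Num.sqrt (_ + _)).
by apply: eq_bigr => i _; rewrite sqr_sqrtr// ip_ge0.
Qed.

Lemma ip_lin_le a u v : S u -> S v ->
  ipO (lin a u v) (lin a u v) <= 2 * a ^+ 2 * (ipO u u) + 2 * (ipO v v).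
Proof.
move=> su sv; have := ip_ge0 mu Omega (lin (- a) u v).
have [sl sl'] := (sqint_lin mO a su sv, sqint_lin mO (- a) su sv).
rewrite !ip_linl// !(ipC mu Omega _ (lin _ _ _)) !ip_linl// !(ipC mu Omega v u).
move: (ipO u u) (ipO u v) (ipO v v) => x y t; lra.
Qed.

Lemma H01_inner_lin_le a u v : H1 Omega u -> H1 Omega v ->
  B (lin a u v) (lin a u v) <= 2 * a ^+ 2 * B u u + 2 * B v v.
Proof.
move=> su sv; have := H01_inner_ge0 (lin (- a) u v).
have [sl sl'] := (H1_lin a su sv, H1_lin (- a) su sv).
rewrite !H01_inner_lin// !(H01_innerC _ (lin _ _ _)) !H01_inner_lin// !(H01_innerC v u).
move: (B u u) (B u v) (B v v) => x y t; lra.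
Qed.

Lemma H1_sqnorm_lin_le a u v : H1 Omega u -> H1 Omega v ->
  H1_sqnorm (lin a u v) <= 2 * a ^+ 2 * H1_sqnorm u + 2 * H1_sqnorm v.
Proof.
move=> Hu Hv; have h := ip_lin_le a (H1_sqint Hu) (H1_sqint Hv).
have h' := H01_inner_lin_le a Hu Hv.
by rewrite /H1_sqnorm !mulrDr addrACA lerD.
Qed.

Lemma H01P u : H01 Omega u <-> H1 Omega u /\ forall e : R, 0 < e ->
  exists2 phi, test_function Omega phi & H1_sqnorm (lin (-1) phi u) < e.
Proof.
split=> -[Hu H]; split => // e e0.
  have [|phi tphi] := H (Num.sqrt e); first by rewrite sqrtr_gt0.
  by exists phi => //; rewrite linB; move: q; rewrite H1_normE ltr_sqrt.
have [|phi tphi] := H (e ^+ 2); first by rewrite exprn_gt0.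
rewrite linB => q; exists phi; first exact: tphi.
rewrite H1_normE -(gtr0_norm e0) -sqrtr_sqr ltr_sqrt; first exact: q.
by rewrite exprn_gt0.
Qed.

Lemma H01_H1 u : H01 Omega u -> H1 Omega u. Proof. by case. Qed.

Lemma test_H01 phi : test_function Omega phi -> H01 Omega phi.
Proof.
move=> tphi; apply/H01P; split; first exact: test_H1.
move=> e e0; exists phi => //; have Hp := test_H1 tphi.
have Hd := H1_lin (-1) Hp Hp; have [sp sd] := (H1_sqint Hp, H1_sqint Hd).
by rewrite /H1_sqnorm ip_linl// H01_inner_lin// !mulN1r !addNr addr0.
Qed.

Lemma H01_lin a u v : H01 Omega u -> H01 Omega v -> H01 Omega (lin a u v).
Proof.
move=> /H01P[Hu au] /H01P[Hv av]; apply/H01P; split; first exact: H1_lin.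
move=> e e0.
have ea : 0 < e / (4 * (a ^+ 2 + 1)).
  by rewrite divr_gt0// mulr_gt0// ltr_wpDl// sqr_ge0.
have [phi tphi hphi] := au _ ea.
have [|psi tpsi hpsi] := av (e / 4); first by rewrite divr_gt0.
exists (lin a phi psi); first exact: test_lin.
have -> : lin (-1) (lin a phi psi) (lin a u v) = lin a (lin (-1) phi u) (lin (-1) psi v).
  by apply/funext => x; rewrite /lin; ring.
have H1u := H1_lin (-1) (test_H1 tphi) Hu.
have H1v := H1_lin (-1) (test_H1 tpsi) Hv.
apply: le_lt_trans (H1_sqnorm_lin_le a H1u H1v) _.
move: (H1_sqnorm_ge0 (lin (-1) phi u)) hphi hpsi.
move: (H1_sqnorm (lin (-1) phi u)) (H1_sqnorm (lin (-1) psi v)) => x y x0 hx hy.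
have : a ^+ 2 * x <= e / 4.
  apply: (@le_trans _ _ ((a ^+ 2 + 1) * x)); first by rewrite mulrDl mul1r lerDl.
  have a1 : 0 < a ^+ 2 + 1 by rewrite ltr_wpDl// sqr_ge0.
  have -> : e / 4 = (a ^+ 2 + 1) * (e / (4 * (a ^+ 2 + 1))) by field; rewrite gt_eqF.
  by rewrite ler_wpM2l// ltW.
lra.
Qed.

Lemma H01_cst0 : H01 Omega (cst 0).
Proof. exact/test_H01/test_cst0. Qed.

Lemma H01_scale a u : H01 Omega u -> H01 Omega (fun x => a * u x).
Proof.
move=> Hu; have := H01_lin a Hu H01_cst0.
by congr H01; apply/funext => x; rewrite /lin addr0.
Qed.

(** The factors [2] stand for the triangle inequality on squared norms. *)
Lemma H01_approx u (e : R) : H01 Omega u -> 0 < e ->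
  exists2 phi, test_function Omega phi &
    ipO (lin (-1) phi u) (lin (-1) phi u) <= e /\
    B phi phi <= 2 * B u u + 2 * e.
Proof.
move=> /H01P[Hu au] e0; have [phi tphi hphi] := au _ e0; exists phi => //.
have Hp := test_H1 tphi; have Hd := H1_lin (-1) Hp Hu.
have b1 := ip_ge0 mu Omega (lin (-1) phi u).
have b2 := H01_inner_ge0 (lin (-1) phi u).
have h := H01_inner_lin_le (-1) Hd Hu.
have E : lin (-1) (lin (-1) phi u) u = phi.
  by apply/funext => x; rewrite /lin; ring.
rewrite E in h; move: h hphi b1 b2; rewrite /H1_sqnorm.
move: (ipO (lin (-1) phi u) (lin (-1) phi u)) (B (lin (-1) phi u) (lin (-1) phi u)).
move: (B phi phi) (B u u) => x y z t h h' b1 b2; split; lra.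
Qed.

Section inequalities.
Hypothesis d13 : (1 <= d <= 3)%N.
Hypothesis M0 : 0 <= M.

Lemma test_inner_ipT phi : test_function Omega phi ->
  B phi phi = \sum_i ipT (pderiv i phi) (pderiv i phi).
Proof.
move=> tphi; have [sp sdp] := test_sqint tphi; apply: eq_bigr => i _.
rewrite -[LHS]/(ipO _ _).
have ae := weak_pderiv_ae (test_weak_pderiv i tphi).
have sG := H1_sqint_weak i (test_H1 tphi).
rewrite (ip_ae mO sG (sdp i) sG (sdp i) ae ae) /ip integral_out//.
by move=> x Ox; have [_ ->] := test_out tphi Ox; rewrite mul0r.
Qed.

Definition poincare_const := 64 * M ^+ 2.

(** Passing to the limit in [C1c_poincare] costs a factor [4], whence [64]. *)
Lemma H01_poincare u : H01 Omega u -> ipO u u <= poincare_const * B u u.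
Proof.
move=> Hu; have Bu0 := H01_inner_ge0 u; have su := H1_sqint (H01_H1 Hu).
have M2 := sqr_ge0 M.
apply/ler_addgt0Pr => e e0.
have c0 : 0 < 64 * M ^+ 2 + 2 by rewrite ltr_wpDl// mulr_ge0.
have e' : 0 < e / (64 * M ^+ 2 + 2) by rewrite divr_gt0.
have E : e = (64 * M ^+ 2 + 2) * (e / (64 * M ^+ 2 + 2)).
  by rewrite mulrCA divff ?mulr1// gt_eqF.
have [phi tphi [p1 p2]] := H01_approx Hu e'.
have [sp _] := test_sqint tphi.
have P : ipO phi phi <= 16 * M ^+ 2 * B phi phi.
  have d1 : (1 <= d)%N by case/andP: d13.
  rewrite (test_inner_ipT tphi); apply: le_trans (C1c_poincare d1 M0 (test_C1c tphi)).
  rewrite /ip integral_out// => x Ox; have [-> _] := test_out tphi Ox.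
  by rewrite mul0r.
have := ip_lin_le 1 (sqint_lin mO (-1) sp su) sp.
have -> : lin 1 (lin (-1) phi u) phi = u by apply/funext => x; rewrite /lin; ring.
have h2 : M ^+ 2 * B phi phi <= M ^+ 2 * (2 * B u u + 2 * (e / (64 * M ^+ 2 + 2))).
  by rewrite ler_wpM2l.
rewrite /poincare_const [X in _ -> _ <= _ + X]E; move: (e / _) Bu0 e' p1 p2 P h2 => e1.
move: (ipO (lin (-1) phi u) (lin (-1) phi u)) (ipO phi phi) (ipO u u).
move: (B phi phi) (B u u) {E Hu su c0} => y1 y2 x1 x2 x3; lra.
Qed.

Lemma H01_inner_eq0 u : H01 Omega u -> B u u = 0 -> ae_eq mu Omega u (cst 0).
Proof.
move=> Hu B0; apply: ip_eq0; [exact: mO|exact: H1_sqint (H01_H1 Hu)|].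
by apply/le_anti; rewrite ip_ge0 andbT; have := H01_poincare Hu; rewrite B0 mulr0.
Qed.

Definition quartic_const := 16 * ladyzhenskaya_const M.

Lemma ladyzhenskaya_const_ge0 : 0 <= ladyzhenskaya_const M.
Proof. by rewrite /ladyzhenskaya_const mulr_ge0// sqr_ge0. Qed.

Let sqr_le16 (L x y : R) : 0 <= L -> 0 <= x -> x <= 4 * y ->
  L * x ^+ 2 <= 16 * L * y ^+ 2.
Proof.
move=> L0 x0 xy; rewrite (_ : 16 * L * y ^+ 2 = L * (4 * y) ^+ 2); last by ring.
by rewrite ler_wpM2l// ler_pXn2r// nnegrE (le_trans x0).
Qed.

Lemma test_quartic phi : test_function Omega phi ->
  (\int[mu]_(x in Omega) (phi x ^+ 4)%:E <= (ladyzhenskaya_const M * B phi phi ^+ 2)%:E)%E.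
Proof.
move=> tphi; have := C1c_ladyzhenskaya d13 M0 (test_C1c tphi).
rewrite (test_inner_ipT tphi); apply: le_trans.
rewrite /intT integral_mkcond le_eqVlt; apply/orP; left; apply/eqP.
apply: eq_integral => x _; rewrite patchE; case: ifPn => //.
rewrite notin_setE => Ox; have [-> _] := test_out tphi Ox.
by rewrite expr0n.
Qed.

(** The square of an element of [H01] is square integrable: approximate by test
    functions, fast enough for almost everywhere convergence, and use Fatou. *)
Lemma H01_quartic u : H01 Omega u -> S (fun x => u x ^+ 2) /\
  ipO (fun x => u x ^+ 2) (fun x => u x ^+ 2) <= quartic_const * B u u ^+ 2.
Proof.
move=> Hu; have [mu_ _] := H1_sqint (H01_H1 Hu).
have mu2 : measurable_fun Omega (fun x => u x ^+ 2) by exact: measurable_funX.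
apply: sqint_le => //.
have [B0|B0] := eqVneq (B u u) 0.
  rewrite (@ae_eq_integral _ _ _ mu _ (cst 0%E)) ?integral0 ?lee_fin//.
  - by rewrite B0 expr0n mulr0.
  - by apply/measurable_EFinP; exact: measurable_funX.
  - move: (H01_inner_eq0 Hu B0); apply: filterS => x H Ox.
    by rewrite (H Ox) /cst !expr0n.
have Bp : 0 < B u u by rewrite lt0r B0 H01_inner_ge0.
(* the rate gives almost everywhere convergence, and the second bound keeps
   [B phi phi] below [4 * B u u] *)
pose eps k : R := Num.min (fast_rate R k) (B u u).
have eps0 k : 0 < eps k by rewrite lt_min fast_rate_gt0 Bp.
have /choice[p pP] : forall k, exists phi, test_function Omega phi /\
    (ipO (lin (-1) phi u) (lin (-1) phi u) <= eps k /\
     B phi phi <= 2 * B u u + 2 * eps k).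
  by move=> k; have [phi t [h h']] := H01_approx Hu (eps0 k); exists phi.
have sp k := (test_sqint (pP k).1).1.
have su := H1_sqint (H01_H1 Hu).
have cv : {ae mu, forall x, Omega x -> lin (-1) (p k) u x @[k --> \oo] --> (0 : R)}.
  apply: (@fast_ae_cvg0 _ _ _ mu _ mO (fun k => lin (-1) (p k) u)) => k.
    exact: sqint_lin.
  by apply: le_trans (pP k).2.1 _; rewrite /eps ge_min lexx.
apply: (@integral_fatou _ _ _ mu Omega mO (fun k x => p k x ^+ 4)).
- by move=> k; apply: measurable_funX; have [] := sp k.
- by apply: measurable_funX.
- by move=> k x; rewrite -[4%N]/(2 * 2)%N exprM sqr_ge0.
- by move=> x; exact: sqr_ge0.
- move: cv; apply: filterS => x H Ox; have {}H := H Ox.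
  have pu : p k x @[k --> \oo] --> u x.
    have : (u x - lin (-1) (p k) u x) @[k --> \oo] --> u x - 0.
      by apply: cvgB => //; exact: cvg_cst.
    rewrite subr0; apply: cvg_trans; apply: near_eq_cvg; apply: nearW => k.
    by rewrite /lin; ring.
  have h : (fun k => p k x ^+ 4) @ \oo --> u x ^+ 4.
    apply: (@continuous_cvg _ _ _ _ _ (fun k => p k x) (fun t : R => t ^+ 4) (u x)) pu.
    exact: exprn_continuous.
  by rewrite -exprM.
- apply: nearW => k; apply: le_trans (test_quartic (pP k).1) _.
  rewrite lee_fin; apply: sqr_le16; [exact: ladyzhenskaya_const_ge0|exact: H01_inner_ge0|].
  apply: le_trans (pP k).2.2 _.
  have : eps k <= B u u by rewrite /eps ge_min lexx orbT.
  by move: (eps k); move: (B u u) => x y; lra.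
Qed.

End inequalities.
End sobolev.

(** * Completeness of the Dirichlet form and Green's operator *)

Section green.
Context (R : realType) (d : nat) (Omega : set 'rV[R]_d) (M : R).
Hypothesis oO : open Omega.
Hypothesis OM : Omega `<=` cube d M.
Hypothesis d13 : (1 <= d <= 3)%N.
Hypothesis M0 : 0 <= M.

Local Notation mu := (lebesgue_rV R d).
Local Notation S := (sqint mu Omega).
Local Notation ipO := (ip mu Omega).
Local Notation G := (weak_pderiv Omega).
Local Notation B := (H01_inner Omega).
Implicit Types (u v w z f g phi psi : 'rV[R]_d -> R) (i : 'I_d).

Let mO : measurable Omega.
Proof. exact: measurable_open_rV. Qed.

(** A Cauchy sequence for the Dirichlet form has Cauchy weak derivatives. *)
Lemma weak_pderiv_dist u v i : H1 Omega u -> H1 Omega v ->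
  ipO (lin (-1) (G i u) (G i v)) (lin (-1) (G i u) (G i v)) <=
  B (lin (-1) u v) (lin (-1) u v).
Proof.
move=> Hu Hv; have Huv := H1_lin oO OM (-1) Hu Hv.
have ae := weak_pderiv_lin oO OM (-1) i Hu Hv.
have s1 := H1_sqint_weak i Huv.
have s2 := sqint_lin mO (-1) (H1_sqint_weak i Hu) (H1_sqint_weak i Hv).
rewrite -(ip_ae mO s1 s2 s1 s2 ae ae) /H01_inner (bigD1 i)//= lerDl.
by apply: sumr_ge0 => j _; exact: ip_ge0.
Qed.

Let sqr_small (a b c : R) : 0 <= c -> a ^+ 2 <= b * c -> forall e, 0 < e ->
  b <= e / (c + 1) -> a ^+ 2 <= e.
Proof.
move=> c0 abc e e0 be; apply: le_trans abc _.
apply: (@le_trans _ _ (e / (c + 1) * (c + 1))).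
  have [b0|b0] := leP 0 b; first by rewrite ler_pM// lerDl.
  apply: (@le_trans _ _ 0); first by rewrite mulr_le0_ge0// ltW.
  by rewrite mulr_ge0 ?divr_ge0 ?addr_ge0// ltW.
by rewrite divfK// gt_eqF// ltr_wpDl.
Qed.

(** For a fixed test function both sides of the defining identity are continuous
    in mean square, by Cauchy-Schwarz. *)
Lemma weak_pderiv_closed i (u_ g_ : nat -> 'rV[R]_d -> R) u g :
  (forall n, S (u_ n)) -> S u -> S g ->
  (forall n, is_weak_pderiv Omega i (u_ n) (g_ n)) ->
  (forall e : R, 0 < e -> exists n,
     ipO (lin (-1) (u_ n) u) (lin (-1) (u_ n) u) <= e /\
     ipO (lin (-1) (g_ n) g) (lin (-1) (g_ n) g) <= e) ->
  is_weak_pderiv Omega i u g.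
Proof.
move=> su_ su sg Hw cv; split => // phi tphi.
have [sphi sdphi] := test_sqint oO OM tphi.
rewrite -[LHS]/(ipO u (pderiv i phi)) -[X in _ = - X]/(ipO g phi).
apply/eqP; rewrite -addr_eq0 -sqrf_eq0; apply/eqP/le_anti; rewrite sqr_ge0 andbT.
apply/ler_addgt0Pr => e e0; rewrite add0r.
set a := ipO (pderiv i phi) (pderiv i phi); set b := ipO phi phi.
have a0 : 0 <= a := ip_ge0 _ _ _.
have b0 : 0 <= b := ip_ge0 _ _ _.
have e4 : 0 < e / 4 by rewrite divr_gt0.
pose r := Num.min (e / 4 / (a + 1)) (e / 4 / (b + 1)).
have r0 : 0 < r by rewrite lt_min !divr_gt0// ltr_wpDl.
have [n [h1 h2]] := cv r r0.
have sg_ : S (g_ n) by have [] := Hw n.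
have c1 := ip_CS mO (sqint_lin mO (-1) (su_ n) su) (sdphi i).
have c2 := ip_CS mO (sqint_lin mO (-1) sg_ sg) sphi.
have {}c1 := sqr_small a0 c1 e4 (le_trans h1 (_ : r <= _)).
have {}c2 := sqr_small b0 c2 e4 (le_trans h2 (_ : r <= _)).
have r1 : r <= e / 4 / (a + 1) by rewrite /r ge_min lexx.
have r2 : r <= e / 4 / (b + 1) by rewrite /r ge_min lexx orbT.
move: (c1 r1) (c2 r2); rewrite !ip_linl//.
have := (Hw n).2 _ tphi.
rewrite -[X in X = _ -> _]/(ipO (u_ n) (pderiv i phi)).
rewrite -[X in _ = - X -> _]/(ipO (g_ n) phi) => ->.
move: (ipO u _) (ipO g _) (ipO (g_ n) _) => x y z.
move=> {cv c1 c2 h1 h2 r1 r2 r0 r e4 a0 b0 a b} h1 h2.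
have := sqr_ge0 ((-1 * - z + x) - (-1 * z + y)); lra.
Qed.

(** The Poincare inequality makes [u_] Cauchy in mean square, so that the
    functions and their weak derivatives converge; [weak_pderiv_closed]
    identifies the limits. A test function close to a late [u_ n] is close to
    the limit, which is therefore in [H01]. *)
Lemma H01_complete (u_ : nat -> 'rV[R]_d -> R) : (forall n, H01 Omega (u_ n)) ->
  (forall e : R, 0 < e -> exists N, forall m n, (N <= m)%N -> (N <= n)%N ->
    B (lin (-1) (u_ m) (u_ n)) (lin (-1) (u_ m) (u_ n)) <= e) ->
  exists2 v, H01 Omega v & forall e : R, 0 < e -> exists N, forall n, (N <= n)%N ->
    B (lin (-1) (u_ n) v) (lin (-1) (u_ n) v) <= e.
Proof.
move=> Hu cu; have H1u n := H01_H1 (Hu n); have su n := H1_sqint (H1u n).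
pose P := poincare_const M + 1.
have P0 : 0 < P by rewrite ltr_wpDl// mulr_ge0// sqr_ge0.
have [|v sv cv] := sqint_complete mO su.
  move=> e e0; have [|N HN] := cu (e / P); first by rewrite divr_gt0.
  exists N => m n Nm Nn.
  have Huv := H01_lin oO OM (-1) (Hu m) (Hu n).
  apply: le_trans (H01_poincare oO OM d13 M0 Huv) _.
  apply: (@le_trans _ _ (P * (e / P))); last by rewrite mulrC divfK// gt_eqF.
  apply: ler_pM; [|exact: H01_inner_ge0| |exact: HN].
    by rewrite /poincare_const mulr_ge0// sqr_ge0.
  by rewrite /P lerDl.
have /choice[g gP] : forall i, exists g, S g /\ forall e : R, 0 < e ->
    exists N, forall n, (N <= n)%N ->
    ipO (lin (-1) (G i (u_ n)) g) (lin (-1) (G i (u_ n)) g) <= e.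
  move=> i; have [|g sg cg] := sqint_complete mO (fun n => H1_sqint_weak i (H1u n)).
    move=> e /cu[N HN]; exists N => m n Nm Nn.
    exact: le_trans (weak_pderiv_dist i (H1u m) (H1u n)) (HN m n Nm Nn).
  by exists g.
have wv i : is_weak_pderiv Omega i v (g i).
  apply: (weak_pderiv_closed su sv (gP i).1 (fun n => weak_pderivP i (H1u n))).
  move=> e e0; have [N1 h1] := cv e e0; have [N2 h2] := (gP i).2 e e0.
  by exists (maxn N1 N2); split; [apply: h1; exact: leq_maxl|apply: h2; exact: leq_maxr].
have H1v : H1 Omega v by split => // i; exists (g i).
have Bcv (e : R) : 0 < e -> exists N, forall n, (N <= n)%N ->
    B (lin (-1) (u_ n) v) (lin (-1) (u_ n) v) <= e.
  move=> e0; have ed : 0 < e / d%:R.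
    by rewrite divr_gt0// ltr0n; case/andP: d13.
  have /choice[N HN] : forall i, exists N, forall n, (N <= n)%N ->
      ipO (lin (-1) (G i (u_ n)) (g i)) (lin (-1) (G i (u_ n)) (g i)) <= e / d%:R.
    by move=> i; exact: (gP i).2.
  exists (\max_i N i)%N => n Nn.
  apply: (@le_trans _ _ (\sum_(i < d) (e / d%:R))); last first.
    rewrite sumr_const card_ord -[leLHS]mulr_natr divfK// pnatr_eq0 -lt0n.
    by case/andP: d13.
  apply: ler_sum => i _.
  have Hd := H1_lin oO OM (-1) (H1u n) H1v.
  have s1 := H1_sqint_weak i Hd.
  have s2 := sqint_lin mO (-1) (H1_sqint_weak i (H1u n)) (gP i).1.
  have ae := weak_pderiv_ae oO OM (is_weak_pderiv_lin oO OM (-1) (su n) sv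
    (weak_pderivP i (H1u n)) (wv i)).
  rewrite -[leLHS]/(ipO _ _) (ip_ae mO s1 s2 s1 s2 ae ae).
  by apply: HN; apply: leq_trans Nn; exact: leq_bigmax.
exists v => //; apply/H01P; split => // e e0.
have e8 : 0 < e / 8 by rewrite divr_gt0.
have [N1 h1'] := cv _ e8; have [N2 h2'] := Bcv _ e8.
pose n := maxn N1 N2.
have {}h1' := h1' n (leq_maxl _ _); have {}h2' := h2' n (leq_maxr _ _).
have /H01P[_ /(_ _ e8)[phi tphi hphi]] := Hu n.
exists phi => //.
have Hp := H1_lin oO OM (-1) (test_H1 oO OM tphi) (H1u n).
have Hn := H1_lin oO OM (-1) (H1u n) H1v.
have := H1_sqnorm_lin_le oO OM 1 Hp Hn.
have -> : lin 1 (lin (-1) phi (u_ n)) (lin (-1) (u_ n) v) = lin (-1) phi v.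
  by apply/funext => x; rewrite /lin; ring.
have hn : H1_sqnorm Omega (lin (-1) (u_ n) v) <= e / 8 + e / 8 by rewrite /H1_sqnorm lerD.
move: hphi hn; move: (H1_sqnorm _ (lin (-1) phi (u_ n))) (H1_sqnorm _ (lin (-1) (u_ n) v)) => x y.
move: (H1_sqnorm _ _) => z {cv Bcv gP wv cu h1' h2'} hx hy hz; lra.
Qed.

(** [green w] is defined by choice among the solutions of the weak equation; the
    Riesz representation theorem on [H01] provides one. *)
Lemma green_spec w (C : R) : 0 <= C ->
  (forall a f g, H01 Omega f -> H01 Omega g ->
     L2_inner Omega (lin a f g) w = a * L2_inner Omega f w + L2_inner Omega g w) ->
  (forall z, H01 Omega z -> L2_inner Omega z w ^+ 2 <= C * B z z) ->
  is_green Omega w (green Omega w).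
Proof.
move=> C0 wl wC.
have [|v Hv vw] := @riesz_representation _ R (H01 Omega) B (fun z => L2_inner Omega z w)
  (H01_cst0 oO OM) (H01_lin oO OM) _ (H01_innerC Omega) (H01_inner_ge0 Omega)
  H01_complete wl C C0 wC.
  by move=> a f g h Hf Hg Hh; apply: (H01_inner_lin oO OM); exact: H01_H1.
by apply: (xgetPex (cst 0)); exists v; split.
Qed.

End green.

(** * The Gross-Pitaevskii energy *)

Section energy.
Context (R : realType) (d : nat) (Omega : set 'rV[R]_d) (M : R).
Hypothesis oO : open Omega.
Hypothesis OM : Omega `<=` cube d M.
Hypothesis d13 : (1 <= d <= 3)%N.
Hypothesis M0 : 0 <= M.
Variables (V : 'rV[R]_d -> R) (W beta : R).
Hypothesis W0 : 0 <= W.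
Hypothesis mV : measurable_fun Omega V.
Hypothesis VW : {ae lebesgue_rV R d, forall x, Omega x -> 0 <= V x <= W}.

Local Notation mu := (lebesgue_rV R d).
Local Notation S := (sqint mu Omega).
Local Notation ipO := (ip mu Omega).
Local Notation G := (weak_pderiv Omega).
Local Notation B := (H01_inner Omega).
Local Notation E := (energy Omega V beta).
Local Notation P := (poincare_const M).
Local Notation C := (quartic_const M).
Implicit Types (u v w z f g : 'rV[R]_d -> R) (i : 'I_d).

Let mO : measurable Omega.
Proof. exact: measurable_open_rV. Qed.

Lemma H01_sqint u : H01 Omega u -> S u.
Proof. by move=> /H01_H1/H1_sqint. Qed.

Lemma poincare_const_ge0 : 0 <= P.
Proof. by rewrite /poincare_const mulr_ge0// sqr_ge0. Qed.

Lemma quartic_const_ge0 : 0 <= C.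
Proof. by rewrite /quartic_const mulr_ge0// ladyzhenskaya_const_ge0. Qed.

(** ** Quartic terms *)

Definition sq u : 'rV[R]_d -> R := fun x => u x ^+ 2.
Definition mulf u v : 'rV[R]_d -> R := fun x => u x * v x.

Lemma sqint_sq u : H01 Omega u -> S (sq u).
Proof. by move=> Hu; have [] := H01_quartic oO OM d13 M0 Hu. Qed.

Lemma sqint_mulf u v : H01 Omega u -> H01 Omega v -> S (mulf u v).
Proof.
move=> Hu Hv; split.
  by apply: measurable_funM; [have [] := H01_sqint Hu|have [] := H01_sqint Hv].
have := sqint_mul mO (sqint_sq Hu) (sqint_sq Hv).
by apply: eq_integrable => // x _ /=; rewrite /mulf /sq exprMn.
Qed.

Lemma ip_mulf u v : ipO (mulf u v) (mulf u v) = ipO (sq u) (sq v).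
Proof. by apply: eq_Rintegral => x _; rewrite /mulf /sq; ring. Qed.

Lemma ip_sq_le u v : H01 Omega u -> H01 Omega v ->
  ipO (sq u) (sq v) <= C * (B u u * B v v).
Proof.
move=> Hu Hv; have [su qu] := H01_quartic oO OM d13 M0 Hu.
have [sv qv] := H01_quartic oO OM d13 M0 Hv.
have h := ip_CS mO su sv.
have h0 : 0 <= ipO (sq u) (sq v).
  by rewrite -ip_mulf; exact: ip_ge0.
have r0 : 0 <= C * (B u u * B v v).
  by apply: mulr_ge0; [exact: quartic_const_ge0|apply: mulr_ge0; exact: H01_inner_ge0].
rewrite -(@ler_pXn2r _ 2)// ?nnegrE//; apply: le_trans h _.
apply: (le_trans (ler_pM (ip_ge0 _ _ _) (ip_ge0 _ _ _) qu qv)).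
by rewrite le_eqVlt; apply/orP; left; apply/eqP; move: (B u u) (B v v) => x y; ring.
Qed.

(** ** The potential *)

(** The bounds on [V] hold almost everywhere only. Truncating [V] to [[0, W]]
    changes it on a null set and makes them hold everywhere. *)
Lemma sqint_V u : S u -> S (mulf V u) /\
  (forall v, S v -> ipO (mulf V u) v ^+ 2 <= W ^+ 2 * ipO u u * ipO v v) /\
  0 <= ipO (mulf V u) u <= W * ipO u u.
Proof.
move=> su; have [mu_ iu] := su.
pose Vc x := Num.max 0 (Num.min (V x) W).
have Vc01 x : 0 <= Vc x <= W.
  by rewrite /Vc le_max lexx /= ge_max W0 ge_min lexx orbT.
have mVc : measurable_fun Omega Vc.
  apply: measurable_maxr; first exact: measurable_cst.
  by apply: measurable_minr => //; exact: measurable_cst.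
have VVc : ae_eq mu Omega V Vc.
  move: VW; apply: filterS => x H Ox; have /andP[V0 V1] := H Ox.
  by rewrite /Vc (min_idPl V1) (max_idPr V0).
have aeu : ae_eq mu Omega (mulf Vc u) (mulf V u).
  by move: VVc; apply: filterS => x H Ox; rewrite /mulf (H Ox).
have sWu : S (lin W u (cst 0)).
  by apply: sqint_lin => //; split; [exact: measurable_cst|
    apply: (eq_integrable mO (cst 0%E)) (integrable0 _ _) => x _; rewrite /= expr0n].
have sc : S (mulf Vc u).
  split; first exact: measurable_funM.
  apply: (@integrable_le _ _ _ _ _ mO _ (fun x => lin W u (cst 0) x ^+ 2)).
  - exact/measurable_funX/measurable_funM.
  - by have [] := sWu.
  - move=> x _; rewrite ger0_norm ?sqr_ge0// /mulf /lin /cst addr0 !exprMn.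
    have /andP[V0 V1] := Vc01 x.
    by rewrite ler_wpM2r ?sqr_ge0// ler_pXn2r// nnegrE.
have sV : S (mulf V u).
  by apply: (ae_sqint mO sc _ aeu); exact: measurable_funM.
have eqV z : S z -> ipO (mulf V u) z = ipO (mulf Vc u) z.
  by move=> sz; apply: ip_ae => //; [exact: ae_eq_sym|exact: ae_eq_refl].
split => //; split.
  move=> v sv; rewrite eqV//; apply: le_trans (ip_CS mO sc sv) _.
  rewrite ler_wpM2r ?ip_ge0//.
  rewrite /ip -RintegralZl//.
  apply: le_Rintegral => //.
  - exact: (sqint_mul mO sc sc).
  - by apply: integrableRZ => //; exact: (sqint_mul mO su su).
  - move=> x _; have /andP[V0 V1] := Vc01 x; rewrite /mulf.
    rewrite (_ : Vc x * u x * (Vc x * u x) = Vc x ^+ 2 * (u x * u x)); last by ring.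
    by rewrite ler_wpM2r -?expr2 ?sqr_ge0// ler_pXn2r// nnegrE.
rewrite eqV//; apply/andP; split.
  apply: Rintegral_ge0 => x _; have /andP[V0 _] := Vc01 x.
  by rewrite /mulf -mulrA mulr_ge0// -expr2 sqr_ge0.
rewrite /ip -RintegralZl//.
apply: le_Rintegral => //.
- exact: (sqint_mul mO sc su).
- by apply: integrableRZ => //; exact: (sqint_mul mO su su).
- move=> x _; have /andP[V0 V1] := Vc01 x; rewrite /mulf -mulrA.
  by rewrite ler_wpM2r// -expr2 sqr_ge0.
Qed.

(** ** The derivative of the lower order terms *)

(** The derivative at [u] in the direction [z] of the energy minus its
    Dirichlet part. *)
Definition lower_form u z := ipO (mulf V u) z + beta * ipO (sq u) (mulf u z).

(** The product [u^3 z] is integrable as the product of [u^2] and [u z], both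
    square integrable by [H01_quartic]. *)
Lemma L2_inner_potential u z : H01 Omega u -> H01 Omega z ->
  L2_inner Omega z (fun x => V x * u x + beta * `|u x| ^+ 2 * u x) = lower_form u z.
Proof.
move=> Hu Hz; have [su sz] := (H01_sqint Hu, H01_sqint Hz).
have sV := (sqint_V su).1.
rewrite /lower_form /ip -RintegralZl//; last first.
  exact: (sqint_mul mO (sqint_sq Hu) (sqint_mulf Hu Hz)).
rewrite -RintegralD//; last 2 first.
- exact: (sqint_mul mO sV sz).
- by apply: integrableRZ => //; exact: (sqint_mul mO (sqint_sq Hu) (sqint_mulf Hu Hz)).
by apply: eq_Rintegral => x _; rewrite real_normK ?num_real// /mulf /sq; ring.
Qed.

Lemma mulf_lin u a f g : mulf u (lin a f g) = lin a (mulf u f) (mulf u g).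
Proof. by apply/funext => x; rewrite /mulf /lin; ring. Qed.

Lemma ip_linr a f g h : S f -> S g -> S h -> ipO h (lin a f g) = a * ipO h f + ipO h g.
Proof. by move=> sf sg sh; rewrite ipC ip_linl// !(ipC _ _ h). Qed.

Lemma lower_form_lin u a f g : H01 Omega u -> H01 Omega f -> H01 Omega g ->
  lower_form u (lin a f g) = a * lower_form u f + lower_form u g.
Proof.
move=> Hu Hf Hg; have sV := (sqint_V (H01_sqint Hu)).1.
rewrite /lower_form mulf_lin (ip_linr a (H01_sqint Hf) (H01_sqint Hg) sV).
rewrite (ip_linr a (sqint_mulf Hu Hf) (sqint_mulf Hu Hg) (sqint_sq Hu)).
move: (ipO _ f) (ipO _ g) (ipO _ (mulf u f)) (ipO _ (mulf u g)) => x y z t; ring.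
Qed.

Definition lower_const (Q : R) := 2 * W ^+ 2 * P ^+ 2 * Q + 2 * beta ^+ 2 * C ^+ 2 * Q ^+ 3.

Let mul_bound (x k a b a' b' : R) : 0 <= k -> 0 <= a -> 0 <= b -> a <= a' ->
  b <= b' -> x <= k * a * b -> x <= k * (a' * b').
Proof. by move=> k0 a0 b0 aa bb /le_trans; apply; rewrite -mulrA ler_wpM2l// ler_pM. Qed.

Let sum_bound (x y a b : R) : x ^+ 2 <= W ^+ 2 * ((P * a) * (P * b)) ->
  y ^+ 2 <= 1 * ((C * (a * a)) * (C * (a * b))) ->
  (x + beta * y) ^+ 2 <= lower_const a * b.
Proof.
move=> h1 h2; have := sqr_ge0 (x - beta * y).
have := ler_wpM2l (sqr_ge0 beta) h2; rewrite /lower_const; move: P C h1 => p c h1; lra.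
Qed.

Lemma lower_form_le u z : H01 Omega u -> H01 Omega z ->
  lower_form u z ^+ 2 <= lower_const (B u u) * B z z.
Proof.
move=> Hu Hz; have [su sz] := (H01_sqint Hu, H01_sqint Hz).
have [sV [h1 _]] := sqint_V su; have {}h1 := h1 _ sz.
have h2 := ip_CS mO (sqint_sq Hu) (sqint_mulf Hu Hz).
rewrite ip_mulf in h2.
have q1 := ip_sq_le Hu Hu; have q2 := ip_sq_le Hu Hz.
have p1 := H01_poincare oO OM d13 M0 Hu; have p2 := H01_poincare oO OM d13 M0 Hz.
have h0 : 0 <= ipO (sq u) (sq z) by rewrite -ip_mulf; exact: ip_ge0.
have {}h1 := mul_bound (sqr_ge0 W) (ip_ge0 _ _ _) (ip_ge0 _ _ _) p1 p2 h1.
rewrite -(mul1r (_ * _)) mulrA in h2.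
have {}h2 := mul_bound ler01 (ip_ge0 _ _ _) h0 q1 q2 h2.
exact: sum_bound h1 h2.
Qed.

(** ** Energy identities *)

Lemma Rintegral_sum (I : Type) (s : seq I) (f : I -> 'rV[R]_d -> R) :
  (forall k, mu.-integrable Omega (EFin \o f k)) ->
  mu.-integrable Omega (EFin \o (fun x => \sum_(k <- s) f k x)) /\
  \int[mu]_(x in Omega) (\sum_(k <- s) f k x) =
  \sum_(k <- s) \int[mu]_(x in Omega) f k x.
Proof.
move=> fi; elim: s => [|k s [ih1 ih2]].
  rewrite big_nil; split.
    by apply: (eq_integrable mO (cst 0%E)) (integrable0 _ _) => x _; rewrite /= big_nil.
  rewrite (@eq_Rintegral _ _ _ mu _ (cst 0)) => [|x _]; last by rewrite big_nil.
  by rewrite /Rintegral integral0.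
have E1 : (fun x => \sum_(j <- k :: s) f j x) = f k \+ (fun x => \sum_(j <- s) f j x).
  by apply/funext => x; rewrite big_cons.
rewrite E1 big_cons -ih2; split; first exact: integrableRD.
by rewrite RintegralD.
Qed.

Lemma energyE u : H01 Omega u ->
  E u = 2^-1 * B u u + 2^-1 * ipO (mulf V u) u + beta / 4 * ipO (sq u) (sq u).
Proof.
move=> Hu; have su := H01_sqint Hu; have sV := (sqint_V su).1.
have iG i : mu.-integrable Omega (EFin \o (fun x => G i u x * G i u x)).
  have s := H1_sqint_weak i (H01_H1 Hu); exact: (sqint_mul mO s s).
have [iS ES] := Rintegral_sum (index_enum _) iG.
have iV := sqint_mul mO sV su.
have iq := sqint_mul mO (sqint_sq Hu) (sqint_sq Hu).
have -> : B u u = \int[mu]_(x in Omega) (\sum_i G i u x * G i u x) by rewrite ES.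
rewrite /ip -(RintegralZl _ mO iS) -(RintegralZl _ mO iV) -(RintegralZl _ mO iq).
have i1 := integrableRZ mO 2^-1 iS; have i2 := integrableRZ mO 2^-1 iV.
have i3 := integrableRZ mO (beta / 4) iq.
rewrite -(RintegralD mO i1 i2) -(RintegralD mO (integrableRD mO i1 i2) i3).
apply: eq_Rintegral => x _; rewrite real_normK ?num_real// /mulf /sq.
rewrite (_ : `|u x| ^+ 4 = u x ^+ 2 * u x ^+ 2); last first.
  by rewrite -[4%N]/(2 * 2)%N exprM real_normK ?num_real.
by congr (_ * _ + _ + _); ring.
Qed.

End energy.

(** * One step of the scheme *)

Section step.
Context (R : realType) (d : nat) (Omega : set 'rV[R]_d) (M : R).
Hypothesis oO : open Omega.
Hypothesis OM : Omega `<=` cube d M.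
Hypothesis d13 : (1 <= d <= 3)%N.
Hypothesis M0 : 0 <= M.
Variables (V : 'rV[R]_d -> R) (W beta : R).
Hypothesis W0 : 0 <= W.
Hypothesis mV : measurable_fun Omega V.
Hypothesis VW : {ae lebesgue_rV R d, forall x, Omega x -> 0 <= V x <= W}.
Hypothesis beta0 : 0 <= beta.

Local Notation mu := (lebesgue_rV R d).
Local Notation S := (sqint mu Omega).
Local Notation ipO := (ip mu Omega).
Local Notation B := (H01_inner Omega).
Local Notation E := (energy Omega V beta).
Local Notation P := (poincare_const M).
Local Notation C := (quartic_const M).
Local Notation N := (lower_form Omega V beta).
Implicit Types (u v w z f g : 'rV[R]_d -> R) (a : R).

Let mO : measurable Omega.
Proof. exact: measurable_open_rV. Qed.

Let ss u : H01 Omega u -> S (sq u).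
Proof. exact: (sqint_sq oO OM d13 M0). Qed.

Let sm u v : H01 Omega u -> H01 Omega v -> S (mulf u v).
Proof. exact: (sqint_mulf oO OM d13 M0). Qed.

Let sV u : H01 Omega u -> S (mulf V u).
Proof. by move=> /H01_sqint su; have [] := sqint_V oO W0 mV VW su. Qed.

Let Elow u (Hu : H01 Omega u) := energyE oO OM d13 M0 beta W0 mV VW Hu.

Lemma quartic_expand u g a : H01 Omega u -> H01 Omega g ->
  ipO (sq (lin (- a) g u)) (sq (lin (- a) g u)) =
  ipO (sq u) (sq u) - 4 * a * ipO (sq u) (mulf u g) +
  6 * a ^+ 2 * ipO (sq u) (sq g) - 4 * a ^+ 3 * ipO (mulf u g) (sq g) +
  a ^+ 4 * ipO (sq g) (sq g).
Proof.
move=> Hu Hg; have [su sg] := (ss Hu, ss Hg); have sug := sm Hu Hg.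
have -> : sq (lin (- a) g u) = lin (a ^+ 2) (sq g) (lin (- (2 * a)) (mulf u g) (sq u)).
  by apply/funext => x; rewrite /sq /lin /mulf; ring.
set h := lin (- (2 * a)) _ _; have sh : S h by exact: sqint_lin.
have L f k : S f -> S k -> ipO (lin (a ^+ 2) (sq g) f) k = a ^+ 2 * ipO (sq g) k + ipO f k.
  by move=> sf sk; exact: ip_linl.
have L' k : S k -> ipO h k = - (2 * a) * ipO (mulf u g) k + ipO (sq u) k.
  by move=> sk; exact: ip_linl.
have sl : S (lin (a ^+ 2) (sq g) h) by exact: sqint_lin.
rewrite L// ipC L// (ipC mu Omega h (lin _ _ _)) L// (ipC mu Omega (sq g) h).
rewrite !L'// !(ipC mu Omega _ h) !L'//.
rewrite ip_mulf (ipC mu Omega (mulf u g) (sq u)).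
move: (ipO (sq u) (sq u)) (ipO (sq u) (mulf u g)) (ipO (sq u) (sq g)).
move: (ipO (mulf u g) (sq g)) (ipO (sq g) (sq g)) => y z t q x; ring.
Qed.

(** The cubic term of [quartic_expand] has no sign. It is absorbed into its
    neighbours by expanding the square of [u g + a g^2]. *)
Lemma cubic_quartic_le u g a : H01 Omega u -> H01 Omega g ->
  - (4 * a ^+ 3 * ipO (mulf u g) (sq g)) <=
  2 * a ^+ 2 * ipO (sq u) (sq g) + 2 * a ^+ 4 * ipO (sq g) (sq g).
Proof.
move=> Hu Hg; have [su sg] := (ss Hu, ss Hg); have sug := sm Hu Hg.
have := ip_ge0 mu Omega (lin a (sq g) (mulf u g)).
have sl : S (lin a (sq g) (mulf u g)) by exact: sqint_lin.
rewrite ip_linl// ipC ip_linl// (ipC mu Omega (mulf u g) (lin _ _ _)) ip_linl//.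
rewrite ip_mulf (ipC mu Omega (sq g) (mulf u g)) => h.
have := mulr_ge0 (sqr_ge0 a) h.
move: (ipO (mulf u g) (sq g)) (ipO (sq g) (sq g)) (ipO (sq u) (sq g)) {h} => x y z.
lra.
Qed.

Lemma H01_form_expand (F : ('rV[R]_d -> R) -> ('rV[R]_d -> R) -> R) u g a :
  (forall f h, F f h = F h f) -> (forall b f h k, H01 Omega f -> H01 Omega h ->
    H01 Omega k -> F (lin b f h) k = b * F f k + F h k) ->
  H01 Omega u -> H01 Omega g ->
  F (lin (- a) g u) (lin (- a) g u) = F u u - 2 * a * F u g + a ^+ 2 * F g g.
Proof.
move=> FC FL Hu Hg; have Hl := H01_lin oO OM (- a) Hg Hu.
rewrite FL// FC FL// (FC u (lin _ _ _)) FL// (FC g u).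
move: (F u u) (F u g) (F g g) => x y z; ring.
Qed.

Let VC f h : ipO (mulf V f) h = ipO (mulf V h) f.
Proof. by apply: eq_Rintegral => x _; rewrite /mulf; ring. Qed.

Lemma energy_expand u g a : H01 Omega u -> H01 Omega g ->
  E (lin (- a) g u) = E u - a * (B u g + N u g)
   + 2^-1 * a ^+ 2 * (B g g + ipO (mulf V g) g)
   + beta / 4 * (6 * a ^+ 2 * ipO (sq u) (sq g) - 4 * a ^+ 3 * ipO (mulf u g) (sq g)
       + a ^+ 4 * ipO (sq g) (sq g)).
Proof.
move=> Hu Hg; have Hl := H01_lin oO OM (- a) Hg Hu.
rewrite !Elow// quartic_expand//.
rewrite (H01_form_expand a (H01_innerC Omega) _ Hu Hg); last first.
  by move=> b f h k Hf Hh Hk; apply: (H01_inner_lin oO OM); exact: H01_H1.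
rewrite (H01_form_expand (F := fun f h => ipO (mulf V f) h) a VC _ Hu Hg); last first.
  move=> b f h k Hf Hh Hk; rewrite mulf_lin.
  by apply: ip_linl => //; [exact: sV|exact: sV|exact: H01_sqint].
rewrite /lower_form.
move: (B u u) (B u g) (B g g) (ipO (mulf V u) u) (ipO (mulf V u) g) (ipO (mulf V g) g).
move: (ipO (sq u) (sq u)) (ipO (sq u) (mulf u g)) (ipO (sq u) (sq g)).
move: (ipO (mulf u g) (sq g)) (ipO (sq g) (sq g)) => x1 x2 x3 x4 x5 x6 x7 x8 x9 y1 y2.
by field.
Qed.

Definition descent_const (Qu Qg : R) :=
  2^-1 + 2^-1 * W * P + beta / 4 * (C * (8 * Qu + 3 * Qg)).

Let descent_arith (e e' a t bg vg X Y Z bu : R) : 0 <= a -> a <= 1 -> 0 <= bg -> 0 <= bu ->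
  vg <= W * (P * bg) -> X <= C * (bu * bg) -> Z <= C * (bg * bg) -> 0 <= Z ->
  - (4 * a ^+ 3 * Y) <= 2 * a ^+ 2 * X + 2 * a ^+ 4 * Z ->
  e' = e - a * t + 2^-1 * a ^+ 2 * (bg + vg)
   + beta / 4 * (6 * a ^+ 2 * X - 4 * a ^+ 3 * Y + a ^+ 4 * Z) ->
  a * t - a ^+ 2 * (descent_const bu bg * bg) <= e - e'.
Proof.
move=> a0 a1 bg0 bu0 hv hX hZ Z0 hY ->.
have a2 : 0 <= a ^+ 2 by exact: sqr_ge0.
have aZ : a ^+ 4 * Z <= a ^+ 2 * Z.
  by rewrite ler_wpM2r// ler_wiXn2l.
have h1 := ler_wpM2l a2 hv; have h2 := ler_wpM2l a2 hX; have h3 := ler_wpM2l a2 hZ.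
have h : 6 * a ^+ 2 * X - 4 * a ^+ 3 * Y + a ^+ 4 * Z <=
    8 * (a ^+ 2 * (C * (bu * bg))) + 3 * (a ^+ 2 * (C * (bg * bg))) by lra.
have b4 : 0 <= beta / 4 by rewrite divr_ge0.
have {}h := ler_wpM2l b4 h.
rewrite /descent_const.
have -> : a ^+ 2 * ((2^-1 + 2^-1 * W * P + beta / 4 * (C * (8 * bu + 3 * bg))) * bg) =
  2^-1 * a ^+ 2 * bg + 2^-1 * (a ^+ 2 * (W * (P * bg))) +
  beta / 4 * (8 * (a ^+ 2 * (C * (bu * bg))) + 3 * (a ^+ 2 * (C * (bg * bg)))) by ring.
move: (beta / 4 * _) (beta / 4 * _) h => p q h.
move: (W * (P * bg)) h1 => r h1; lra.
Qed.

(** The first order term is the derivative of the energy at [u] applied to [g];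
    all others carry [a^2] and at least two factors [g]. *)
Lemma energy_descent u g a : H01 Omega u -> H01 Omega g -> 0 <= a -> a <= 1 ->
  a * (B u g + N u g) - a ^+ 2 * (descent_const (B u u) (B g g) * B g g) <=
  E u - E (lin (- a) g u).
Proof.
move=> Hu Hg a0 a1.
have [_ [_ /andP[_ hv]]] := sqint_V oO W0 mV VW (H01_sqint Hg).
apply: (descent_arith a0 a1 _ _ _ (ip_sq_le oO OM d13 M0 Hu Hg)
  (ip_sq_le oO OM d13 M0 Hg Hg) (ip_ge0 _ _ _) (cubic_quartic_le a Hu Hg) (energy_expand a Hu Hg)).
- exact: H01_inner_ge0.
- exact: H01_inner_ge0.
- apply: le_trans hv _; apply: ler_wpM2l => //; exact: (H01_poincare oO OM d13 M0).
Qed.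

(** ** Rescaling *)

Lemma H01_scale_inner c u : H01 Omega u ->
  B (fun x => c * u x) (fun x => c * u x) = c ^+ 2 * B u u.
Proof.
move=> Hu; have H0 := H01_cst0 oO OM; have Hc := H01_scale oO OM c Hu.
have K := H01_H1 Hu; have K0 := H01_H1 H0.
have Z k : H1 Omega k -> B (cst 0) k = 0.
  move=> Hk; have := H01_inner_lin oO OM (-1) K0 K0 Hk.
  rewrite (_ : lin (-1) (cst 0) (cst 0) = cst 0); first by rewrite mulN1r addNr.
  by apply/funext => x; rewrite /lin /=; ring.
have L k : H1 Omega k -> B (fun x => c * u x) k = c * B u k.
  move=> Hk; have := H01_inner_lin oO OM c K K0 Hk; rewrite (Z _ Hk) addr0.
  by rewrite (_ : lin c u (cst 0) = fun x => c * u x)//; apply/funext => x; rewrite /lin addr0.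
rewrite (L _ (H01_H1 Hc)) (H01_innerC _ u (fun x => c * u x)) (L _ K).
exact: mulrA.
Qed.

(** The terms of the energy are nonnegative and homogeneous of degree [2]
    or [4]. *)
Lemma energy_scale_le c u : H01 Omega u -> 0 <= c -> c <= 1 ->
  E (fun x => c * u x) <= E u.
Proof.
move=> Hu c0 c1; have Hc := H01_scale oO OM c Hu.
have [sV' [_ /andP[hv _]]] := sqint_V oO W0 mV VW (H01_sqint Hu).
rewrite !Elow// H01_scale_inner//.
have -> : ipO (mulf V (fun x => c * u x)) (fun x => c * u x) = c ^+ 2 * ipO (mulf V u) u.
  rewrite /ip -(RintegralZl _ mO (sqint_mul mO sV' (H01_sqint Hu))).
  by apply: eq_Rintegral => x _; rewrite /mulf; ring.
have -> : ipO (sq (fun x => c * u x)) (sq (fun x => c * u x)) = c ^+ 4 * ipO (sq u) (sq u).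
  rewrite /ip -(RintegralZl _ mO (sqint_mul mO (ss Hu) (ss Hu))).
  by apply: eq_Rintegral => x _; rewrite /sq; ring.
have b4 : 0 <= beta / 4 by rewrite divr_ge0.
have c2 : c ^+ 2 <= 1 by rewrite exprn_ile1.
have c4 : c ^+ 4 <= 1 by rewrite exprn_ile1.
apply: lerD; first apply: lerD.
- by apply: ler_wpM2l => //; apply: ler_piMl => //; exact: H01_inner_ge0.
- by apply: ler_wpM2l => //; apply: ler_piMl.
- by apply: ler_wpM2l => //; apply: ler_piMl => //; exact: ip_ge0.
Qed.

(** ** Existence of the Riemannian gradient *)

Let lower_const0 u : 0 <= lower_const M W beta (B u u).
Proof.
have b := H01_inner_ge0 Omega u; have W2 := sqr_ge0 W; have p2 := sqr_ge0 P.
have c2 := sqr_ge0 C; have be2 := sqr_ge0 beta.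
rewrite /lower_const; move: (B u u) (W ^+ 2) (P ^+ 2) (C ^+ 2) (beta ^+ 2) b W2 p2 c2 be2.
by move=> x1 x2 x3 x4 x5 *; rewrite addr_ge0// !mulr_ge0// exprn_ge0.
Qed.

Lemma green_potentialP u : H01 Omega u -> H01 Omega (green_potential Omega V beta u) /\
  forall z, H01 Omega z -> B z (green_potential Omega V beta u) = N u z.
Proof.
move=> Hu; have LP z := L2_inner_potential oO OM d13 M0 beta W0 mV VW (z := z) Hu.
have [|f|Hp pP] := green_spec oO OM d13 M0 (w := fun x => V x * u x + beta * `|u x| ^+ 2 * u x)
   (lower_const0 u).
- move=> a f g Hf Hg; have Hl := H01_lin oO OM a Hf Hg.
  rewrite (LP _ Hl) (LP _ Hf) (LP _ Hg).
  exact: (lower_form_lin oO OM d13 M0 beta W0 mV VW a Hu Hf Hg).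
- move=> Hz; rewrite (LP _ Hz).
  exact: (lower_form_le oO OM d13 M0 beta W0 mV VW Hu Hz).
by split => // z Hz; rewrite pP// LP.
Qed.

Lemma greenP u : S u -> H01 Omega (green Omega u) /\
  forall z, H01 Omega z -> B z (green Omega u) = ipO z u.
Proof.
move=> su; have c0 : 0 <= P * ipO u u.
  by apply: mulr_ge0; [exact: poincare_const_ge0|exact: ip_ge0].
have [|z|Hp pP] := green_spec oO OM d13 M0 (w := u) c0.
- by move=> a f g Hf Hg; exact: (ip_linl mO a (H01_sqint Hf) (H01_sqint Hg) su).
- move=> Hz; apply: le_trans (ip_CS mO (H01_sqint Hz) su) _.
  rewrite mulrAC; apply: ler_wpM2r; first exact: ip_ge0.
  exact: (H01_poincare oO OM d13 M0).
by [].
Qed.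

Section gradient.
Variable u : 'rV[R]_d -> R.
Hypothesis mu_ : manifold Omega u.

Let Hu : H01 Omega u. Proof. by case: mu_. Qed.
Let su : S u. Proof. exact: H01_sqint. Qed.
Let ipu : ipO u u = 1.
Proof.
have [_] := mu_; rewrite /L2_norm => h.
by rewrite -[LHS]sqr_sqrtr ?ip_ge0// -[Num.sqrt _]/(Num.sqrt (L2_inner Omega u u)) h expr1n.
Qed.

Local Notation p := (green_potential Omega V beta u).
Local Notation b := (green Omega u).
Local Notation grad := (gradE Omega V beta u).
Local Notation rgrad := (riem_gradE Omega V beta u).

Lemma gradE_lin : grad = lin 1 u p.
Proof. by apply/funext => x; rewrite /gradE /lin mul1r. Qed.

Lemma H01_gradE : H01 Omega grad.
Proof. by rewrite gradE_lin; exact: (H01_lin oO OM 1 Hu (green_potentialP Hu).1). Qed.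

(** [gradE] represents the derivative of the energy for the [H01] inner
    product. *)
Lemma gradE_inner z : H01 Omega z -> B grad z = B u z + N u z.
Proof.
move=> Hz; have [Hp pP] := green_potentialP Hu; rewrite gradE_lin.
rewrite (H01_inner_lin oO OM 1 (H01_H1 Hu) (H01_H1 Hp) (H01_H1 Hz)) mul1r.
by rewrite (H01_innerC _ p) pP.
Qed.

(** [green_potential u] has norm at most that of the functional that it
    represents, which [lower_form_le] bounds. *)
Lemma gradE_bound : B grad grad <= 2 * B u u + 2 * lower_const M W beta (B u u).
Proof.
have [Hp pP] := green_potentialP Hu; rewrite {1 2}gradE_lin.
have := H01_inner_lin_le oO OM 1 (H01_H1 Hu) (H01_H1 Hp).
have h : B p p <= lower_const M W beta (B u u).
  have := lower_form_le oO OM d13 M0 beta W0 mV VW Hu Hp.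
  rewrite -pP// expr2 => h; have [->|b0] := eqVneq (B p p) 0; first exact: lower_const0.
  by rewrite -(ler_pM2r (_ : 0 < B p p)) // lt0r b0 H01_inner_ge0.
rewrite expr1n mulr1 => /le_trans; apply; rewrite lerD2l; exact: ler_wpM2l.
Qed.

(** [B u (green u)] is the mean square of [u], that is [1]; by Cauchy-Schwarz
    [green u] cannot have norm zero. *)
Lemma green_inner_gt0 : 0 < B b b.
Proof.
have [Hb bP] := greenP su.
rewrite lt0r H01_inner_ge0 andbT; apply/negP => /eqP b0.
have BL a f g h : H01 Omega f -> H01 Omega g -> H01 Omega h ->
    B (lin a f g) h = a * B f h + B g h.
  by move=> Hf Hg Hh; apply: (H01_inner_lin oO OM); exact: H01_H1.
have h := semi_inner_CS (H01_lin oO OM) BL (H01_innerC Omega) (H01_inner_ge0 Omega) Hu Hb.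
by move: h; rewrite b0 mulr0 (bP _ Hu) ipu expr1n ler10.
Qed.

Let gam := (1 + L2_inner Omega p u) / H01_norm Omega b ^+ 2.

Let rgrad_lin : rgrad = lin (- gam) b grad.
Proof. by apply/funext => x; rewrite /riem_gradE /lin /gradE /gam; ring. Qed.

Lemma H01_riem_gradE : H01 Omega rgrad.
Proof. by rewrite rgrad_lin; exact: (H01_lin oO OM _ (greenP su).1 H01_gradE). Qed.

Let grad_b : B grad b = gam * B b b.
Proof.
have [Hb bP] := greenP su; have [Hp pP] := green_potentialP Hu.
rewrite (gradE_inner Hb) (bP _ Hu) ipu -(pP _ Hb) (H01_innerC _ b) (bP _ Hp).
rewrite /gam /H01_norm sqr_sqrtr ?H01_inner_ge0// divfK// gt_eqF//.
exact: green_inner_gt0.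
Qed.

Let BL a f g h : H01 Omega f -> H01 Omega g -> H01 Omega h ->
  B (lin a f g) h = a * B f h + B g h.
Proof. by move=> Hf Hg Hh; apply: (H01_inner_lin oO OM); exact: H01_H1. Qed.

Let rgrad_b : B rgrad b = 0.
Proof.
have [Hb _] := greenP su.
rewrite rgrad_lin (BL _ Hb H01_gradE Hb) grad_b; move: (B b b) => x; ring.
Qed.

(** The Riemannian gradient is tangent to the sphere: by definition of [green],
    being [H01]-orthogonal to [green u] is being [L2]-orthogonal to [u]. *)
Lemma riem_gradE_tangent : ipO rgrad u = 0.
Proof. by have [_ bP] := greenP su; rewrite -(bP _ H01_riem_gradE) rgrad_b. Qed.

(** [riem_gradE] is the [H01]-orthogonal projection of [gradE] on the orthogonal
    of [green u]; hence this identity and the next inequality. *)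
Lemma gradE_riem_gradE : B grad rgrad = B rgrad rgrad.
Proof.
have [Hb _] := greenP su; have := BL (- gam) Hb H01_gradE H01_riem_gradE.
rewrite -rgrad_lin (H01_innerC _ b rgrad) rgrad_b mulr0 add0r.
exact: esym.
Qed.

Lemma riem_gradE_le : B rgrad rgrad <= B grad grad.
Proof.
have [Hb _] := greenP su; rewrite -gradE_riem_gradE H01_innerC.
have := BL (- gam) Hb H01_gradE H01_gradE; rewrite -rgrad_lin => ->.
rewrite (H01_innerC _ b grad) grad_b gerDr mulNr oppr_le0 mulrA -expr2.
by apply: mulr_ge0; [exact: sqr_ge0|exact: H01_inner_ge0].
Qed.

Variable a : R.
Hypothesis a0 : 0 < a.
Hypothesis a1 : a <= 1.

Local Notation v := (fun x => u x - a * rgrad x).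

Let v_lin : v = lin (- a) rgrad u.
Proof. by apply/funext => x; rewrite /lin; ring. Qed.

Let Hv : H01 Omega v.
Proof. by rewrite v_lin; exact: (H01_lin oO OM (- a) H01_riem_gradE Hu). Qed.

Let ipv : 1 <= ipO v v.
Proof.
have sr := H01_sqint H01_riem_gradE; rewrite v_lin.
have sl : S (lin (- a) rgrad u) by exact: sqint_lin.
rewrite (ip_linl mO _ sr su sl) (ipC mu Omega rgrad) (ipC mu Omega u).
rewrite (ip_linl mO _ sr su sr) (ip_linl mO _ sr su su) riem_gradE_tangent ipu.
rewrite (ipC mu Omega u rgrad) riem_gradE_tangent.
have := ip_ge0 mu Omega rgrad; move: (ipO rgrad rgrad) => x x0.
by rewrite mulr0 add0r addr0 lerDr mulrA mulrNN mulr_ge0// mulr_ge0// ltW.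
Qed.

Let s_ge1 : 1 <= L2_norm Omega v.
Proof. by rewrite -[leLHS]sqrtr1 ler_wsqrtr. Qed.

Let s_gt0 : 0 < L2_norm Omega v.
Proof. exact: lt_le_trans ltr01 s_ge1. Qed.

Let next_scale : retraction Omega v = (fun x => (L2_norm Omega v)^-1 * v x).
Proof. by apply/funext => x; rewrite /retraction mulrC. Qed.

Lemma retraction_manifold : manifold Omega (retraction Omega v).
Proof.
split; first by rewrite next_scale; exact: (H01_scale oO OM _ Hv).
rewrite {1}/L2_norm next_scale.
have -> : L2_inner Omega (fun x => (L2_norm Omega v)^-1 * v x)
    (fun x => (L2_norm Omega v)^-1 * v x) = (L2_norm Omega v)^-1 ^+ 2 * ipO v v.
  rewrite /ip -(RintegralZl _ mO (sqint_mul mO (H01_sqint Hv) (H01_sqint Hv))).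
  by apply: eq_Rintegral => x _; ring.
rewrite sqrtrM ?sqr_ge0// sqrtr_sqr ger0_norm ?invr_ge0 ?ltW//.
by rewrite -[Num.sqrt (ipO v v)]/(L2_norm Omega v) mulVf// gt_eqF.
Qed.

(** The first order gain is [a * B rgrad rgrad]; half of it pays for the second
    order terms when [a * K <= 1 / 2]. *)
Lemma energy_step (K : R) : descent_const (B u u) (B rgrad rgrad) <= K ->
  a * K <= 2^-1 ->
  a / 2 * B rgrad rgrad <= E u - E (retraction Omega v).
Proof.
move=> hK aK.
have h1 : E (retraction Omega v) <= E v.
  rewrite next_scale; apply: (energy_scale_le Hv); first by rewrite invr_ge0 ltW.
  by rewrite invf_le1.
have h2 := energy_descent Hu H01_riem_gradE (ltW a0) a1.
rewrite -v_lin -(gradE_inner H01_riem_gradE) gradE_riem_gradE in h2.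
have b0 := H01_inner_ge0 Omega rgrad.
move: (E u) (E v) (E (retraction Omega v)) h1 h2 => e1 e2 e3 h1 h2.
move: hK b0 h2; move: (descent_const _ _) => k; move: (B rgrad rgrad) => x hK b0 h2.
have h3 : a * (k * x) <= 2^-1 * x.
  by rewrite mulrA ler_wpM2r// (le_trans _ aK)// ler_wpM2l// ltW.
have := ler_wpM2l (ltW a0) h3; rewrite !mulrA -expr2 => h4.
rewrite !mulrA in h2; lra.
Qed.

End gradient.

End step.

(** * Energy dissipation along the scheme *)

Lemma bounded_subset_cube (R : realType) d (Omega : set 'rV[R]_d) :
  bounded_set Omega -> exists2 M : R, 0 <= M & Omega `<=` cube d M.
Proof.
move=> [M [_ HM]]; exists (`|M| + 1); first by rewrite addr_ge0.
move=> x Ox i; have MM : M < `|M| + 1 by rewrite (le_lt_trans (ler_norm M))// ltrDl.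
apply: le_trans (HM _ MM x Ox); rewrite /Num.norm/= mx_normrE.
exact: (le_bigmax _ (fun ij : 'I_1 * 'I_d => `|x ij.1 ij.2|) (ord0, i)).
Qed.

Section dissipation.
Context (R : realType) (d : nat) (Omega : set 'rV[R]_d) (M : R).
Hypothesis oO : open Omega.
Hypothesis OM : Omega `<=` cube d M.
Hypothesis d13 : (1 <= d <= 3)%N.
Hypothesis M0 : 0 <= M.
Variables (V : 'rV[R]_d -> R) (W beta K : R).
Hypothesis W0 : 0 <= W.
Hypothesis mV : measurable_fun Omega V.
Hypothesis VW : {ae lebesgue_rV R d, forall x, Omega x -> 0 <= V x <= W}.
Hypothesis beta0 : 0 <= beta.

Local Notation ipO := (ip (lebesgue_rV R d) Omega).
Local Notation B := (H01_inner Omega).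
Local Notation E := (energy Omega V beta).
Local Notation P := (poincare_const M).
Local Notation C := (quartic_const M).
Local Notation lower := (lower_const M W beta).

(** Twice a bound of the initial energy, increased by [1] to be positive. *)
Definition sublevel := K ^+ 2 + W + beta / 2 * (C * (K ^+ 2 * K ^+ 2)) + 1.

(** The bound of [gradE_bound] at the largest Dirichlet norm that the sublevel
    set allows; the final [1] makes it positive. *)
Definition grad_bound := 2 * sublevel + 2 * lower sublevel + 1.

Definition step_bound := Num.min 1 (2^-1 / descent_const M W beta sublevel grad_bound).

Let p0 : 0 <= P := poincare_const_ge0 M.
Let c0 : 0 <= C := quartic_const_ge0 M.

Lemma sublevel_gt0 : 0 < sublevel.
Proof.
have k0 := sqr_ge0 K; have q0 := mulr_ge0 c0 (mulr_ge0 k0 k0).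
have := mulr_ge0 (divr_ge0 beta0 (ler0n R 2)) q0; rewrite /sublevel.
by move: k0 W0; move: (K ^+ 2) (_ / 2 * _) => x y; lra.
Qed.

Let lower1_ge0 (x y : R) : 0 <= 2 * x ^+ 2 * y ^+ 2.
Proof. exact: mulr_ge0 (mulr_ge0 (ler0n R 2) (sqr_ge0 x)) (sqr_ge0 y). Qed.

Let lower_ge0 q : 0 <= q -> 0 <= lower q.
Proof.
move=> q0; rewrite /lower_const addr_ge0//; first exact: (mulr_ge0 (lower1_ge0 _ _)).
exact: mulr_ge0 (lower1_ge0 _ _) (exprn_ge0 3 q0).
Qed.

Let lower_le q q' : 0 <= q -> q <= q' -> lower q <= lower q'.
Proof.
move=> q0 qq; apply: lerD; first exact: ler_wpM2l (lower1_ge0 _ _) _ _ qq.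
apply: ler_wpM2l (lower1_ge0 _ _) _ _ _.
by rewrite ler_pXn2r// nnegrE (le_trans q0).
Qed.

Lemma grad_bound_gt0 : 0 < grad_bound.
Proof.
have := lower_ge0 (ltW sublevel_gt0); have := sublevel_gt0; rewrite /grad_bound.
by move: sublevel => s s0; move: (lower s) => l; move: s0; lra.
Qed.

Let descent_le x y x' y' : x <= x' -> y <= y' ->
  descent_const M W beta x y <= descent_const M W beta x' y'.
Proof.
move=> xx yy; rewrite /descent_const lerD2l; apply: ler_wpM2l; first exact: divr_ge0.
by apply: ler_wpM2l => //; move: xx yy; lra.
Qed.

Let descent_gt0 : 0 < descent_const M W beta sublevel grad_bound.
Proof.
have s0 := ltW sublevel_gt0; have g0 := ltW grad_bound_gt0.
rewrite /descent_const.
have := mulr_ge0 (mulr_ge0 (ler0n R 2) W0) p0.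
have h : 0 <= 8 * sublevel + 3 * grad_bound.
  by move: s0 g0; move: sublevel grad_bound => x y; lra.
have := mulr_ge0 (divr_ge0 beta0 (ler0n R 4)) (mulr_ge0 c0 h).
by move: (_ / 4 * _) => x; move: P => p; move: W => w; lra.
Qed.

Lemma step_bound_gt0 : 0 < step_bound.
Proof. by rewrite lt_min ltr01 divr_gt0// invr_gt0. Qed.

Lemma initial_energy_le u : manifold Omega u -> H01_norm Omega u = K ->
  2 * E u <= sublevel.
Proof.
move=> [Hu u1] uK; have su := H01_sqint Hu.
have BK : B u u = K ^+ 2 by rewrite -uK /H01_norm sqr_sqrtr// H01_inner_ge0.
have iu : ipO u u = 1.
  rewrite -[LHS]sqr_sqrtr ?ip_ge0// -[Num.sqrt _]/(Num.sqrt (L2_inner Omega u u)).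
  by rewrite -[Num.sqrt _]/(L2_norm Omega u) u1 expr1n.
have [_ [_ /andP[_ hV]]] := sqint_V oO W0 mV VW su.
have hq := ip_sq_le oO OM d13 M0 Hu Hu.
rewrite (energyE oO OM d13 M0 beta W0 mV VW Hu) /sublevel.
rewrite iu mulr1 in hV; rewrite BK in hq *.
have := ler_wpM2l (divr_ge0 beta0 (ler0n R 4)) hq.
have -> : beta / 2 * (C * (K ^+ 2 * K ^+ 2)) = 2 * (beta / 4 * (C * (K ^+ 2 * K ^+ 2))).
  by field.
move: (beta / 4 * _) (beta / 4 * _) (ipO (mulf V u) u) hV => x y z hV h.
move: (K ^+ 2) => k; lra.
Qed.

Lemma energy_coercive u : H01 Omega u -> B u u <= 2 * E u.
Proof.
move=> Hu; have su := H01_sqint Hu.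
have [_ [_ /andP[hV _]]] := sqint_V oO W0 mV VW su.
rewrite (energyE oO OM d13 M0 beta W0 mV VW Hu).
have : 0 <= beta / 4 * ipO (sq u) (sq u).
  by rewrite mulr_ge0 ?divr_ge0// ip_ge0.
move: (beta / 4 * _) (B u u) (ipO (mulf V u) u) hV => x y z hV h; lra.
Qed.

Let grad_le u : manifold Omega u -> 2 * E u <= sublevel ->
  B (gradE Omega V beta u) (gradE Omega V beta u) <= grad_bound.
Proof.
move=> mu_ uE; have Bu := le_trans (energy_coercive mu_.1) uE.
apply: le_trans (gradE_bound oO OM d13 M0 beta W0 mV VW mu_) _.
have := lower_le (H01_inner_ge0 Omega u) Bu; move: Bu; rewrite /grad_bound.
by move: (lower (B u u)) (lower sublevel) => x y; move: (B u u) sublevel => z w; lra.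
Qed.

(** Induction on [n] with the invariant that twice the energy is at most
    [sublevel]: it bounds the Dirichlet norm, hence the constants in
    [energy_step], whose conclusion preserves the invariant. *)
Theorem scheme_dissipation (alpha : nat -> R) u0 :
  manifold Omega u0 -> H01_norm Omega u0 = K ->
  (forall n, 0 < alpha n <= step_bound) ->
  forall n, let u := scheme Omega V beta alpha u0 in
  [/\ manifold Omega (u n), B (u n) (u n) <= sublevel,
      B (riem_gradE Omega V beta (u n)) (riem_gradE Omega V beta (u n)) <=
      B (gradE Omega V beta (u n)) (gradE Omega V beta (u n)),
      B (gradE Omega V beta (u n)) (gradE Omega V beta (u n)) <= grad_bound &
      alpha n / 2 * B (riem_gradE Omega V beta (u n)) (riem_gradE Omega V beta (u n))
      <= E (u n) - E (u n.+1)].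
Proof.
move=> mu0 uK ha n u.
have step k : manifold Omega (u k) -> 2 * E (u k) <= sublevel ->
    [/\ B (riem_gradE Omega V beta (u k)) (riem_gradE Omega V beta (u k)) <=
      B (gradE Omega V beta (u k)) (gradE Omega V beta (u k)),
      manifold Omega (u k.+1) &
      alpha k / 2 * B (riem_gradE Omega V beta (u k)) (riem_gradE Omega V beta (u k))
      <= E (u k) - E (u k.+1)].
  move=> muk uE; have /andP[a0] := ha k; rewrite le_min => /andP[a1 ad].
  have rg := riem_gradE_le oO OM d13 M0 beta W0 mV VW muk.
  have gb := grad_le muk uE.
  split=> //; first exact: (retraction_manifold oO OM d13 M0 beta W0 mV VW muk a0).
  apply: (energy_step oO OM d13 M0 W0 mV VW beta0 muk a0 a1
    (K := descent_const M W beta sublevel grad_bound)).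
    apply: descent_le; last exact: le_trans rg gb.
    exact: le_trans (energy_coercive muk.1) uE.
  by rewrite -ler_pdivlMr.
have inv k : manifold Omega (u k) /\ 2 * E (u k) <= sublevel.
  elim: k => [|k [muk uE]]; first by split => //; exact: initial_energy_le.
  have [_ muk1 dE] := step k muk uE; split => //; apply: le_trans uE.
  have /andP[a0 _] := ha k.
  have : 0 <= alpha k / 2 * B (riem_gradE Omega V beta (u k)) (riem_gradE Omega V beta (u k)).
    by rewrite mulr_ge0 ?H01_inner_ge0// divr_ge0// ltW.
  by move=> /le_trans/(_ dE); rewrite subr_ge0 => h; rewrite ler_wpM2l.
have [mun uE] := inv n; have [h1 h2 h3] := step n mun uE; split => //.
  exact: le_trans (energy_coercive mun.1) uE.
exact: grad_le.
Qed.

End dissipation.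

Theorem theorem3p1 (R : realType) (d : nat) (hd : (1 <= d <= 3)%N)
    (Omega : set 'rV[R]_d) (hOmega : bounded_lipschitz_domain Omega)
    (V : 'rV[R]_d -> R) (Vmax : R) (hV : bounded_potential Omega V Vmax)
    (beta : R) (hbeta : 0 <= beta) (K : R) :
  exists Cu Cg Calpha : R,
    [/\ 0 < Cu, 0 < Cg, 0 < Calpha & Calpha <= 1] /\
    forall u0 : 'rV[R]_d -> R, manifold Omega u0 -> H01_norm Omega u0 = K ->
    forall (alpha : nat -> R) (alpha_min alpha_max : R),
      0 < alpha_min ->
      (forall n, alpha_min <= alpha n <= alpha_max) ->
      alpha_max <= Calpha ->
    let u := scheme Omega V beta alpha u0 in
    forall n : nat,
      [/\ manifold Omega (u n),
          H01_norm Omega (u n) <= Cu,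
          H01_norm Omega (riem_gradE Omega V beta (u n))
            <= H01_norm Omega (gradE Omega V beta (u n)),
          H01_norm Omega (gradE Omega V beta (u n)) <= Cg &
          energy Omega V beta (u n) - energy Omega V beta (u n.+1)
            >= alpha_min / 2
               * H01_norm Omega (riem_gradE Omega V beta (u n)) ^+ 2].
Proof.
have [oO _ _ bO _] := hOmega; have [M M0 OM] := bounded_subset_cube bO.
have [mV VV] := hV.
have VW : {ae lebesgue_rV R d, forall x, Omega x -> 0 <= V x <= `|Vmax|}.
  move: VV; apply: filterS => x H Ox; have /andP[-> V1] := H Ox.
  by rewrite (le_trans V1)// ler_norm.
have W0 : 0 <= `|Vmax| by [].
exists (Num.sqrt (sublevel M `|Vmax| beta K)), (Num.sqrt (grad_bound M `|Vmax| beta K)),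
  (step_bound M `|Vmax| beta K).
split.
  split; last by rewrite ge_min lexx.
  - by rewrite sqrtr_gt0; exact: sublevel_gt0.
  - by rewrite sqrtr_gt0; exact: grad_bound_gt0.
  - exact: step_bound_gt0.
move=> u0 mu0 uK alpha amin amax amin0 ha aC u n.
have ha' k : 0 < alpha k <= step_bound M `|Vmax| beta K.
  have /andP[h1 h2] := ha k.
  by rewrite (lt_le_trans amin0 h1) (le_trans h2 aC).
have [h1 h2 h3 h4 h5] :=
  scheme_dissipation oO OM hd M0 W0 mV VW hbeta mu0 uK ha' n.
split; [exact: h1|exact: ler_wsqrtr|exact: ler_wsqrtr|exact: ler_wsqrtr|].
apply: le_trans h5; rewrite sqr_sqrtr; last exact: H01_inner_ge0.
apply: ler_wpM2r; first exact: H01_inner_ge0.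
by have /andP[h _] := ha n; rewrite ler_wpM2r ?invr_ge0.
Qed.
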